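(* Let $K$, $X=\Omega/\Gamma$, $\omega$, $|\omega|$, $S$, $\bar S$, $f$ and $\mathcal{H}_f$ be as in the context, and assume $S=V(\omega)\subset V(f)$, with all zeros of $\omega$ and all zeros and poles of $f$ $K$-rational. Then there exists a probability measure $p_t(x,\cdot)$, $t\ge 0$, $x\in X(K)\setminus\bar S$, on the Borel $\sigma$-algebra of $X(K)\setminus\bar S$ such that the Cauchy problem for the heat equation $\left(\frac{\partial}{\partial t}-\mathcal{H}_f\right)h(t,x)=0$ ($t\ge0$, $x\in X(K)\setminus\bar S$) with initial condition $h(0,x)=h_0(x)\in C(X(K)\setminus\bar S)$ has a unique solution in $C^1((0,\infty),X(K)\setminus\bar S)$ of the form $h(t,x)=\int_{X(K)\setminus\bar S}h_0(y)\,p_t(x,|\omega(y)|)$ (i.e. integration of $h_0$ against the measure $p_t(x,\cdot)$). Moreover, $p_t(x,\cdot)$ is the transition function of a Markov process whose paths are right continuous and have no other discontinuities than jumps.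
   Context: $K$ is a non-archimedean local field with ring of integers $O_K$, uniformiser $\pi$, residue field of cardinality $p^f$, Haar measure $dx$ with $\mu(O_K)=1$, $|\pi|=p^{-f}$. $X=\Omega/\Gamma$ is a Mumford curve over $K$ of genus $g\ge2$: $\Gamma\subset\mathrm{PGL}_2(K)$ a Schottky group with limit set $\mathscr L$, $\Omega=\mathbb P^1\setminus\mathscr L$. $F\subset K$ is a good fundamental domain for $\Gamma$ acting on $\Omega(K)$. $\omega=w(z)\,dz$ is a regular differential $1$-form on $X$, inducing a positive Borel measure $|\omega|$ on $X(K)$, locally $|w(x)|\,dx$. $S=V(\omega)\subset\Omega(K)$ is the set of points of $\Omega$ over the zeros of $\omega$, $\bar S=S/\Gamma$. $f\in K(X)$ has zero set $V(f)$ and pole set $P(f)$ and is viewed as a $\Gamma$-invariant meromorphic function on $\Omega$. Let $T_S$ be the skeleton of the Berkovich space $F^{an}\setminus S$ and $\sigma_F:F^{an}\setminus S\to T_S$ the retraction; for $A\subseteq F(K)\setminus S$ let $U(A)=\sigma_F^{-1}(\sigma_F(A))\cap F(K)$. For $x,y\in F\setminus(\mathscr L\cup S)$ put $H(x,y)=|f(x-y)|$ if $x-y\notin U(P(f))$ and $H(x,y)=1$ otherwise, regarded as a $\Gamma$-periodic function on $(X(K)\setminus\bar S)^2$. The Laplacian operator is $\mathcal{H}_f\psi(x)=\int_{X(K)\setminus\bar S}H(x,y)(\psi(y)-\psi(x))\,|\omega(y)|$. *)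

(* Defs.v *)
From HB Require Import structures.
From mathcomp Require Import all_boot all_order all_algebra.
From mathcomp Require Import all_classical all_reals all_analysis.
From mathcomp Require Import measurable_realfun.

Set Implicit Arguments.
Unset Strict Implicit.
Unset Printing Implicit Defensive.

Import Order.TTheory GRing.Theory Num.Theory.
Import numFieldNormedType.Exports.

Local Open Scope classical_set_scope.
Local Open Scope ring_scope.

Record nafield (R : realType) := NAField {
  na_sort :> fieldType;
  na_abs : na_sort -> R;
  na_abs_ge0 : forall x, 0 <= na_abs x;
  na_abs_eq0 : forall x, na_abs x = 0 -> x = 0;
  na_absM : forall x y, na_abs (x * y) = na_abs x * na_abs y;
  na_abs1 : na_abs 1 = 1;
  na_abs0 : na_abs 0 = 0;
  na_absD : forall x y, na_abs (x + y) <= Num.max (na_abs x) (na_abs y) }.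

(* The carrier under a name of its own, so that it can be given the topology
   defined by the absolute value. *)
Definition line (R : realType) (F : nafield R) : Type := na_sort F.

HB.instance Definition _ (R : realType) (F : nafield R) :=
  GRing.Field.on (line F).
HB.instance Definition _ (R : realType) (F : nafield R) :=
  isPointed.Build (line F) 0.

Definition absv (R : realType) (F : nafield R) (x : line F) : R := na_abs x.

Definition line_open (R : realType) (F : nafield R) (U : set (line F)) :=
  forall a, U a ->
    exists2 r : R, 0 < r & forall z, absv (z - a) < r -> U z.

Lemma line_openT (R : realType) (F : nafield R) : line_open [set: line F].
Proof. by move=> a _; exists 1. Qed.

Lemma line_openI (R : realType) (F : nafield R) (A B : set (line F)) :
  line_open A -> line_open B -> line_open (A `&` B).
Proof.
move=> oA oB a [/oA[r r0 rA] /oB[s s0 sB]].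
exists (Num.min r s); first by rewrite lt_min r0 s0.
by move=> z; rewrite lt_min => /andP[zr zs]; split; [exact: rA|exact: sB].
Qed.

Lemma line_open_bigU (R : realType) (F : nafield R) (I : Type)
    (f : I -> set (line F)) :
  (forall i, line_open (f i)) -> line_open (\bigcup_i f i).
Proof.
by move=> of_ a [i _ /of_[r r0 rf]]; exists r => // z /rf ?; exists i.
Qed.

HB.instance Definition _ (R : realType) (F : nafield R) :=
  isOpenTopological.Build (line F) (@line_openT R F) (@line_openI R F)
    (@line_open_bigU R F).

Definition na_complete (R : realType) (F : nafield R) :=
  forall u : nat -> line F,
    (forall e : R, 0 < e -> exists N : nat, forall m n : nat,
       (N <= m)%N -> (N <= n)%N -> absv (u m - u n) < e) ->
    exists l : line F, u @ \oo --> l.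

(* Local field with uniformiser [pi], residue field of cardinality [p ^ f] and
   normalised absolute value; [e] enumerates representatives of the residue
   classes. *)
Definition local_field (R : realType) (F : nafield R) (p f : nat)
    (pi : line F) :=
  [/\ na_complete F,
      prime p /\ (0 < f)%N,
      absv pi = ((p ^ f)%:R)^-1,
      forall x : line F, absv x < 1 -> absv x <= absv pi &
      exists e : 'I_(p ^ f) -> line F,
        (forall i, absv (e i) <= 1) /\
        forall x : line F, absv x <= 1 ->
          exists! i : 'I_(p ^ f), absv (x - e i) < 1].

(* [C] is the completion of an algebraic closure of [F]. *)
Definition completed_closure (R : realType) (F C : nafield R)
    (iota : {rmorphism line F -> line C}) :=
  [/\ forall x : line F, absv (iota x) = absv x,
      GRing.closed_field_axiom (line C),
      na_complete C &
      forall (x : line C) (e : R), 0 < e ->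
        exists2 y : line C, algebraicOver iota y & absv (x - y) < e].

Definition P1 (R : realType) (F : nafield R) : Type := option (line F).

HB.instance Definition _ (R : realType) (F : nafield R) := Choice.on (P1 F).

Definition P1_open (R : realType) (F : nafield R) (U : set (P1 F)) :=
  open [set z : line F | U (Some z)] /\
  (U None -> exists r : R, forall z : line F, r < absv z -> U (Some z)).

Lemma P1_openT (R : realType) (F : nafield R) : P1_open [set: P1 F].
Proof. by split; [exact: openT|move=> _; exists 0]. Qed.

Lemma P1_openI (R : realType) (F : nafield R) (A B : set (P1 F)) :
  P1_open A -> P1_open B -> P1_open (A `&` B).
Proof.
move=> [oA iA] [oB iB]; split; first exact: openI.
move=> [/iA[r rA] /iB[s sB]]; exists (Num.max r s) => z.
by rewrite gt_max => /andP[zr zs]; split; [exact: rA|exact: sB].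
Qed.

Lemma P1_open_bigU (R : realType) (F : nafield R) (I : Type)
    (f : I -> set (P1 F)) :
  (forall i, P1_open (f i)) -> P1_open (\bigcup_i f i).
Proof.
move=> of_; split; last first.
  by move=> [i _ /(of_ i).2[r rf]]; exists r => z /rf ?; exists i.
rewrite (_ : [set z | _] = \bigcup_i [set z : line F | f i (Some z)]).
  by apply: bigcup_open => i _; exact: (of_ i).1.
by apply/seteqP; split=> z [i _ ?]; exists i.
Qed.

HB.instance Definition _ (R : realType) (F : nafield R) :=
  isOpenTopological.Build (P1 F) (@P1_openT R F) (@P1_openI R F)
    (@P1_open_bigU R F).

Definition mobius (R : realType) (F : nafield R) (A : 'M[line F]_2)
    (z : P1 F) : P1 F :=
  match z with
  | Some z => if A 1 0 * z + A 1 1 == 0 then None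
              else Some ((A 0 0 * z + A 0 1) / (A 1 0 * z + A 1 1))
  | None => if A 1 0 == 0 then None else Some (A 0 0 / A 1 0)
  end.

(* A subgroup of PGL_2 is encoded by its full preimage in GL_2. *)
Definition pgl_subgroup (F : fieldType) (G : set 'M[F]_2) :=
  [/\ forall A, G A -> A \in unitmx,
      forall c : F, c != 0 -> G c%:M,
      forall A B, G A -> G B -> G (A *m B) &
      forall A, G A -> G (invmx A)].

Definition word_mx (F : fieldType) (g : nat) (gam : 'I_g -> 'M[F]_2)
    (s : seq ('I_g * bool)) : 'M[F]_2 :=
  \prod_(l <- s) (if l.2 then gam l.1 else invmx (gam l.1)).

Definition pgl_generated (F : fieldType) (G : set 'M[F]_2) (g : nat)
    (gam : 'I_g -> 'M[F]_2) :=
  (forall i, G (gam i)) /\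
  forall A, G A -> exists (c : F) (s : seq ('I_g * bool)),
    c != 0 /\ A = c *: word_mx gam s.

Definition reduced_word (g : nat) (s : seq ('I_g * bool)) :=
  sorted (fun l m => (l.1 != m.1) || (l.2 == m.2)) s.

Definition pgl_free_basis (F : fieldType) (G : set 'M[F]_2) (g : nat)
    (gam : 'I_g -> 'M[F]_2) :=
  pgl_generated G gam /\
  forall s, s != [::] -> reduced_word s -> ~~ is_scalar_mx (word_mx gam s).

Definition orbit_space (R : realType) (F : nafield R) (G : set 'M[line F]_2)
    (V : set (P1 F)) (v0 : V) : Type :=
  set_type [set O : set (P1 F) |
    exists2 z, V z & O = [set mobius A z | A in G]].

Section OrbitSpace.
Context (R : realType) (F : nafield R) (G : set 'M[line F]_2).
Context (V : set (P1 F)) (v0 : V).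

HB.instance Definition _ := Choice.on (orbit_space G v0).

Definition orbit_class (z : V) : orbit_space G v0 :=
  exist _ [set mobius A (val z) | A in G]
    (mem_set (ex_intro2 _ _ (val z) (set_mem (valP z)) erefl)).

(* Quotient topology of the subspace topology of [V]. *)
Definition orbit_space_open (U : set (orbit_space G v0)) :=
  open (orbit_class @^-1` U).

Lemma orbit_space_openT : orbit_space_open setT.
Proof. by rewrite /orbit_space_open preimage_setT; exact: openT. Qed.

Lemma orbit_space_openI (A B : set (orbit_space G v0)) :
  orbit_space_open A -> orbit_space_open B -> orbit_space_open (A `&` B).
Proof. by move=> ? ?; exact: openI. Qed.

Lemma orbit_space_open_bigU (I : Type) (f : I -> set (orbit_space G v0)) :
  (forall i, orbit_space_open (f i)) -> orbit_space_open (\bigcup_i f i).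
Proof. by move=> of_; apply: bigcup_open => i _; exact: of_. Qed.

HB.instance Definition _ := isOpenTopological.Build (orbit_space G v0)
  orbit_space_openT orbit_space_openI orbit_space_open_bigU.
HB.instance Definition _ := isPointed.Build (orbit_space G v0) (orbit_class v0).

End OrbitSpace.

Definition borel (T : ptopologicalType) := g_sigma_algebraType (@open T).

Definition haar_measure (R : realType) (F : nafield R)
    (mu : {measure set (borel (line F)) -> \bar R}) :=
  mu [set x : line F | absv x <= 1] = 1%E /\
  forall (a : line F) (B : set (borel (line F))), measurable B ->
    mu [set a + x | x in (B : set (line F))] = mu B.

Section Curve.
Context (R : realType) (K C : nafield R).
Context (iota : {rmorphism line K -> line C}).

Definition mobiusC (A : 'M[line K]_2) (z : P1 C) : P1 C :=
  mobius (map_mx iota A) z.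

Definition P1_inj (z : P1 K) : P1 C := omap iota z.

Definition K_rational (A : set (P1 C)) := A `<=` range P1_inj.

(* Distinct elements of PGL_2 are matrices that are not proportional. *)
Definition limit_set (G : set 'M[line K]_2) : set (P1 C) :=
  [set a | exists (q : P1 C) (u : nat -> 'M[line K]_2),
     [/\ forall n, G (u n),
         forall m n, m <> n -> forall c : line K, u m <> c *: u n &
         (fun n => mobiusC (u n) q) @ \oo --> a]].

Definition discontinuous (G : set 'M[line K]_2) :=
  limit_set G <> setT /\
  forall q : P1 C, compact (closure [set mobiusC A q | A in G]).

Definition schottky (G : set 'M[line K]_2) :=
  [/\ pgl_subgroup G,
      exists (n : nat) (gam : 'I_n -> 'M[line K]_2), pgl_generated G gam,
      discontinuous G &
      forall A, G A -> forall n : nat, (0 < n)%N ->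
        is_scalar_mx (A ^+ n) -> is_scalar_mx A].

(* [Disc false a c] stands for the disc of centre [a] and radius |c|, and
   [Disc true a c] for the disc around infinity of all z such that |z - a|
   exceeds |c|. *)
Record disc := Disc {
  d_infty : bool;
  d_center : line K;
  d_radius : line K }.

Definition open_disc (d : disc) : set (P1 C) := [set z |
  match z with
  | Some z => if d_infty d then absv (d_radius d) < absv (z - iota (d_center d))
              else absv (z - iota (d_center d)) < absv (d_radius d)
  | None => d_infty d
  end].

Definition closed_disc (d : disc) : set (P1 C) := [set z |
  match z with
  | Some z => if d_infty d then absv (d_radius d) <= absv (z - iota (d_center d))
              else absv (z - iota (d_center d)) <= absv (d_radius d)
  | None => d_infty d
  end].

Definition affinoid (A : set (P1 C)) :=
  exists (n : nat) (D : 'I_n -> disc),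
    (forall i, d_radius (D i) != 0) /\
    A = ~` \bigcup_i open_disc (D i).

(* Rational functions over K are written P / Q. *)
Definition rat_regular (A : set (P1 C)) (P Q : {poly line K}) :=
  Q != 0 /\
  forall z, A z ->
    match z with
    | Some z => (map_poly iota Q).[z] != 0
    | None => (size P <= size Q)%N
    end.

Definition rat_eval (P Q : {poly line K}) (z : P1 C) : line C :=
  match z with
  | Some z => (map_poly iota P).[z] / (map_poly iota Q).[z]
  | None => iota (P`_(size Q).-1 / lead_coef Q)
  end.

(* Analytic functions on an affinoid, with coefficients in K: uniform limits
   of rational functions over K without poles on it. *)
Definition analytic_on (A : set (P1 C)) (h : P1 C -> line C) :=
  forall e : R, 0 < e -> exists P Q : {poly line K},
    rat_regular A P Q /\ forall z, A z -> absv (h z - rat_eval P Q z) < e.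

Definition analytic (U : set (P1 C)) (h : P1 C -> line C) :=
  forall A, affinoid A -> A `<=` U -> analytic_on A h.

(* The functions are valued in the projective line, [None] being the value at
   the poles.  The ring of an affinoid of the kind above is a principal ideal
   domain, whence the coprime quotients. *)
Definition meromorphic (U : set (P1 C)) (f : P1 C -> P1 C) :=
  forall A, affinoid A -> A `<=` U -> A !=set0 ->
    exists h1 h2 : P1 C -> line C,
      [/\ analytic_on A h1, analytic_on A h2,
          exists2 z, A z & h2 z != 0 &
          forall z, A z -> ((h1 z != 0) || (h2 z != 0)) /\
            f z = if h2 z == 0 then None else Some (h1 z / h2 z)].

Section Group.
Context (G : set 'M[line K]_2).

Definition Omega : set (P1 C) := ~` limit_set G.

(* The function field K(X) of X = Omega / G. *)
Definition function_field (f : P1 C -> P1 C) :=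
  meromorphic Omega f /\
  forall A z, G A -> Omega z -> f (mobiusC A z) = f z.

Definition zero_set (f : P1 C -> P1 C) : set (P1 C) :=
  [set z | Omega z /\ f z = Some 0].

Definition pole_set (f : P1 C -> P1 C) : set (P1 C) :=
  [set z | Omega z /\ f z = None].

(* w(z) dz; its regularity at infinity, when infinity is in Omega, is a
   consequence of the invariance under G, because the orbit of infinity then
   has finite points. *)
Definition regular_differential (w : line C -> line C) :=
  analytic (Omega `\ None) (fun z => if z is Some z then w z else 0) /\
  forall A (z z' : line C), G A -> Omega (Some z) ->
    mobiusC A (Some z) = Some z' ->
    w z' * (iota (\det A) / (iota (A 1 0) * z + iota (A 1 1)) ^+ 2) = w z.

(* At infinity the form is pulled back from a finite point of the orbit. *)
Definition zeros_form (w : line C -> line C) : set (P1 C) :=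
  [set z | Omega z /\
     exists (A : 'M[line K]_2) (z' : line C),
       [/\ G A, mobiusC A z = Some z' & w z' = 0]].

Definition OmegaK_minus (S : set (P1 C)) : set (P1 K) :=
  [set z | Omega (P1_inj z) /\ ~ S (P1_inj z)].

(* The measure |omega| is locally |w(x)| dx: on each Borel set of K that is
   mapped injectively to the curve it is given by the density |w|. *)
Definition abs_form_measure (S : set (P1 C)) (v0 : OmegaK_minus S)
    (w : line C -> line C)
    (mu : {measure set (borel (line K)) -> \bar R})
    (nu : {measure set (borel (orbit_space G v0)) -> \bar R}) :=
  forall B : set (borel (line K)), measurable B ->
    [set (Some z : P1 K) | z in B] `<=` OmegaK_minus S ->
    {in [set v : OmegaK_minus S | exists2 z, B z & val v = Some z] &,
      injective (@orbit_class _ _ G _ v0)} ->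
    nu (@orbit_class _ _ G _ v0 @`
          [set v : OmegaK_minus S | exists2 z, B z & val v = Some z]) =
    (\int[mu]_(z in B) (absv (w (iota z)))%:E)%E.

(* Complement in P^1 of 2g open discs, the generator [gam i] mapping the
   exterior of [D false i] to the disc [D true i]. *)
Definition good_domain (g : nat) (gam : 'I_g -> 'M[line K]_2)
    (D : bool -> 'I_g -> disc) :=
  [/\ pgl_free_basis G gam,
      forall b i, d_radius (D b i) != 0,
      forall b i b' i', (b, i) <> (b', i') ->
        closed_disc (D b i) `&` closed_disc (D b' i') = set0,
      forall i, mobiusC (gam i) @` (~` open_disc (D false i)) =
                closed_disc (D true i) &
      forall i, mobiusC (gam i) @` (~` closed_disc (D false i)) =
                open_disc (D true i)].

End Group.

Definition domain (g : nat) (D : bool -> 'I_g -> disc) : set (P1 C) :=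
  ~` \bigcup_b \bigcup_i open_disc (D b i).

Definition domainK (g : nat) (D : bool -> 'I_g -> disc) : set (line K) :=
  [set z | domain D (P1_inj (Some z))].

(* The boundary circles of [domain] are identified in pairs by the generators;
   dropping one circle of each pair leaves exactly one representative of each
   orbit of K-points. *)
Definition strict_domainK (g : nat) (D : bool -> 'I_g -> disc) :
    set (line K) :=
  [set z | domainK D z /\
     forall i, ~ closed_disc (D false i) (P1_inj (Some z))].

(* Points of the Berkovich affine line over C. *)
Definition mult_seminorm (x : {poly line C} -> R) :=
  [/\ forall c : line C, x c%:P = absv c,
      forall P Q, x (P * Q) = x P * x Q &
      forall P Q, x (P + Q) <= Num.max (x P) (x Q)].

Definition eval_point (z : line C) : {poly line C} -> R :=
  fun P => absv P.[z].

Definition berk_disc (a : line C) (r : R) : set ({poly line C} -> R) :=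
  [set x | mult_seminorm x /\ x ('X - a%:P) < r].

(* Sup-norm on the disc of centre [a] and radius [r], read off the Taylor
   coefficients at [a]: the boundary point of [berk_disc a r]. *)
Definition gauss_point (a : line C) (r : R) : {poly line C} -> R :=
  fun P => \big[Num.max/0]_(i < size P) (absv (P \Po ('X + a%:P))`_i * r ^+ i).

Section Skeleton.
Context (g : nat) (D : bool -> 'I_g -> disc) (S : set (P1 C)).

(* F^an without S.  It lies in the affine line when infinity is not in F. *)
Definition domain_an_minus : set ({poly line C} -> R) :=
  [set x | [/\ mult_seminorm x,
     forall b i,
       if d_infty (D b i)
       then x ('X - (iota (d_center (D b i)))%:P) <= absv (d_radius (D b i))
       else absv (d_radius (D b i)) <= x ('X - (iota (d_center (D b i)))%:P) &
     forall s, S (Some s) -> x <> eval_point s]].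

(* Analytic skeleton: the points that have no neighbourhood isomorphic to an
   open disc. *)
Definition skeleton : set ({poly line C} -> R) :=
  [set x | domain_an_minus x /\
     ~ exists (a : line C) (r : R),
         [/\ 0 < r, berk_disc a r x & berk_disc a r `<=` domain_an_minus]].

(* A point of the skeleton is fixed; any other point is sent to the boundary
   point of the largest open disc around it, which is the only disc whose
   boundary point is on the skeleton. *)
Definition retraction (x : {poly line C} -> R) : {poly line C} -> R :=
  xget x [set y | skeleton y /\
    (x = y \/ exists (a : line C) (r : R),
       [/\ 0 < r, berk_disc a r x, berk_disc a r `<=` domain_an_minus &
           y = gauss_point a r])].

Definition U_nbhd (A : set (line K)) : set (line K) :=
  [set z | [/\ domainK D z, ~ S (P1_inj (Some z)) &
    (retraction @` [set eval_point (iota a) | a in A])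
      (retraction (eval_point (iota z)))]].

End Skeleton.

Section Operator.
Context (G : set 'M[line K]_2) (g : nat) (D : bool -> 'I_g -> disc).
Context (S : set (P1 C)) (f : P1 C -> P1 C).

Definition polesK : set (line K) :=
  [set z | domainK D z /\ pole_set G f (P1_inj (Some z))].

(* As f is G-invariant, x - y is taken modulo G: the cut-off applies when the
   orbit of x - y meets U(P(f)). *)
Definition near_poles (z : line K) :=
  exists (A : 'M[line K]_2) (u : line K),
    [/\ G A, U_nbhd D S polesK u & mobius A (Some u) = Some z].

(* Differences that are in the limit set, where f is not defined, are given
   the value 1. *)
Definition kernel_of_difference (z : line K) : R :=
  if `[< Omega G (P1_inj (Some z)) /\ ~ near_poles z >]
  then (if f (P1_inj (Some z)) is Some c then absv c else 1)
  else 1.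

Context (v0 : OmegaK_minus G S).

Definition strict_repr (x : orbit_space G v0) : line K :=
  xget 0 [set z | strict_domainK D z /\ val x (Some z)].

Definition kernelH (x y : orbit_space G v0) : R :=
  kernel_of_difference (strict_repr x - strict_repr y).

Definition laplacian
    (nu : {measure set (borel (orbit_space G v0)) -> \bar R})
    (psi : orbit_space G v0 -> R) (x : orbit_space G v0) : R :=
  \int[nu]_y (kernelH x y * (psi y - psi x)).

End Operator.

End Curve.

Section Evolution.
Context (R : realType) (X : ptopologicalType).

(* C(X) as the Banach space with the supremum norm. *)
Definition bounded_continuous (h : X -> R) :=
  continuous h /\ exists M : R, forall x, `|h x| <= M.

(* h is a C^1 curve in C(X) on (0, +oo); the equation holds for all t >= 0,
   with a right derivative at 0 (in particular h is continuous at 0). *)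
Definition cauchy_solution (L : (X -> R) -> X -> R) (h0 : X -> R)
    (h : R -> X -> R) :=
  [/\ forall t, 0 <= t -> bounded_continuous (h t),
      h 0 = h0,
      forall t : R, 0 <= t ->
        {uniform, (fun s : R => (s - t)^-1 *: (h s - h t))
                    @ within [set s : R | 0 <= s] t^' --> L (h t)} &
      forall t : R, 0 < t -> {uniform, (fun s : R => L (h s)) @ t --> L (h t)}].

Context (p : R -> X -> probability (borel X) R).

Definition transition_function :=
  [/\ forall (t : R) (B : set (borel X)), 0 <= t -> measurable B ->
        measurable_fun setT ((fun x => p t x B) : borel X -> \bar R),
      forall (x : X) (B : set (borel X)), measurable B ->
        p 0 x B = \d_(x : borel X) B &
      forall (s t : R) (x : X) (B : set (borel X)),
        0 <= s -> 0 <= t -> measurable B ->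
        p (s + t) x B = (\int[p s x]_y p t y B)%E].

Definition past (W : Type) (Y : R -> W -> X) (s : R) : set (set W) :=
  <<s \bigcup_(u in `[0, s]) preimage_set_system setT (Y u : W -> borel X)
        measurable >>.

(* [Px x] is the law of the process started at x; the last clause is
   P_x(Y_(s+t) \in A | past s) = p_t(Y_s, A). *)
Definition markov_process (d : measure_display) (W : measurableType d)
    (Px : X -> probability W R) (Y : R -> W -> X) :=
  [/\ forall t, 0 <= t -> measurable_fun setT (Y t : W -> borel X),
      forall x, Px x (Y 0 @^-1` [set x]) = 1%E,
      forall (t : R) (x : X) (A : set (borel X)), 0 <= t -> measurable A ->
        Px x (Y t @^-1` A) = p t x A &
      forall (s t : R) (x : X) (A : set (borel X)) (B : set W),
        0 <= s -> 0 <= t -> measurable A -> past Y s B ->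
        Px x (B `&` Y (s + t) @^-1` A) = (\int[Px x]_(o in B) p t (Y s o) A)%E].

Definition right_continuous_with_jumps (W : Type) (Y : R -> W -> X) :=
  forall o : W,
    (forall t : R, 0 <= t -> (fun s => Y s o) @ t^'+ --> Y t o) /\
    (forall t : R, 0 < t -> exists l : X, (fun s => Y s o) @ t^'- --> l).

End Evolution.

(* Main.v *)
(* The Laplacian is a bounded operator.  The K-points of the strict fundamental
   domain represent each orbit exactly once: uniqueness is a ping-pong argument,
   and existence holds because the discs met along the itinerary of a point that
   never enters the domain shrink, the value group being discrete, so that the
   point is a limit point.  The domain lies in a compact ball of K, so |omega| is
   finite, and |f| is bounded outside the neighbourhood of its poles.  Hence the
   Laplacian is lam (Q - 1) for a probability kernel Q obtained by thinning
   |omega|, and the process is the jump process with exponential holding times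
   and jump kernel Q; its transition semigroup solves the Cauchy problem, with
   uniqueness by a Gronwall argument in the sup norm.  The kernel H is only
   measurable; the Laplacian preserves continuity because translating the
   variable of integration in K moves the dependence on x to the density |w|. *)
Require Import Defs.
From HB Require Import structures.
From mathcomp Require Import all_boot all_order all_algebra.
From mathcomp Require Import all_classical all_reals all_analysis.
From mathcomp Require Import measurable_realfun.
From mathcomp Require Import ring lra.

Set Implicit Arguments.
Unset Strict Implicit.
Unset Printing Implicit Defensive.

Import Order.TTheory GRing.Theory Num.Theory.
Import numFieldNormedType.Exports.

Local Open Scope classical_set_scope.
Local Open Scope ring_scope.

(** * Markov chains on path space *)

(** The total mass of the kernel at x varies with x, whereas one exponential clock needs one rate.
    Letting rejected moves stay put makes the rate constant, [nu] of the curve times a bound of the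
    kernel, so that all holding times share one law, of which only the tail is used. Since paths are
    wanted, the semigroup comes from path space and not from the exponential series of the
    generator. The price is that its kernels are at first merely measurable. Analysis is regained
    from a single expansion at short times, with an error of order t^2 uniform in x, read off the
    first jump: with the semigroup law it gives differentiability in the sup norm, and products of
    Euler steps give continuity in x. On the arithmetic side the curve is carried into the line by
    its representatives in the strict domain, an injective continuous map under which [nu] becomes a
    continuous density on a ball. That ball is an additive group, which is why Haar measure can be
    translated inside it. Rationality of the zeros of the form enters where a Berkovich disc has to
    avoid S, because continuity of w is available only along K-points. *)

Lemma bounded_integrable d (T : measurableType d) (R : realType)
    (mu : {measure set T -> \bar R}) (f : T -> \bar R) (M : R) :
  (mu setT < +oo)%E -> measurable_fun setT f ->
  (forall x, `|f x| <= M%:E)%E -> mu.-integrable setT f.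
Proof.
move=> muT mf fM; apply/integrableP; split => //.
apply: (@le_lt_trans _ _ (\int[mu]_x (cst `|M|%:E x))%E).
  apply: ge0_le_integral => //.
  - by apply: measurableT_comp.
  - by move=> x _; rewrite (le_trans (fM x))// lee_fin ler_norm.
by rewrite integral_cst// lte_mul_pinfty// lee_fin.
Qed.

Definition image_measure d d' (T : measurableType d) (T' : measurableType d')
    (R : realType) (mu : {measure set T -> \bar R}) (f : T -> T')
    (mf : measurable_fun setT f) : {measure set T' -> \bar R} :=
  measure_function_pushforward__canonical__measure_function_Measure mu mf.

Lemma measurable_EFin_indic d (T : measurableType d) (R : realType) (D : set T) :
  measurable D -> measurable_fun setT (fun t => (\1_D t)%:E : \bar R).
Proof.
by move=> mD; apply/measurable_EFinP; rewrite (_ : \1_D = mindic R mD).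
Qed.

(** * Sequences with the product sigma-algebra, and their cylinders *)

Section PathSpace.
Context d (S : measurableType d).

Definition coordinate_sets : set (set (nat -> S)) :=
  \bigcup_i preimage_set_system setT (fun w : nat -> S => w i) measurable.

Definition paths := g_sigma_algebraType coordinate_sets.

Definition scons (s : S) (w : paths) : paths :=
  fun n => if n is m.+1 then w m else s.

Lemma measurable_coord (i : nat) :
  measurable_fun setT (fun w : paths => w i).
Proof.
move=> _ B mB; rewrite setTI; apply: sub_sigma_algebra.
by exists i => //; exists B => //; rewrite setTI.
Qed.

Lemma measurable_fun_paths d' (T : measurableType d') (f : T -> paths) :
  (forall i, measurable_fun setT (fun t => f t i)) -> measurable_fun setT f.
Proof.
move=> mf; apply: (@measurability _ _ T paths setT f coordinate_sets erefl) => // _ [_ [i _ [B mB <-]] <-].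
rewrite setTI; rewrite [X in measurable X](_ : _ = setT `&` (f ^~ i) @^-1` B).
  exact: mf.
by rewrite !setTI.
Qed.

Lemma measurable_scons d' (T : measurableType d') (f : T -> S) (h : T -> paths) :
  measurable_fun setT f -> measurable_fun setT h ->
  measurable_fun setT (fun t => scons (f t) (h t)).
Proof.
move=> mf mh; apply: measurable_fun_paths => -[|i] //=.
exact: (measurableT_comp (measurable_coord i) mh).
Qed.

Lemma measurable_scons1 (s : S) : measurable_fun setT (scons s).
Proof.
apply: measurable_fun_paths => -[|i] /=; first exact: measurable_cst.
exact: measurable_coord.
Qed.

HB.instance Definition _ s :=
  isMeasurableFun.Build _ _ _ _ (scons s) (measurable_scons1 s).

Definition depends_on (n : nat) (C : set paths) :=
  forall w w' : paths, (forall i, (i < n)%N -> w i = w' i) -> C w -> C w'.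

Lemma depends_onW n m C : (n <= m)%N -> depends_on n C -> depends_on m C.
Proof.
by move=> nm dC w w' ww'; apply: dC => i ni; exact/ww'/(leq_trans ni).
Qed.

Lemma depends_on_scons n s C :
  depends_on n.+1 C -> depends_on n (scons s @^-1` C).
Proof.
by move=> dC w w' ww'; apply: dC => -[|i] //=; rewrite ltnS; exact: ww'.
Qed.

Definition cylinder (C : set paths) := measurable C /\ exists n, depends_on n C.

Lemma cylinder0 : cylinder set0.
Proof. by split => //; exists 0%N. Qed.

Lemma cylinderU A B : cylinder A -> cylinder B -> cylinder (A `|` B).
Proof.
move=> [mA [n nA]] [mB [m mB']]; split; first exact: measurableU.
exists (maxn n m) => w w' ww' [Aw|Bw]; [left|right].
  by apply: (depends_onW (leq_maxl n m) nA) Aw.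
by apply: (depends_onW (leq_maxr n m) mB') Bw.
Qed.

Lemma cylinderC A : cylinder A -> cylinder (~` A).
Proof.
move=> [mA [n nA]]; split; first exact: measurableC.
by exists n => w w' ww' nAw Aw'; apply: nAw; apply: nA Aw' => i ni; rewrite ww'.
Qed.

Lemma cylinderI A B : cylinder A -> cylinder B -> cylinder (A `&` B).
Proof.
move=> cA cB; rewrite -[A]setCK -[B]setCK -setCU.
by apply: cylinderC; apply: cylinderU; exact: cylinderC.
Qed.

Lemma cylinderD A B : cylinder A -> cylinder B -> cylinder (A `\` B).
Proof. by move=> cA cB; rewrite setDE; apply: cylinderI => //; exact: cylinderC. Qed.

Lemma cylinder_scons s C : cylinder C -> cylinder (scons s @^-1` C).
Proof.
move=> [mC [n nC]]; split.
  by rewrite -[X in measurable X]setTI; exact: measurable_scons1.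
by exists n; apply: depends_on_scons; exact: depends_onW (leqnSn n) nC.
Qed.

(** A synonym of [paths], so that the algebra of cylinders can be a structure of its own beside the
    sigma-algebra of [paths]; the extension of measures starts from it. *)
Definition cylinder_algebra := paths.
HB.instance Definition _ := Pointed.on cylinder_algebra.
HB.instance Definition _ := @isAlgebraOfSets.Build (sigma_display coordinate_sets)
  cylinder_algebra cylinder cylinder0 cylinderU cylinderC.

Lemma measurable_cylindersE :
  (measurable : set (set paths)) = <<s cylinder >>.
Proof.
apply/seteqP; split; last first.
  by apply: smallest_sub; [exact: sigma_algebra_measurable|move=> C []].
apply: smallest_sub; first exact: smallest_sigma_algebra.
move=> _ [i _ [B mB <-]]; apply: sub_sigma_algebra; split.
  exact: measurable_coord.
by exists i.+1 => w w' ww' [_ Bw]; split => //; rewrite /= -ww'.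
Qed.

End PathSpace.

Section PullbackKernel.
Context d d1 d2 (T : measurableType d) (X : measurableType d1)
  (Y : measurableType d2) (R : realType) (k : R.-pker X ~> Y) (h : T -> X)
  (mh : measurable_fun setT h).

(** The measurability proof is a phantom argument: through it the kernel structure is attached to
    the pulled-back family, and results on measurability of fibre integrals apply with [T] as
    parameter space. *)
Definition kpullback of measurable_fun setT h :=
  fun t : T => k (h t) : {measure set Y -> \bar R}.
Let kp := kpullback mh.

Let mkp U : measurable U -> measurable_fun setT (kp ^~ U).
Proof. by move=> mU; exact: measurableT_comp (measurable_kernel k U mU) mh. Qed.
HB.instance Definition _ := isKernel.Build _ _ _ _ _ kp mkp.

Let kp1 t : kp t setT = 1%E. Proof. exact: prob_kernel. Qed.
HB.instance Definition _ := Kernel_isProbability.Build _ _ _ _ _ kp kp1.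

Lemma measurable_integral_pullback (f : T * Y -> \bar R) :
  (forall z, 0 <= f z)%E -> measurable_fun setT f ->
  measurable_fun setT (fun t => \int[k (h t)]_y f (t, y))%E.
Proof. by move=> f0 mf; exact: (measurable_fun_integral_finite_kernel f kp). Qed.

Lemma measurable_xsection_pullback (C : set (T * Y)) : measurable C ->
  measurable_fun setT (fun t => k (h t) (xsection C t)).
Proof.
move=> mC; apply: (measurable_fun_xsection_finite_kernel kp).
by rewrite inE.
Qed.

End PullbackKernel.

(** * The Ionescu-Tulcea theorem for a time-homogeneous chain *)

Section IonescuTulcea.
Context d d' (X : measurableType d) (S : measurableType d') (R : realType).
Variables (k : R.-pker X ~> S) (nxt : S -> X).
Hypothesis mnxt : measurable_fun setT nxt.
Local Open Scope ereal_scope.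

Local Notation path := (paths S).

(* The chain stopped after [n] steps, continued by a constant path. *)
Fixpoint stopped n (x : X) (C : set path) : \bar R :=
  if n is m.+1 then \int[k x]_s stopped m (nxt s) (scons s @^-1` C)
  else \d_(point : path) C.

Lemma stopped_ge0 n x C : 0 <= stopped n x C.
Proof.
elim: n x C => [|n IH] x C /=; first by rewrite diracE lee_fin ler0n.
by apply: integral_ge0 => s _; exact: IH.
Qed.

(** The parameter [t] occurs in the start and in the set, because the induction turns each drawn
    symbol into a new parameter, replacing [T] by [T * S]. *)
Lemma measurable_stopped n d0 (T : measurableType d0) (h : T -> X)
    (C : set (T * path)) : measurable_fun setT h -> measurable C ->
  measurable_fun setT (fun t => stopped n (h t) (xsection C t)).
Proof.
elim: n d0 T h C => [|n IH] d0 T h C mh mC /=.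
  apply: (eq_measurable_fun (fun t => (\1_C (t, point : path))%:E)).
    by move=> t _; rewrite diracE indicE mem_xsection.
  apply/measurable_EFinP; apply: measurableT_comp; last exact: pair2_measurable.
  by rewrite (_ : \1_C = mindic R mC).
pose C' := (fun u : T * S * path => (u.1.1, scons u.1.2 u.2)) @^-1` C.
have mC' : measurable C'.
  rewrite -[C']setTI; apply: (_ : measurable_fun setT _) => //.
  have m1 : measurable_fun setT (fun u : T * S * path => u.1).
    exact: measurable_fst.
  apply: measurable_fun_pair; first exact: (measurableT_comp measurable_fst m1).
  apply: measurable_scons; last exact: measurable_snd.
  exact: (measurableT_comp measurable_snd m1).
have mf := IH _ (T * S)%type (nxt \o snd) C'
  (measurableT_comp mnxt measurable_snd) mC'.
apply: (eq_measurable_fun (fun t => \int[k (h t)]_s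
   stopped n (nxt s) (xsection C' (t, s)))).
  move=> t _; apply: eq_integral => s _; congr stopped.
by apply: (measurable_integral_pullback _ mh _ mf) => z; exact: stopped_ge0.
Qed.

Lemma measurable_stopped_scons n C : measurable C ->
  measurable_fun setT (fun s => stopped n (nxt s) (scons s @^-1` C)).
Proof.
move=> mC; pose C' := (fun u : S * path => scons u.1 u.2) @^-1` C.
have mC' : measurable C'.
  rewrite -[C']setTI; apply: (_ : measurable_fun setT _) => //.
  by apply: measurable_scons; [exact: measurable_fst|exact: measurable_snd].
apply: eq_measurable_fun (measurable_stopped n mnxt mC') => s _.
by congr stopped; apply/seteqP; split=> w; rewrite /xsection /C' /= inE.
Qed.

Let mscons s (C : set path) : measurable C -> measurable (scons s @^-1` C).
Proof. by move=> mC; rewrite -[X in measurable X]setTI; exact: measurable_scons1. Qed.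

Lemma stoppedT n x : stopped n x setT = 1.
Proof.
elim: n x => [|n IH] x /=; first by rewrite diracT.
under eq_integral do rewrite preimage_setT IH.
by rewrite integral_cst// mul1e prob_kernel.
Qed.

Lemma stopped0 n x : stopped n x set0 = 0.
Proof.
elim: n x => [|n IH] x /=; first by rewrite dirac0.
by apply: integral0_eq => s _; rewrite preimage_set0 IH.
Qed.

Lemma stoppedU n x A B : measurable A -> measurable B -> A `&` B = set0 ->
  stopped n x (A `|` B) = stopped n x A + stopped n x B.
Proof.
elim: n x A B => [|n IH] x A B mA mB AB /=; first by rewrite measureU.
rewrite -ge0_integralD//; first last.
- exact: measurable_stopped_scons.
- by move=> *; exact: stopped_ge0.
- exact: measurable_stopped_scons.
- by move=> *; exact: stopped_ge0.
apply: eq_integral => s _; rewrite preimage_setU IH//; try exact: mscons.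
by rewrite -preimage_setI AB preimage_set0.
Qed.

(** The base case rests on the fact that a set depending on no coordinate is empty or full. It makes
    the choice of [n] in [cylinder_prob] immaterial. *)
Lemma stopped_stable n j x C : depends_on n C ->
  stopped (n + j) x C = stopped n x C.
Proof.
elim: n x C => [|n IH] x C dC; last first.
  by rewrite addSn /=; apply: eq_integral => s _; apply: IH; exact: depends_on_scons.
have [C0|/set0P[w Cw]] := eqVneq C set0; first by rewrite C0 !stopped0.
suff -> : C = setT by rewrite !stoppedT.
by apply/seteqP; split=> // w' _; apply: dC Cw.
Qed.

Definition cylinder_prob x (C : set path) : \bar R :=
  stopped (xget 0%N [set n | depends_on n C]) x C.

Lemma cylinder_probE n x C : depends_on n C -> cylinder_prob x C = stopped n x C.
Proof.
move=> dC; rewrite /cylinder_prob.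
case: xgetP => [m _ /= dmC|/(_ n)//].
have [mn|/ltnW nm] := leqP m n.
  by rewrite -(subnKC mn) stopped_stable.
by rewrite -(subnKC nm) stopped_stable.
Qed.

Lemma cylinder_prob_ge0 x C : 0 <= cylinder_prob x C.
Proof. exact: stopped_ge0. Qed.

Lemma cylinder_prob0 x : cylinder_prob x set0 = 0.
Proof. exact: stopped0. Qed.

Lemma cylinder_probT x : cylinder_prob x setT = 1.
Proof. exact: stoppedT. Qed.

Lemma cylinder_probU x A B : cylinder A -> cylinder B -> A `&` B = set0 ->
  cylinder_prob x (A `|` B) = cylinder_prob x A + cylinder_prob x B.
Proof.
move=> [mA [n nA]] [mB [m nB]] AB.
have nA' := depends_onW (leq_maxl n m) nA.
have nB' := depends_onW (leq_maxr n m) nB.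
rewrite (cylinder_probE x nA') (cylinder_probE x nB').
rewrite (@cylinder_probE (maxn n m)) ?stoppedU//.
by move=> w w' ww' [Aw|Bw]; [left; exact: nA' Aw|right; exact: nB' Bw].
Qed.

Lemma le_cylinder_prob x A B : cylinder A -> cylinder B -> A `<=` B ->
  cylinder_prob x A <= cylinder_prob x B.
Proof.
move=> cA cB AB; rewrite -(setDUK AB) cylinder_probU ?setDIK//.
  by rewrite leeDl// cylinder_prob_ge0.
exact: cylinderD.
Qed.

Lemma cylinder_prob_le1 x A : cylinder A -> cylinder_prob x A <= 1.
Proof.
move=> cA; rewrite -(cylinder_probT x); apply: le_cylinder_prob => //.
by rewrite -setC0; apply: cylinderC; exact: cylinder0.
Qed.

Lemma cylinder_prob_scons x C : cylinder C ->
  cylinder_prob x C = \int[k x]_s cylinder_prob (nxt s) (scons s @^-1` C).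
Proof.
move=> [mC [n nC]].
have nC' := depends_onW (leqnSn n) nC.
rewrite (cylinder_probE x nC') /=; apply: eq_integral => s _.
by rewrite (@cylinder_probE n)//; exact: depends_on_scons.
Qed.

Lemma measurable_cylinder_prob_scons C : cylinder C ->
  measurable_fun setT (fun s => cylinder_prob (nxt s) (scons s @^-1` C)).
Proof.
move=> [mC [n nC]]; apply: eq_measurable_fun (measurable_stopped_scons n mC).
move=> s _; rewrite (@cylinder_probE n)//.
by apply: depends_on_scons; exact: depends_onW (leqnSn n) nC.
Qed.

(** If every first symbol lost the bound at some index, the pointwise infimum [G] of the conditional
    probabilities would be below [e] everywhere. By dominated convergence its integral is at least
    [e], so the positive function [e - G] would have integral zero against a probability measure. *)
Lemma cylinder_prob_step x e (C : nat -> set path) :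
  (forall i, cylinder (C i)) -> (forall i j, (i <= j)%N -> C j `<=` C i) ->
  (forall i, e%:E <= cylinder_prob x (C i)) ->
  exists s, forall i, e%:E <= cylinder_prob (nxt s) (scons s @^-1` C i).
Proof.
move=> cC dC eC; apply: contrapT => /forallNP no.
pose g (i : nat) s := cylinder_prob (nxt s) (scons s @^-1` C i).
have g0 i s : 0 <= g i s by exact: cylinder_prob_ge0.
have g1 i s : g i s <= 1 by apply: cylinder_prob_le1; exact: cylinder_scons.
have mg i : measurable_fun setT (g i) by exact: measurable_cylinder_prob_scons.
have dg s : {homo g ^~ s : i j / (i <= j)%N >-> j <= i}.
  move=> i j ij; apply: le_cylinder_prob; try exact: cylinder_scons.
  by move=> w /= /(dC _ _ ij).
pose G s := ereal_inf (range (g ^~ s)).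
have gG s : g ^~ s @ \oo --> G s by exact: ereal_nonincreasing_cvgn.
have mG : measurable_fun setT G.
  apply: (emeasurable_fun_cvg g) => // s _; exact: gG.
have G0 s : 0 <= G s by apply: le_ereal_inf_tmp => _ [i _ <-]; exact: g0.
have [|||iG _ cG] := @dominated_convergence _ _ _ (k x) setT measurableT g G (cst 1) mg mG.
- by apply: aeW => s _; exact: gG.
- by apply: (@bounded_integrable _ _ _ _ _ 1) => //= [|s];
    rewrite ?prob_kernel ?ltry// normr1.
- by apply: aeW => s n _; rewrite gee0_abs.
have eG : e%:E <= \int[k x]_s G s.
  rewrite -(cvg_lim _ cG)//; apply: lime_ge; first exact: cvgP cG.
  by apply: nearW => n /=; rewrite -cylinder_prob_scons.
have Ge s : G s < e%:E.
  have [i /negP] : exists i, ~ (e%:E <= g i s) by apply/existsNP; exact: no.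
  rewrite -ltNge; apply: le_lt_trans.
  by apply: ereal_inf_lbound; exists i.
have ie : (k x).-integrable setT (cst e%:E).
  by apply: (@bounded_integrable _ _ _ _ _ `|e|) => //=; rewrite prob_kernel ltry.
have : \int[k x]_s (e%:E - G s) = 0.
  apply/eqP; rewrite eq_le integral_ge0 ?andbT//; last first.
    by move=> s _; rewrite ltW// sube_gt0.
  rewrite integralB//= integral_cst// prob_kernel mule1 sube_le0.
  exact: eG.
under eq_integral => s _ do
  rewrite -(@gee0_abs _ (e%:E - G s)) ?ltW ?sube_gt0//.
move/(ae_eq_integral_abs _ _) => [].
- exact: measurableT.
- exact: emeasurable_funB.
- move=> N [mN N0 subN].
have /eqP : k x setT = 0.
  apply/eqP; rewrite -measure_le0 -N0 le_measure ?inE// => s _.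
  apply: subN => /= /(_ I)/eqP; apply/negP.
  by rewrite gt_eqF// sube_gt0.
by rewrite prob_kernel onee_eq0.
Qed.

(** The heart of the extension. If the probabilities stayed above some [e > 0], iterating
    [cylinder_prob_step] would select symbols one after the other, and the resulting path would lie
    in all the sets. *)
Lemma cylinder_prob_cvg0 x (C : nat -> set path) :
  (forall i, cylinder (C i)) -> (forall i j, (i <= j)%N -> C j `<=` C i) ->
  \bigcap_i C i = set0 -> cylinder_prob x (C i) @[i --> \oo] --> 0.
Proof.
move=> cC dC C0.
have dcp : {homo (fun i => cylinder_prob x (C i)) : i j / (i <= j)%N >-> j <= i}.
  by move=> i j ij; apply: le_cylinder_prob => //; exact: dC.
suff <- : ereal_inf (range (fun i => cylinder_prob x (C i))) = 0.
  exact: ereal_nonincreasing_cvgn.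
apply/eqP; rewrite eq_le; apply/andP; split; last first.
  by apply: le_ereal_inf_tmp => _ [i _ <-]; exact: cylinder_prob_ge0.
apply/lee_addgt0Pr => e e0; rewrite add0e leNgt; apply/negP => ltC.
have {ltC}leC i : e%:E <= cylinder_prob x (C i).
  by rewrite (le_trans (ltW ltC))//; apply: ereal_inf_lbound; exists i.
(* Invariant of the recursion: the current state, together with the fibres of the sets over the
   prefix chosen so far. *)
pose ok (y : X * (nat -> set path)) := [/\ forall i, cylinder (y.2 i),
  forall i j, (i <= j)%N -> y.2 j `<=` y.2 i &
  forall i, e%:E <= cylinder_prob y.1 (y.2 i)].
pose after (y : X * (nat -> set path)) s :=
  (nxt s, fun i => scons s @^-1` y.2 i).
have step (y : {y | ok y}) : {s | ok (after (sval y) s)}.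
  case: y => -[z E] [cE dE eE] /=; apply: cid.
  have [s hs] := cylinder_prob_step cE dE eE.
  exists s; split => //= [i|i j ij w /=]; first exact: cylinder_scons.
  exact: dE.
pose y0 : {y | ok y} := exist _ (x, C) (And3 cC dC leC).
pose y := fix y n : {y | ok y} :=
  if n is m.+1 then exist ok _ (svalP (step (y m))) else y0.
pose w n := sval (step (y n)).
have wE n i v : (sval (y n)).2 i v ->
    C i (fun j => if (j < n)%N then w j else v (j - n)%N).
  elim: n v => [|n IH] v /=.
    by rewrite (_ : (fun j => _) = v)//; apply/funext => j; rewrite subn0.
  move/IH; rewrite (_ : (fun j => _) = (fun j => if (j < n.+1)%N then w j else
    v (j - n.+1)%N))//; apply/funext => j.
  have [jn|nj|->] := ltngtP j n.
  - by rewrite ltnS (ltnW jn).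
  - by rewrite ltnS leqNgt nj /= -(subnSK nj).
  - by rewrite ltnSn subnn.
suff : (\bigcap_i C i) w by rewrite C0.
(* [C i] sees only [n] coordinates. Its fibre over the first [n] chosen symbols has probability at
   least [e], hence contains some [v], and any such [v] certifies that [w] is in [C i]. *)
move=> i _; have [_ [n dn]] := cC i.
have [cE _ /(_ i)] := svalP (y n).
have [->|/set0P[v Ev] _] := eqVneq ((sval (y n)).2 i) set0.
  by rewrite cylinder_prob0 lee_fin leNgt e0.
by apply: dn (wE _ _ _ Ev) => j ->.
Qed.

Definition cylinder_measure x : set (cylinder_algebra S) -> \bar R :=
  cylinder_prob x.

(** The complements of the partial unions [V n] in the whole union are cylinders decreasing to the
    empty set, so continuity there gives countable additivity. *)
Let cylinder_measure_sigma_additive x :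
  semi_sigma_additive (cylinder_measure x).
Proof.
move=> F mF tF mU.
pose V n := \big[setU/set0]_(i < n) F i.
have cV n : cylinder (V n).
  rewrite /V; apply: big_ind; [exact: cylinder0|exact: cylinderU|].
  by move=> i _; exact: mF.
have VE n : cylinder_prob x (V n) = \sum_(0 <= i < n) cylinder_prob x (F i).
  elim: n => [|n IH]; first by rewrite /V big_ord0 big_geq// cylinder_prob0.
  rewrite big_nat_recr//= -IH -cylinder_probU//.
  - by rewrite /V big_ord_recr.
  - exact: mF.
  apply/seteqP; split => // w [+ Fn]; rewrite /V -bigcup_mkord => -[i /= ni Fi].
  have in_ : i = n by apply: tF => //; exists w.
  by rewrite in_ ltnn in ni.
pose U := \bigcup_n F n.
have VU n : V n `<=` U by rewrite /V -bigcup_mkord => w [i _ Fi]; exists i.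
have UE n : cylinder_prob x U - cylinder_prob x (U `\` V n) = cylinder_prob x (V n).
  rewrite -{1}(setDUK (VU n)) cylinder_probU ?setDIK//; last exact: cylinderD.
  rewrite addeK// ge0_fin_numE ?cylinder_prob_ge0//.
  by rewrite (le_lt_trans (cylinder_prob_le1 _ _)) ?ltry//; exact: cylinderD.
rewrite (_ : (fun n => _) = (fun n => cylinder_prob x U -
    cylinder_prob x (U `\` V n))); last by apply/funext => n; rewrite UE VE.
rewrite -[cylinder_measure x _]sube0; apply: cvgeB => //.
- by rewrite fin_num_adde_defl.
- exact: cvg_cst.
- apply: cylinder_prob_cvg0.
  + by move=> i; exact: cylinderD.
  + move=> i j ij; apply: setDS; rewrite /V -!bigcup_mkord => w [l /= li Fl].
    by exists l => //=; exact: leq_trans ij.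
  + apply/seteqP; split => // w VW; have [[i _ Fi] _] := VW 0%N I.
    have [_] := VW i.+1 I; apply; rewrite /V -bigcup_mkord.
    by exists i => //=.
Qed.

HB.instance Definition _ x := isMeasure.Build _ (cylinder_algebra S) R
  (cylinder_measure x) (cylinder_prob0 x) (cylinder_prob_ge0 x)
  (@cylinder_measure_sigma_additive x).

Definition chain x : set path -> \bar R := measure_extension (cylinder_measure x).

Let chain_sigma_additive x : semi_sigma_additive (chain x).
Proof.
move=> F mF tF mU.
have E (A : set path) : measurable A ->
  @measurable _ (g_sigma_algebraType (@measurable _ (cylinder_algebra S))) A.
  by rewrite measurable_cylindersE.
by apply: (measure_semi_sigma_additive (s := measure_extension (cylinder_measure x)));
  [move=> i; exact: E|by []|exact: E].
Qed.

Let chain0 x : chain x set0 = 0.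
Proof. exact: (measure0 (measure_extension (cylinder_measure x))). Qed.

Let chain_ge0 x A : 0 <= chain x A.
Proof. exact: (measure_ge0 (measure_extension (cylinder_measure x))). Qed.

HB.instance Definition _ x := isMeasure.Build _ path R (chain x) (chain0 x)
  (chain_ge0 x) (@chain_sigma_additive x).

Lemma chainE x C : cylinder C -> chain x C = cylinder_prob x C.
Proof. by move=> cC; rewrite /chain /measure_extension measurable_mu_extE. Qed.

Lemma cylinderT : cylinder (setT : set path).
Proof. by split => //; exists 0%N. Qed.

Let chainT x : chain x setT = 1.
Proof. by rewrite chainE ?cylinder_probT//; exact: cylinderT. Qed.

HB.instance Definition _ x := Measure_isProbability.Build _ _ _ (chain x) (chainT x).

Definition chain_measure x : {measure set path -> \bar R} := chain x.

Let measurable_chain C : measurable C -> measurable_fun setT (chain_measure ^~ C).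
Proof.
move=> mC.
suff : (<<s @cylinder _ S >> : set _) C -> measurable_fun setT (chain_measure ^~ C).
  by apply; rewrite -measurable_cylindersE.
move=> sC; move: C sC {mC}; apply: dynkin_induction.
- exact: measurable_cylindersE.
- exact: cylinderI.
- by apply: (eq_measurable_fun (cst 1)) => // x _; rewrite /= chainT.
- move=> C cC; have [mC [n nC]] := cC.
  have mC' : measurable (setT `*` C : set (X * path)) by exact: measurableX.
  apply: eq_measurable_fun (measurable_stopped n (@measurable_id _ _ _) mC') => x _.
  by rewrite /chain_measure/= chainE// (cylinder_probE x nC) in_xsectionX ?inE.
- move=> C mC mCf; apply: (eq_measurable_fun (fun x => 1 - chain_measure x C)).
    by move=> x _; rewrite /chain_measure /= probability_setC.
  exact: emeasurable_funB.
- move=> F mF tF mFf.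
  apply: (eq_measurable_fun (fun x => \sum_(n <oo) chain_measure x (F n))).
    by move=> x _; rewrite measure_bigcup//; apply: eq_eseriesl => i; rewrite in_setT.
  by apply: ge0_emeasurable_sum => // n x _ _; exact: measure_ge0.
Qed.

HB.instance Definition _ :=
  isKernel.Build _ _ _ _ _ chain_measure measurable_chain.
HB.instance Definition _ :=
  Kernel_isProbability.Build _ _ _ _ _ chain_measure chainT.

Lemma measurable_chain_xsection d0 (T : measurableType d0) (h : T -> X)
    (C : set (T * path)) : measurable_fun setT h -> measurable C ->
  measurable_fun setT (fun t => chain (h t) (xsection C t)).
Proof. by move=> mh mC; exact: (measurable_xsection_pullback chain_measure mh). Qed.

(** Conditional law of the path given its first symbol; the source is [X * S] so that it composes
    with [k]. *)
Definition chain_from (xs : X * S) : {measure set path -> \bar R} :=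
  image_measure (chain_measure (nxt xs.2)) (measurable_scons1 xs.2).

Let measurable_chain_from C : measurable C -> measurable_fun setT (chain_from ^~ C).
Proof.
move=> mC; pose C' := (fun u : X * S * path => scons u.1.2 u.2) @^-1` C.
have mC' : measurable C'.
  rewrite -[C']setTI; apply: (_ : measurable_fun setT _) => //.
  apply: measurable_scons; last exact: measurable_snd.
  exact: (measurableT_comp measurable_snd measurable_fst).
have := measurable_chain_xsection (measurableT_comp mnxt (measurable_snd (T1 := X))) mC'.
apply: eq_measurable_fun => -[x s] _; congr chain.
by apply/seteqP; split=> w; rewrite /xsection /C' /= inE.
Qed.

HB.instance Definition _ :=
  isKernel.Build _ _ _ _ _ chain_from measurable_chain_from.

Let chain_fromT xs : chain_from xs setT = 1.
Proof. exact: chainT. Qed.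

HB.instance Definition _ :=
  Kernel_isProbability.Build _ _ _ _ _ chain_from chain_fromT.

(** The right side is an integral against the composite of [k] with [chain_from]. This measure
    agrees with [chain x] on cylinders, which generate the sigma-algebra and are stable under
    intersection. *)
Lemma integral_chain x (f : path -> \bar R) :
  (forall w, 0 <= f w) -> measurable_fun setT f ->
  \int[chain x]_w f w = \int[k x]_s \int[chain (nxt s)]_w f (scons s w).
Proof.
move=> f0 mf; transitivity (\int[kcomp k chain_from x]_w f w).
  apply: eq_measure_integral => C mC _.
  apply: (@measure_unique _ _ _ (@cylinder _ S) (fun=> setT)) => //.
  - exact: measurable_cylindersE.
  - exact: cylinderI.
  - by move=> _; exact: cylinderT.
  - by rewrite bigcup_const.
  - move=> A cA; rewrite [LHS](chainE x cA) [LHS](cylinder_prob_scons x cA).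
    by apply: eq_integral => s _; rewrite -(chainE (nxt s) (cylinder_scons s cA)).
  - by move=> _; have := ltry (1 : R); rewrite -(chainT x).
rewrite [LHS](integral_kcomp k chain_from x f0 mf); apply: eq_integral => s _.
by rewrite ge0_integral_pushforward.
Qed.

End IonescuTulcea.

(** * Jump processes with exponential holding times *)

Section HoldingTime.
Context (R : realType) (lam : R) (lam0 : 0 < lam).

Local Notation RT := (measurableTypeR R).

Lemma holding_time_exists : exists eta : probability (measurableTypeR R) R,
  forall s, 0 <= s -> eta [set r | s < r] = (expR (- (lam * s)))%:E.
Proof.
pose eta : probability (measurableTypeR R) R :=
  exponential_distribution_exponential_prob__canonical__probability_measure_Probability lam0.
have eta_lt0 : eta [set r | r < 0] = 0%E.
  rewrite /= /exponential_prob integral0_eq// => r r0.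
  by rewrite lt0_exponential_pdf.
have mlt (s : R) : measurable ([set r | s < r] : set (measurableTypeR R)).
  by rewrite -set_itvoy; exact: measurable_itv.
have mlt' (s : R) : measurable ([set r | r < s] : set (measurableTypeR R)).
  by rewrite -set_itvNyo; exact: measurable_itv.
exists eta => s s0; rewrite -[[set r | s < r]]setCK.
rewrite probability_setC; last by apply: measurableC; exact: mlt.
(* The formula for the interval [[0, s]] is for [0 < s]; at [s = 0] the interval is a point, which a
   density does not charge. *)
have [->|sn0] := eqVneq s 0.
  have : eta [set` `[0, 0] ] = 0%E.
    rewrite /= /exponential_prob set_itv1.
    rewrite integral_set1.
    by [].
  move=> e0; rewrite (_ : ~` _ = [set r | r < 0] `|` [set` `[0, 0]]); last first.
    apply/seteqP; split => r /=; rewrite in_itv/= -eq_le.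
      by move/negP; rewrite -leNgt le_eqVlt eq_sym => /orP[->|->]; [right|left].
    by move=> [r0|/eqP <-]; apply/negP; rewrite -leNgt// ltW.
  rewrite measureU//; first last.
  - apply/seteqP; split=> r //= -[r0]; rewrite in_itv/= => /andP[].
    by rewrite leNgt r0.
  rewrite mulr0 oppr0 expR0 -[RHS]sube0; congr (_ - _)%E.
  by rewrite -[RHS]adde0; congr (_ + _)%E; [exact: eta_lt0|exact: e0].
have {sn0}s0' : 0 < s by rewrite lt_neqAle eq_sym sn0.
have := exponential_prob_itv0c lam s0'; rewrite mulNr => e0.
rewrite (_ : ~` _ = [set r | r < 0] `|` [set` `[0, s]]); last first.
  apply/seteqP; split => r /=; rewrite in_itv/=.
    by move/negP; rewrite -leNgt => ->; have [|] := ltP r 0; [left|right].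
  by move=> [r0|/andP[_ rs]]; apply/negP; rewrite -leNgt// (le_trans (ltW r0)).
rewrite measureU//; first last.
- apply/seteqP; split=> r //= -[r0]; rewrite in_itv/= => /andP[].
  by rewrite leNgt r0.
rewrite [X in (_ - (X + _))%E](_ : _ = 0)%E; last exact: eta_lt0.
rewrite add0e [X in (_ - X)%E](_ : _ = (1 - (expR (- (lam * s)))%:E)%E)//.
by rewrite -!EFinB opprB addrC subrK.
Qed.

Variable eta : probability (measurableTypeR R) R.
Hypothesis etaE : forall s, 0 <= s ->
  eta [set r | s < r] = (expR (- (lam * s)))%:E.

Lemma measurable_gt (s : R) : measurable ([set r | s < r] : set (measurableTypeR R)).
Proof. by rewrite -set_itvoy; exact: measurable_itv. Qed.

Lemma measurable_le (s : R) : measurable ([set r | r <= s] : set (measurableTypeR R)).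
Proof. by rewrite -set_itvNyc; exact: measurable_itv. Qed.

Lemma holding_gt s : eta [set r | s < r] = (expR (- (lam * Num.max s 0)))%:E.
Proof.
have [s0|s0] := leP 0 s; first exact: etaE.
rewrite mulr0 oppr0 expR0; apply/eqP; rewrite eq_le probability_le1/=; last exact: measurable_gt.
have := etaE (lexx 0); rewrite mulr0 oppr0 expR0 => <-.
apply: le_measure; rewrite ?inE; try exact: measurable_gt.
by move=> r /=; exact: lt_trans.
Qed.

Lemma holding_le s : 0 <= s -> eta [set r | r <= s] = (1 - expR (- (lam * s)))%:E.
Proof.
move=> s0; rewrite (_ : [set r | r <= s] = ~` [set r | s < r]); last first.
  by apply/seteqP; split => r /=; rewrite leNgt => /negP.
by rewrite probability_setC; [rewrite etaE// EFinB|exact: measurable_gt].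
Qed.

Lemma holding_le0 s : s <= 0 -> eta [set r | r <= s] = 0%E.
Proof.
move=> s0; rewrite (_ : [set r | r <= s] = ~` [set r | s < r]); last first.
  by apply/seteqP; split => r /=; rewrite leNgt => /negP.
rewrite probability_setC; last exact: measurable_gt.
by rewrite holding_gt (max_idPr s0) mulr0 oppr0 expR0 subee.
Qed.

Let msub (s : R) : measurable_fun setT
  (fun r : measurableTypeR R => r - s : measurableTypeR R).
Proof. by apply: measurable_funB => //; exact: measurable_id. Qed.

(** Two measures are compared on the positive half-line: the law of [r - s], and the law of [r]
    scaled by the survival probability. They agree on open half-lines, a generating system stable
    under intersection; the values [r <= 0] on the right form a null set. *)
Lemma memoryless (s : R) (h : R -> \bar R) : 0 <= s ->
  (forall r, 0 <= h r)%E -> measurable_fun setT (h : measurableTypeR R -> _) ->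
  (\int[eta]_(r in [set r | (s < r)%R]) h (r - s)%R =
   (expR (- (lam * s)))%:E * \int[eta]_r h r)%E.
Proof.
move=> s0 h0 mh; pose D : set (measurableTypeR R) := [set r | 0 < r].
have mD : measurable D by exact: measurable_gt.
have e0 : 0 <= expR (- (lam * s)) by exact: expR_ge0.
transitivity (\int[image_measure eta (msub s)]_(r in D) h r)%E.
  rewrite [RHS]ge0_integral_pushforward//; last exact: measurable_funTS.
  by congr integral; apply/seteqP; split => r; rewrite /D/= subr_gt0.
pose m1 : {measure set (measurableTypeR R) -> \bar R} :=
  mrestr (image_measure eta (msub s)) mD.
pose m2 : {measure set (measurableTypeR R) -> \bar R} := mscale (NngNum e0) eta.
transitivity (\int[m2]_(r in D) h r)%E.
  apply: eq_measure_integral => A mA AD.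
  transitivity (m1 A).
    by rewrite /m1 /= /mrestr (setIidl AD).
  refine (@measure_unique _ R (measurableTypeR R) (@RGenOInfty.G R)
    (fun n => [set` `]- n%:R, +oo[ ]) _ _ _ _ m1 m2 _ _ A mA).
  - exact: RGenOInfty.measurableE.
  - move=> _ _ [x ->] [y ->]; exists (Num.max x y).
    by apply/seteqP; split => z /=; rewrite !in_itv/= !andbT gt_max; [move=> [-> ->]|move=> /andP[]].
  - by move=> n; exists (- n%:R).
  - apply/seteqP; split => // r _; exists (Num.truncn `|r|).+1 => //=.
    rewrite in_itv/= andbT ltrNl (le_lt_trans (ler_norm _))// normrN.
    exact: Num.Theory.truncnS_gt.
  - move=> _ [x ->].
    (* Keeping only positive values of [r - s] truncates the half-line beginning at [x] to the one
       beginning at [max x 0]; the exponential of the sum then factors. *)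
    transitivity (eta [set r | s + Num.max x 0 < r]).
      rewrite /m1 /= /mrestr /= /pushforward set_itvoy; congr (eta _).
      apply/seteqP; split => r; rewrite /D/= -ltrBrDl gt_max ?subr_gt0.
        by move=> [-> ->].
      by move=> /andP[].
    transitivity ((expR (- (lam * s)))%:E * eta [set r | (x < r)%R])%E.
      rewrite [LHS]etaE; last by rewrite addr_ge0// le_max lexx orbT.
      by rewrite holding_gt -EFinM -expRD mulrDr opprD.
    by rewrite -set_itvoy.
  - move=> n; apply: (@le_lt_trans _ _ 1%E); last exact: ltry.
    apply: probability_le1; rewrite -[X in measurable X]setTI; apply: msub => //.
    by apply: measurableI => //; exact: measurable_itv.
rewrite [LHS]ge0_integral_mscale//; last exact: measurable_funTS.
congr (_ * _)%E.
rewrite [RHS](@ge0_negligible_integral _ _ _ _ _ ([set r | r <= 0] : set RT))//.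
- by congr integral; apply/seteqP; split => r; rewrite /D/= ltNge; [move/negP|move=> [_ /negP]].
- exact: measurable_le.
- exact: holding_le0.
Qed.

End HoldingTime.

(** * The process built from jumps and holding times *)

Section JumpProcess.
Context (R : realType) d (X : measurableType d) (Q : R.-pker X ~> X).
Local Notation RT := (measurableTypeR R).
Variable eta : probability RT R.
Local Open Scope ereal_scope.

Definition holding_kernel (x : X) : {measure set RT -> \bar R} := eta.
Let measurable_holding_kernel U :
  measurable U -> measurable_fun setT (holding_kernel ^~ U).
Proof. by move=> _; exact: measurable_cst. Qed.
HB.instance Definition _ :=
  isKernel.Build _ _ _ _ _ holding_kernel measurable_holding_kernel.
Let holding_kernelT x : holding_kernel x setT = 1.
Proof. exact: probability_setT. Qed.
HB.instance Definition _ :=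
  Kernel_isProbability.Build _ _ _ _ _ holding_kernel holding_kernelT.

Definition jump_kernel (xr : X * RT) : {measure set (RT * X) -> \bar R} :=
  image_measure (Q xr.1) (pair1_measurable xr.2).
Let measurable_jump_kernel U :
  measurable U -> measurable_fun setT (jump_kernel ^~ U).
Proof.
move=> mU; pose U' := (fun u : X * RT * X => (u.1.2, u.2)) @^-1` U.
have mU' : measurable U'.
  rewrite -[U']setTI; apply: (_ : measurable_fun setT _) => //.
  apply: measurable_fun_pair; last exact: measurable_snd.
  exact: (measurableT_comp measurable_snd measurable_fst).
have := measurable_xsection_pullback Q (measurable_fst (T1 := X) (T2 := RT)) mU'.
apply: eq_measurable_fun => -[x r] _; congr (Q x _).
by apply/seteqP; split=> w; rewrite /xsection /U' /= inE.
Qed.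
HB.instance Definition _ :=
  isKernel.Build _ _ _ _ _ jump_kernel measurable_jump_kernel.
Let jump_kernelT xr : jump_kernel xr setT = 1.
Proof. exact: prob_kernel. Qed.
HB.instance Definition _ :=
  Kernel_isProbability.Build _ _ _ _ _ jump_kernel jump_kernelT.

Definition step (x : X) : {measure set (RT * X) -> \bar R} :=
  kcomp holding_kernel jump_kernel x.
Let measurable_step U : measurable U -> measurable_fun setT (step ^~ U).
Proof. exact: (measurable_kernel (holding_kernel \; jump_kernel)). Qed.
HB.instance Definition _ := isKernel.Build _ _ _ _ _ step measurable_step.
Let stepT x : step x setT = 1.
Proof.
rewrite /step/= /kcomp; under eq_integral do rewrite jump_kernelT.
by rewrite integral_cst// mul1e.
Qed.
HB.instance Definition _ := Kernel_isProbability.Build _ _ _ _ _ step stepT.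

(** Starting point, then pairs of a holding time and the state entered when it ends. Holding times
    range over all reals; non-positive ones are null, but every estimate by first jump has to carry
    them along. *)
Definition histories := (X * paths (RT * X)%type)%type.

Definition law (x : X) : {measure set histories -> \bar R} :=
  image_measure (chain_measure step measurable_snd x) (pair1_measurable x).

Let measurable_law U : measurable U -> measurable_fun setT (law ^~ U).
Proof.
move=> mU; have := measurable_chain_xsection step measurable_snd (@measurable_id _ _ _) mU.
apply: eq_measurable_fun => x _; congr chain.
by apply/seteqP; split=> w; rewrite /xsection /= inE.
Qed.
HB.instance Definition _ := isKernel.Build _ _ _ _ _ law measurable_law.
Lemma lawT x : law x setT = 1.
Proof.
transitivity (chain_measure step measurable_snd x (pair x @^-1` setT)); first by [].
by rewrite preimage_setT prob_kernel.
Qed.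
HB.instance Definition _ := Kernel_isProbability.Build _ _ _ _ _ law lawT.

Lemma law_le1 x U : measurable U -> law x U <= 1.
Proof. by move=> mU; rewrite -(lawT x); apply: le_measure; rewrite ?inE. Qed.

Definition hold (o : histories) : R := (o.2 0%N).1.

Definition shift (o : histories) : histories := ((o.2 0%N).2, fun i => o.2 i.+1).

Definition hcons (x : X) (r : R) (o : histories) : histories :=
  (x, scons ((r, o.1) : RT * X) o.2).

Lemma shift_hcons x r o : shift (hcons x r o) = o.
Proof. by case: o. Qed.

Lemma hold_hcons x r o : hold (hcons x r o) = r.
Proof. by []. Qed.

Let measurable_coord2 i : measurable_fun setT (fun o : histories => o.2 i).
Proof. exact: (measurableT_comp (measurable_coord i) measurable_snd). Qed.

Lemma measurable_hold : measurable_fun setT (hold : histories -> RT).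
Proof. exact: (measurableT_comp measurable_fst (measurable_coord2 0%N)). Qed.

Lemma measurable_shift : measurable_fun setT shift.
Proof.
apply: measurable_fun_pair.
  exact: (measurableT_comp measurable_snd (measurable_coord2 0%N)).
apply: measurable_fun_paths => i; exact: (measurable_coord2 i.+1).
Qed.

(* Renewal at the first jump. *)
Lemma integral_law x (h : histories -> \bar R) :
  (forall o, 0 <= h o) -> measurable_fun setT h ->
  \int[law x]_o h o =
  \int[eta]_r \int[Q x]_y \int[law y]_o h (hcons x r o).
Proof.
move=> h0 mh; rewrite ge0_integral_pushforward// preimage_setT.
have mhx : measurable_fun setT (h \o pair x).
  by apply: measurableT_comp mh _; exact: pair1_measurable.
rewrite integral_chain//; last by move=> w; exact: h0.
pose g (s : RT * X) :=
  \int[chain step measurable_snd s.2]_w (h \o pair x) (scons s w).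
have g0 s : 0 <= g s by apply: integral_ge0 => w _; exact: h0.
have mg : measurable_fun setT g.
  pose f (z : (RT * X)%type * paths (RT * X)%type) := (h \o pair x) (scons z.1 z.2).
  have mf : measurable_fun setT f.
    apply: (measurableT_comp mhx).
    by apply: measurable_scons; [exact: measurable_fst|exact: measurable_snd].
  apply: (@measurable_integral_pullback _ _ _ _ _ _ _
    (chain_measure step measurable_snd) snd measurable_snd f) => // z.
  exact: h0.
rewrite [LHS](integral_kcomp holding_kernel jump_kernel x g0 mg).
apply: eq_integral => r _; rewrite ge0_integral_pushforward// preimage_setT.
apply: eq_integral => y _; rewrite /g /= ge0_integral_pushforward//.
rewrite (_ : (fun o => _) = (h \o pair x) \o (fun o => scons ((r, o.1) : RT * X) o.2))//.
apply: measurableT_comp mhx _.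
apply: measurable_scons; last exact: measurable_snd.
by apply: measurable_fun_pair; [exact: measurable_cst|exact: measurable_fst].
Qed.

Let msc (h : histories -> \bar R) x : measurable_fun setT h ->
  measurable_fun setT (fun z : (RT * X)%type * histories => h (hcons x z.1.1 z.2)).
Proof.
move=> mh; apply: (measurableT_comp mh).
apply: measurable_fun_pair; first exact: measurable_cst.
apply: measurable_scons; last exact: (measurableT_comp measurable_snd measurable_snd).
apply: measurable_fun_pair.
  exact: (measurableT_comp measurable_fst measurable_fst).
exact: (measurableT_comp measurable_fst measurable_snd).
Qed.

Lemma measurable_hcons_integral x (h : histories -> \bar R) :
  (forall o, 0 <= h o) -> measurable_fun setT h ->
  measurable_fun setT (fun z : RT * X => \int[law z.2]_o h (hcons x z.1 o)).
Proof.
move=> h0 mh.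
exact: (@measurable_integral_pullback _ _ _ _ _ _ _ law snd measurable_snd
  (fun z : (RT * X)%type * histories => h (hcons x z.1.1 z.2)) (fun z => h0 _) (msc x mh)).
Qed.

Lemma measurable_renewal x (h : histories -> \bar R) :
  (forall o, 0 <= h o) -> measurable_fun setT h ->
  measurable_fun setT (fun r : RT => \int[Q x]_y \int[law y]_o h (hcons x r o)).
Proof.
move=> h0 mh.
pose g (z : RT * X) := \int[law z.2]_o h (hcons x z.1 o).
have mg : measurable_fun setT g by exact: measurable_hcons_integral.
apply: (@measurable_integral_pullback _ _ _ _ _ _ _ Q (fun=> x) _ g) => // z.
by apply: integral_ge0 => o _; exact: h0.
Qed.

Lemma measurable_hcons x r : measurable_fun setT (hcons x r).
Proof.
apply: measurable_fun_pair; first exact: measurable_cst.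
apply: measurable_scons; last exact: measurable_snd.
by apply: measurable_fun_pair; [exact: measurable_cst|exact: measurable_fst].
Qed.

Let law_preimage x r y (D : set histories) : measurable D ->
  \int[law y]_o (\1_D (hcons x r o))%:E = law y (hcons x r @^-1` D).
Proof.
move=> mD; rewrite -[hcons x r @^-1` D]setIT -integral_indic//.
by rewrite -[X in measurable X]setTI; exact: measurable_hcons.
Qed.

Lemma law_renewal x D : measurable D ->
  law x D = \int[eta]_r \int[Q x]_y law y (hcons x r @^-1` D).
Proof.
move=> mD; rewrite -[in LHS](setIT D) -integral_indic// integral_law.
- by apply: eq_integral => r _; apply: eq_integral => y _; exact: law_preimage.
- by move=> o; rewrite lee_fin.
- exact: measurable_EFin_indic.
Qed.

Lemma measurable_law_preimage x r D : measurable D ->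
  measurable_fun setT (fun y => law y (hcons x r @^-1` D)).
Proof.
move=> mD; have i0 o : 0 <= (\1_D o)%:E :> \bar R by rewrite lee_fin.
apply: (eq_measurable_fun (fun y => \int[law y]_o (\1_D (hcons x r o))%:E)).
  by move=> y _ /=; rewrite law_preimage.
exact: (measurableT_comp (measurable_hcons_integral x i0
  (measurable_EFin_indic mD)) (pair1_measurable (r : RT))).
Qed.

Lemma measurable_law_renewal x D : measurable D ->
  measurable_fun setT (fun r : RT => \int[Q x]_y law y (hcons x r @^-1` D)).
Proof.
move=> mD; have i0 o : 0 <= (\1_D o)%:E :> \bar R by rewrite lee_fin.
apply: (eq_measurable_fun
  (fun r => \int[Q x]_y \int[law y]_o (\1_D (hcons x r o))%:E)).
  by move=> r _; apply: eq_integral => y _; rewrite law_preimage.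
exact: (measurable_renewal x i0 (measurable_EFin_indic mD)).
Qed.

(** Counting jumps by peeling off the first holding time turns renewal arguments into inductions on
    [n]. A jump at time [s] itself counts as done, which is what makes the paths right
    continuous. *)
Fixpoint at_jump n (s : R) (o : histories) : bool :=
  if n is m.+1 then (hold o <= s)%R && at_jump m (s - hold o)%R (shift o)
  else (s < hold o)%R.

Fixpoint state n (o : histories) : X :=
  if n is m.+1 then state m (shift o) else o.1.

(* [point] is the value after an explosion. *)
Definition process (s : R) (o : histories) : X :=
  if `[< exists n, at_jump n s o >] then
    state (xget 0%N [set n | at_jump n s o]) o
  else point.

Lemma at_jump_inj n m s o : at_jump n s o -> at_jump m s o -> n = m.
Proof.
elim: n m s o => [|n IH] [|m] s o //=.
- by move=> sh /andP[]; rewrite leNgt sh.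
- by move=> /andP[] + _; rewrite leNgt => /negP.
- by move=> /andP[_ h1] /andP[_ h2]; congr _.+1; exact: IH h1 h2.
Qed.

Lemma process_at n s o : at_jump n s o -> process s o = state n o.
Proof.
move=> a; rewrite /process asboolT; last by exists n.
case: xgetP => [m _ /= am|/(_ n)//].
by rewrite (at_jump_inj am a).
Qed.

Lemma process_exploded s o : ~ (exists n, at_jump n s o) -> process s o = point.
Proof. by move=> no; rewrite /process asboolF. Qed.

(** The renewal equation of paths. Explosion respects it: for [r <= s] a history has exploded by [s]
    exactly when its continuation has exploded by [s - r], so both sides fall back on the same
    default. *)
Lemma process_hcons s x r o :
  process s (hcons x r o) = if (s < r)%R then x else process (s - r) o.
Proof.
case: ltP => sr; first by rewrite (@process_at 0).
have [[n a]|no] := pselect (exists n, at_jump n (s - r) o).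
  by rewrite (process_at a) (@process_at n.+1) /= ?shift_hcons//= hold_hcons sr.
rewrite !process_exploded// => -[[|n]] /=; first by rewrite hold_hcons ltNge sr.
by rewrite shift_hcons => /andP[_ a]; apply: no; exists n.
Qed.

Lemma measurable_at_jump n d0 (T : measurableType d0) (f : T -> RT)
    (h : T -> histories) : measurable_fun setT f -> measurable_fun setT h ->
  measurable_fun setT (fun t => at_jump n (f t) (h t)).
Proof.
elim: n f h => [|n IH] f h mf mh /=.
  by apply: measurable_fun_ltr => //; exact: (measurableT_comp measurable_hold mh).
have mhh : measurable_fun setT (fun t => hold (h t) : RT).
  exact: (measurableT_comp measurable_hold mh).
apply: measurable_and; first exact: measurable_fun_ler.
apply: IH; first exact: measurable_funB.
exact: (measurableT_comp measurable_shift mh).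
Qed.

Lemma measurable_at n s : measurable [set o | at_jump n s o].
Proof.
rewrite -[X in measurable X]setTI.
have := measurable_at_jump n (measurable_cst s) (@measurable_id _ histories setT).
by move=> /(_ measurableT [set true]); exact.
Qed.

Lemma measurable_state n : measurable_fun setT (state n).
Proof.
elim: n => [|n IH]; first exact: measurable_fst.
exact: (measurableT_comp IH measurable_shift).
Qed.

Lemma measurable_process s : measurable_fun setT (process s).
Proof.
move=> _ A mA; rewrite setTI.
rewrite (_ : _ @^-1` A =
    (\bigcup_n ([set o | at_jump n s o] `&` state n @^-1` A)) `|`
    (~` (\bigcup_n [set o | at_jump n s o]) `&` [set o | A point])).
  apply: measurableU.
    apply: bigcupT_measurable => n; apply: measurableI; first exact: measurable_at.
    by rewrite -[X in measurable X]setTI; exact: measurable_state.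
  apply: measurableI.
    by apply: measurableC; apply: bigcupT_measurable => n; exact: measurable_at.
  have [Ap|nAp] := pselect (A point).
    by rewrite (_ : [set o | _] = setT)//; apply/seteqP; split.
  by rewrite (_ : [set o | _] = set0)//; apply/seteqP; split.
apply/seteqP; split => o /=.
  have [[n a]|no] := pselect (exists n, at_jump n s o).
    by rewrite (process_at a) => Ao; left; exists n.
  by rewrite (process_exploded no) => Ap; right; split => // -[n _ a]; apply: no; exists n.
move=> [[n _ [/process_at -> //]]|[no Ap]].
by rewrite process_exploded// => -[n a]; apply: no; exists n.
Qed.

Definition late n (s : R) : set histories :=
  [set o | forall k, (k < n)%N -> ~~ at_jump k s o].

Lemma measurable_late n s : measurable (late n s).
Proof.
rewrite (_ : late n s = \bigcap_(k in `I_n) ~` [set o | at_jump k s o]).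
  by apply: bigcap_measurableType => k _; apply: measurableC; exact: measurable_at.
by apply/seteqP; split => o h k kn; apply/negP; exact: h.
Qed.

Lemma late_hcons n s x r o :
  late n.+1 s (hcons x r o) -> (r <= s)%R /\ late n (s - r) o.
Proof.
move=> h; have := h 0%N isT; rewrite /= -leNgt hold_hcons => rs; split => // k kn.
by have := h k.+1 kn; rewrite /= shift_hcons hold_hcons rs.
Qed.

Variable lam : R.
Hypothesis lam0 : (0 < lam)%R.
Hypothesis etaE : forall s, (0 <= s)%R ->
  eta [set r | (s < r)%R] = (expR (- (lam * s)))%:E.
Let q s : R := 1 - expR (- (lam * s)).

Let q_ge0 s : (0 <= s -> 0 <= q s)%R.
Proof.
by move=> s0; rewrite subr_ge0 -expR0 ler_expR oppr_le0 mulr_ge0// ltW.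
Qed.

Let q_le s t : (s <= t -> q s <= q t)%R.
Proof. by move=> st; rewrite lerD2l lerN2 ler_expR lerN2 ler_pM2l. Qed.

(** Each of the [n] jumps has to wait at most [s], and the waits are independent, so each costs a
    factor [q s]; the induction conditions on the first jump. *)
Lemma law_late_le n s x : (0 <= s)%R -> law x (late n s) <= (q s ^+ n)%:E.
Proof.
elim: n s x => [|n IH] s x s0.
  by rewrite expr0; apply: law_le1; exact: measurable_late.
have qn : (0 <= q s ^+ n)%R by rewrite exprn_ge0// q_ge0.
have ml := measurable_late n.+1 s.
rewrite law_renewal//.
(* The second indicator pays for [r <= 0], where the remaining time [s - r] is not below [s] and the
   induction hypothesis is too weak; its integral is zero. *)
apply: (@le_trans _ _ (\int[eta]_r ((q s ^+ n)%:E * (\1_[set r | (r <= s)%R] r)%:E +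
    (\1_[set r | (r <= 0)%R] r)%:E))).
  apply: ge0_le_integral => //.
  - by move=> r _; apply: integral_ge0.
  - exact: measurable_law_renewal.
  - apply: emeasurable_funD; first apply: measurable_funeM;
      by apply: measurable_EFin_indic; exact: measurable_le.
  - move=> r _; rewrite -[leRHS]mule1 -(prob_kernel (s := Q) x) -integral_cst//.
    have B0 : 0 <= (q s ^+ n)%:E * (\1_[set r | (r <= s)%R] r)%:E :> \bar R.
      by rewrite mule_ge0 ?lee_fin.
    have ml' : measurable (hcons x r @^-1` late n.+1 s).
      by rewrite -[X in measurable X]setTI; exact: measurable_hcons.
    apply: ge0_le_integral => //; first exact: measurable_law_preimage.
    move=> y _ /=; have [r0|r0] := leP r 0%R.
      rewrite [X in _ + X%:E]indicE mem_set//= (le_trans (law_le1 _ ml'))//.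
      by rewrite leeDr.
    have [rs|sr] := leP r s; last first.
      rewrite (_ : _ @^-1` _ = set0) ?measure0 ?adde_ge0 ?lee_fin//.
      by apply/seteqP; split => // o /= /late_hcons[]; rewrite leNgt sr.
    rewrite (@le_trans _ _ (law y (late n (s - r))))//.
      rewrite le_measure ?inE//; first exact: measurable_late.
      by move=> o /= /late_hcons[].
    rewrite (le_trans (IH _ _ _)) ?subr_ge0//.
    rewrite (_ : \1_[set r1 | (r1 <= s)%R] r = 1%R) ?mule1; last first.
      by rewrite indicE mem_set.
    apply: (@le_trans _ _ (q s ^+ n)%:E); last by rewrite leeDl// lee_fin.
    rewrite lee_fin.
    by rewrite lerXn2r ?nnegrE ?q_ge0 ?subr_ge0// q_le// gerBl ltW.
have mle (u : R) : measurable_fun setT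
    (fun r : RT => (\1_[set r | (r <= u)%R] r)%:E : \bar R).
  by apply: measurable_EFin_indic; exact: measurable_le.
rewrite ge0_integralD//; last 2 first.
- by move=> r _; rewrite mule_ge0 ?lee_fin.
- exact: measurable_funeM.
rewrite ge0_integralZl ?lee_fin//.
rewrite !integral_indic ?setIT//; [|exact: measurable_le|exact: measurable_le].
rewrite [X in _ * X + _](_ : _ = (q s)%:E); last exact: (holding_le etaE s0).
rewrite [X in _ + X](_ : _ = 0); last exact: (holding_le0 etaE (lexx 0%R)).
by rewrite adde0 exprSr EFinM.
Qed.

Definition exploding (s : R) : set histories := [set o | forall n, ~~ at_jump n s o].

Lemma measurable_exploding s : measurable (exploding s).
Proof.
rewrite (_ : exploding s = \bigcap_n ~` [set o | at_jump n s o]).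
  by apply: bigcapT_measurable => k; apply: measurableC; exact: measurable_at.
by apply/seteqP; split => o h k *; apply/negP; exact: h.
Qed.

Lemma law_exploding s x : (0 <= s)%R -> law x (exploding s) = 0.
Proof.
move=> s0; apply/eqP; rewrite eq_le measure_ge0 andbT.
apply/lee_addgt0Pr => e e0; rewrite add0e.
have q1 : (`|q s| < 1)%R by rewrite ger0_norm ?q_ge0// gtrBl expR_gt0.
have /cvgrPdist_lt/(_ e e0)[n _ /(_ n (leqnn n)) qe] := cvg_expr q1.
apply: (@le_trans _ _ (law x (late n s))).
  rewrite le_measure ?inE//; [exact: measurable_exploding|exact: measurable_late|].
  by move=> o h k _; exact: h.
rewrite (le_trans (law_late_le _ _ _))// lee_fin ltW//.
by rewrite (le_lt_trans (ler_norm _))//; move: qe; rewrite sub0r normrN.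
Qed.

Lemma at_jumpW n s s' o : (s <= s')%R -> at_jump n s' o ->
  exists2 m, (m <= n)%N & at_jump m s o.
Proof.
elim: n s s' o => [|n IH] s s' o ss' /=; first by exists 0%N => //=; exact: le_lt_trans ss' _.
move=> /andP[hs' a]; have [hs|sh] := leP (hold o) s; last by exists 0%N.
have [m mn am] := IH _ _ _ (lerB ss' (lexx (hold o))) a.
by exists m.+1 => //=; rewrite hs.
Qed.

(** Integer times suffice because the number of jumps is monotone in time ([at_jumpW]); the union
    stays countable and therefore null. *)
Definition exploded : set histories := \bigcup_n exploding n%:R.

Lemma measurable_exploded : measurable exploded.
Proof. by apply: bigcupT_measurable => n; exact: measurable_exploding. Qed.

Lemma law_exploded x : law x exploded = 0.
Proof.
apply/eqP; rewrite -measure_le0.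
apply: (le_trans (measure_sigma_subadditive _ _ _ (@subset_refl _ _))) => //.
- by move=> n; exact: measurable_exploding.
- exact: measurable_exploded.
- by rewrite eseries0// => n _ _; rewrite law_exploding.
Qed.

Lemma not_exploded s o : ~ exploded o -> exists n, at_jump n s o.
Proof.
move=> no; apply: contrapT => /forallNP na; apply: no.
exists (Num.truncn `|s|).+1 => // n; apply/negP => an.
have [|m _ /na //] := at_jumpW (s := s) _ an.
by rewrite (le_trans (ler_norm s))// ltW// Num.Theory.truncnS_gt.
Qed.

Definition past_events (s : R) : set (set histories) :=
  <<s \bigcup_(u in `[0%R, s]) preimage_set_system setT (process u) measurable >>.

Lemma past_events_measurable s B : past_events s B -> measurable B.
Proof.
apply: smallest_sub; first exact: sigma_algebra_measurable.
by move=> _ [u _ [A mA <-]]; exact: measurable_process.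
Qed.

(** The sets with this property form a sigma-algebra. For an event at time [u] the renewal equation
    gives a trivial event if [u < r], and an event at time [u - r] otherwise. *)
Lemma past_events_hcons x r s B : (r <= s)%R ->
  past_events s B -> past_events (s - r) (hcons x r @^-1` B).
Proof.
move=> rs; pose G := [set B | past_events (s - r) (hcons x r @^-1` B)].
suff : past_events s `<=` G by apply.
have [p0 pD pU] : sigma_algebra setT (past_events (s - r)).
  exact: smallest_sigma_algebra.
apply: smallest_sub.
  split => [|A GA|F GF].
  - by rewrite /G/= preimage_set0.
  - by rewrite /G/= setTD preimage_setC -setTD; exact: pD.
  - by rewrite /G/= preimage_bigcup; exact: pU.
move=> _ [u /= + [A mA <-]]; rewrite in_itv/= => /andP[u0 us]; rewrite /G/= setTI.
have [ur|ru] := ltP u r.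
  have [Ax|Ax] := pselect (A x).
    rewrite (_ : _ @^-1` _ = setT); first by rewrite -[setT]setD0; exact: pD.
    by apply/seteqP; split => // o _ /=; rewrite process_hcons ur.
  rewrite (_ : _ @^-1` _ = set0)//.
  by apply/seteqP; split => // o /=; rewrite process_hcons ur.
apply: sub_sigma_algebra; exists (u - r)%R.
  by rewrite /= in_itv/= subr_ge0 ru lerB.
exists A => //; rewrite setTI; apply/seteqP; split => o /=;
  by rewrite process_hcons ltNge ru.
Qed.

(* Before the first jump the past only knows the starting point. *)
Lemma past_events_before x s B r r' o o' : past_events s B ->
  (s < r)%R -> (s < r')%R -> B (hcons x r o) -> B (hcons x r' o').
Proof.
move=> pB; pose G := [set B : set histories | forall r r' o o',
  (s < r)%R -> (s < r')%R -> B (hcons x r o) -> B (hcons x r' o')].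
suff : past_events s `<=` G by move=> /(_ _ pB); apply.
apply: smallest_sub.
  split => [//|A GA|F GF].
  - move=> r1 r2 o1 o2 sr1 sr2 [_ nA]; split => // Ao2.
    by apply: nA; exact: GA Ao2.
  - by move=> r1 r2 o1 o2 sr1 sr2 [n _ Fn]; exists n => //; exact: GF Fn.
move=> _ [u /= + [A mA <-]]; rewrite in_itv/= => /andP[u0 us] r1 r2 o1 o2 sr1 sr2.
by rewrite !setTI /= !process_hcons !(le_lt_trans us).
Qed.

Definition transition (t : R) (x : X) : {measure set X -> \bar R} :=
  image_measure (law x) (measurable_process t).

Let mpre t A : measurable A -> measurable (process t @^-1` A).
Proof. by move=> mA; rewrite -[X in measurable X]setTI; exact: measurable_process. Qed.

Lemma measurable_transition t A : measurable A ->
  measurable_fun setT (fun x => transition t x A).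
Proof. by move=> mA; exact: (measurable_kernel law _ (mpre t mA)). Qed.

Let mtrans t s A : measurable A ->
  measurable_fun setT (fun o => transition t (process s o) A).
Proof.
by move=> mA; exact: (measurableT_comp (measurable_transition t mA) (measurable_process s)).
Qed.

Let restrict_indic (D : set histories) (g : histories -> \bar R) x :
  \int[law x]_(o in D) g o = \int[law x]_o (g o * (\1_D o)%:E).
Proof. by rewrite integral_mkcond epatch_indic. Qed.

Lemma integral_law_in x (D : set histories) (g : histories -> \bar R) :
  measurable D -> (forall o, 0 <= g o) -> measurable_fun setT g ->
  \int[law x]_(o in D) g o = \int[eta]_r \int[Q x]_y
    \int[law y]_o (g (hcons x r o) * (\1_D (hcons x r o))%:E).
Proof.
move=> mD g0 mg; rewrite restrict_indic.
apply: (integral_law x (h := fun o => g o * (\1_D o)%:E)).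
  by move=> o; rewrite mule_ge0 ?lee_fin.
by apply: emeasurable_funM => //; exact: measurable_EFin_indic.
Qed.

Let integral_gt (s : R) (g : R -> \bar R) :
  \int[eta]_r (if (s < r)%R then g r else 0) = \int[eta]_(r in [set r | (s < r)%R]) g r.
Proof.
rewrite [RHS]integral_mkcond; apply: eq_integral => r _.
by rewrite patchE; case: ifPn => sr; [rewrite mem_set|rewrite memNset//; exact/negP].
Qed.

(** With no jump before [s], the event [B] is decided by the starting point and the rest of the
    holding time is again exponential. Otherwise the first jump is stripped, and the induction
    hypothesis applies from the state entered, at time [s - r]. *)
Lemma markov_at_jump n s t x A B : (0 <= s)%R -> (0 <= t)%R -> measurable A ->
  past_events s B ->
  \int[law x]_(o in B `&` [set o | at_jump n s o]) (\1_A (process (s + t) o))%:E =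
  \int[law x]_(o in B `&` [set o | at_jump n s o]) transition t (process s o) A.
Proof.
move=> + t0 mA; elim: n s x B => [|n IH] s x B s0 pB.
  have mB := past_events_measurable pB.
  have mD := measurableI _ _ mB (measurable_at 0 s).
  have mA' u : measurable_fun setT (fun o => (\1_A (process u o))%:E : \bar R).
    exact: (measurableT_comp (measurable_EFin_indic mA) (measurable_process u)).
  rewrite (integral_law_in x mD _ (mA' _)); last by move=> o; rewrite lee_fin.
  rewrite (integral_law_in x mD _ (mtrans t s mA)); last by [].
  (* The constant value taken by the indicator of [B] on all histories from [x] whose first jump
     comes after [s]. *)
  pose b : \bar R := (`[< exists r o, (s < r)%R /\ B (hcons x r o) >] : nat)%:R%:E.
  have b0 : 0 <= b by rewrite lee_fin.
  have bE r o : (\1_(B `&` [set o | at_jump 0 s o]) (hcons x r o))%:E =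
      if (s < r)%R then b else 0.
    rewrite indicE; case: ifPn => sr; last first.
      by rewrite memNset// => -[_ /=]; rewrite hold_hcons; exact/negP.
    congr (_%:R%:E); congr nat_of_bool; apply/idP/asboolP.
      by rewrite inE => -[Bo _]; exists r, o.
    move=> [r1 [w1 [sr1 Bo1]]]; rewrite inE; split; last by rewrite /= hold_hcons.
    exact: past_events_before pB sr1 sr Bo1.
  pose h (r : R) := \int[Q x]_y \int[law y]_o (\1_A (process t (hcons x r o)))%:E.
  have h0 r : 0 <= h r.
    by apply: integral_ge0 => y _; apply: integral_ge0 => o _; rewrite lee_fin.
  have i0 o : 0 <= (\1_A (process t o))%:E :> \bar R by rewrite lee_fin.
  have mh : measurable_fun setT (h : RT -> _).
    exact: (measurable_renewal x i0 (mA' t)).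
  have hE : \int[eta]_r h r = transition t x A.
    rewrite -(integral_law x i0 (mA' t)).
    rewrite (_ : (fun o => _) = (fun o => (\1_(process t @^-1` A) o)%:E))//.
    by rewrite integral_indic ?setIT//; exact: mpre.
  transitivity (\int[eta]_r (if (s < r)%R then b * h (r - s)%R else 0)).
    apply: eq_integral => r _; case: ifPn => sr; last first.
      apply: integral0_eq => y _; apply: integral0_eq => o _.
      by rewrite bE (negbTE sr) mule0.
    transitivity (\int[Q x]_y
        (b * \int[law y]_o (\1_A (process t (hcons x (r - s) o)))%:E)).
      apply: eq_integral => y _; rewrite -ge0_integralZl//; last first.
        exact: (measurableT_comp (mA' t) (measurable_hcons x (r - s))).
      apply: eq_integral => o _; rewrite bE sr muleC; congr (_ * (\1_A _)%:E).
      rewrite !process_hcons ltrBrDl opprB addrA [(t + s)%R]addrC.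
      by rewrite [(s + t + _)%R]addrAC.
    rewrite ge0_integralZl; [by []|exact: measurableT| | |exact: b0].
      exact: (measurableT_comp (measurable_hcons_integral x i0 (mA' t))
        (pair1_measurable ((r - s)%R : RT))).
    by move=> y _; apply: integral_ge0 => w _; rewrite lee_fin.
  rewrite integral_gt.
  transitivity (b * (expR (- (lam * s)))%:E * transition t x A).
    rewrite -hE -muleA -(memoryless etaE s0 h0 mh).
    rewrite ge0_integralZl; [by []|exact: measurable_gt| | |exact: b0].
      apply: measurable_funTS; apply: (measurableT_comp mh).
      by apply: measurable_funB => //; exact: measurable_id.
    by move=> r _; exact: h0.
  transitivity (\int[eta]_r (if (s < r)%R then b * transition t x A else 0)).
    rewrite integral_gt integral_cst; last exact: measurable_gt.
    rewrite -[X in _ = _ * X]/(eta [set r | (s < r)%R]).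
    have -> : eta [set r | (s < r)%R] = (expR (- (lam * s)))%:E by exact: etaE.
    exact: muleAC.
  apply: eq_integral => r _; case: ifPn => sr; last first.
    apply/esym; apply: integral0_eq => y _; apply: integral0_eq => o _.
    by rewrite bE (negbTE sr) mule0.
  under [RHS]eq_integral => y _.
    under eq_integral => o _ do rewrite bE sr process_hcons sr muleC.
    rewrite integral_cst// lawT mule1.
    over.
  by rewrite /= integral_cst// prob_kernel mule1.
have mB := past_events_measurable pB.
have mD := measurableI _ _ mB (measurable_at n.+1 s).
have mA' u : measurable_fun setT (fun o => (\1_A (process u o))%:E : \bar R).
  exact: (measurableT_comp (measurable_EFin_indic mA) (measurable_process u)).
rewrite (integral_law_in x mD _ (mA' _)); last by move=> o; rewrite lee_fin.
rewrite (integral_law_in x mD _ (mtrans t s mA)); last by [].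
apply: eq_integral => r _; apply: eq_integral => y _.
have [rs|sr] := leP r s; last first.
  have z o : (\1_(B `&` [set o | at_jump n.+1 s o]) (hcons x r o))%:E = 0 :> \bar R.
    by rewrite indicE memNset// => -[_ /=]; rewrite hold_hcons leNgt sr.
  by rewrite !integral0_eq// => o _; rewrite z mule0.
have sr0 : (0 <= s - r)%R by rewrite subr_ge0.
have := IH _ y _ sr0 (past_events_hcons x rs pB).
pose D' := hcons x r @^-1` B `&` [set o | at_jump n (s - r) o].
have DD' o : \1_(B `&` [set o | at_jump n.+1 s o]) (hcons x r o) = \1_D' o :> R.
  rewrite !indicE; congr (_%:R); congr nat_of_bool; apply/idP/idP;
    by rewrite !inE /D' /= shift_hcons hold_hcons rs.
move=> IH'; have E := etrans (esym (restrict_indic D' _ y))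
  (etrans IH' (restrict_indic D' _ y)).
refine (etrans _ (etrans E _)); apply: eq_integral => o _; rewrite DD'; congr (_ * _).
  by rewrite process_hcons ltNge (le_trans rs) ?lerDl//= addrAC.
by rewrite process_hcons ltNge rs.
Qed.

(** The jump count at time [s] is unique, and it exists outside the null set of explosions by time
    [s]. *)
Lemma integral_split_jumps s x B (g : histories -> \bar R) : (0 <= s)%R ->
  measurable B -> measurable_fun setT g -> (forall o, 0 <= g o) ->
  \int[law x]_(o in B) g o =
  \sum_(n <oo) \int[law x]_(o in B `&` [set o | at_jump n s o]) g o.
Proof.
move=> s0 mB mg g0.
rewrite (@ge0_negligible_integral _ _ _ _ _ (exploding s))//; first last.
- exact: law_exploding.
- exact: measurable_funTS.
- exact: measurable_exploding.
rewrite -ge0_integral_bigcup//.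
- congr integral; apply/seteqP; split => o.
    move=> [Bo no]; have [n an] : exists n, at_jump n s o.
      by apply: contrapT => /forallNP na; apply: no => n; apply/negP; exact: na.
    by exists n.
  by move=> [n _ [Bo an]]; split => // /(_ n); rewrite an.
- by move=> n; apply: measurableI => //; exact: measurable_at.
- exact: measurable_funTS.
- apply/trivIsetP => i j _ _ /eqP ij; apply/seteqP; split => // o [[_ ai] [_ aj]].
  by apply: ij; exact: at_jump_inj ai aj.
Qed.

Lemma markov_property s t x A B : (0 <= s)%R -> (0 <= t)%R -> measurable A ->
  past_events s B ->
  law x (B `&` process (s + t) @^-1` A) =
  \int[law x]_(o in B) transition t (process s o) A.
Proof.
move=> s0 t0 mA pB; have mB := past_events_measurable pB.
rewrite setIC -integral_indic//; last exact: mpre.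
have mI : measurable_fun setT
    (fun o => (\1_(process (s + t) @^-1` A) o)%:E : \bar R).
  by apply: measurable_EFin_indic; exact: mpre.
rewrite (integral_split_jumps x s0 mB mI); last by move=> o; rewrite lee_fin.
rewrite (integral_split_jumps x s0 mB (mtrans t s mA)); last by [].
by apply: eq_eseriesr => n _; exact: markov_at_jump.
Qed.

Lemma transitionT t x : transition t x setT = 1.
Proof. exact: lawT. Qed.

HB.instance Definition _ t :=
  isKernel.Build _ _ _ _ _ (transition t) (measurable_transition t).
HB.instance Definition _ t :=
  Kernel_isProbability.Build _ _ _ _ _ (transition t) (transitionT t).

Lemma integral_transition t x (g : X -> \bar R) : (forall y, 0 <= g y) ->
  measurable_fun setT g ->
  \int[transition t x]_y g y = \int[law x]_o g (process t o).
Proof.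
move=> g0 mg; rewrite [LHS]ge0_integral_pushforward ?preimage_setT//.
exact: measurable_process.
Qed.

Lemma chapman_kolmogorov s t x A : (0 <= s)%R -> (0 <= t)%R -> measurable A ->
  transition (s + t) x A = \int[transition s x]_y transition t y A.
Proof.
move=> s0 t0 mA.
have pT : past_events s setT.
  rewrite -[setT]setD0; have [p0 pD _] : sigma_algebra setT (past_events s).
    exact: smallest_sigma_algebra.
  exact: pD.
rewrite integral_transition//; last exact: measurable_transition.
by have := markov_property x s0 t0 mA pT; rewrite setTI.
Qed.

Lemma integral_chapman_kolmogorov s t x (g : X -> \bar R) :
  (0 <= s)%R -> (0 <= t)%R -> (forall y, 0 <= g y) -> measurable_fun setT g ->
  \int[transition (s + t) x]_z g z =
  \int[transition s x]_y \int[transition t y]_z g z.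
Proof.
move=> s0 t0 g0 mg.
pose k := kpullback (transition t) (@measurable_snd _ _ X X).
transitivity (\int[kcomp (transition s) k x]_z g z).
  apply: eq_measure_integral => A mA _; exact: chapman_kolmogorov.
exact: (integral_kcomp (transition s) k x g0 mg).
Qed.

(** * Expansion of the transition function at short times *)

Section Generator.
Variables (g : X -> R) (N : R).
Hypotheses (mg : measurable_fun setT g) (g0 : forall y, (0 <= g y)%R)
  (gN : forall y, (g y <= N)%R).

Let mgE : measurable_fun setT (EFin \o g). Proof. exact/measurable_EFinP. Qed.
Let g0E y : 0 <= (g y)%:E. Proof. by rewrite lee_fin. Qed.
Let mgp s : measurable_fun setT (fun o => (g (process s o))%:E).
Proof. exact: (measurableT_comp mgE (measurable_process s)). Qed.
Let gp0 s o : 0 <= (g (process s o))%:E. Proof. exact: g0E. Qed.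
Let N0 (y : X) : (0 <= N)%R. Proof. exact: le_trans (g0 y) (gN y). Qed.

Let u s y := \int[law y]_o (g (process s o))%:E.
Let I s y := \int[law y]_(o in [set o | (hold o <= s)%R]) (g (process s o))%:E.

Let mhold s : measurable [set o : histories | (hold o <= s)%R].
Proof.
rewrite -[X in measurable X]setTI.
exact: (measurable_hold measurableT (measurable_le s)).
Qed.

Let law_hold s y : (0 <= s)%R -> law y [set o | (hold o <= s)%R] <= (q s)%:E.
Proof.
move=> s0; rewrite -[q s]expr1; apply: le_trans (law_late_le 1 y s0).
rewrite le_measure ?inE//; first exact: measurable_late.
by move=> o /= hs [|//] _ /=; rewrite -leNgt.
Qed.

(** Without a jump the process still sits at [y], an event of probability [exp (- lam s)]; [I]
    collects the histories that have jumped. *)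
Let uE s y : (0 <= s)%R -> u s y = (expR (- (lam * s)) * g y)%:E + I s y.
Proof.
move=> s0; pose D : set histories := [set o | at_jump 0 s o].
have mD : measurable D by exact: measurable_at.
have DC : [set o | (hold o <= s)%R] = ~` D.
  by apply/seteqP; split => o; rewrite /D/= leNgt => /negP.
rewrite /u /I DC -(setUv D) ge0_integral_setU//; first last.
- exact/disj_setPCl.
- exact: measurable_funTS.
- exact: measurableC.
congr (_ + _); rewrite (integral_law_in y mD (gp0 s) (mgp s)).
transitivity (\int[eta]_(r in [set r | (s < r)%R]) (g y)%:E); last first.
  rewrite integral_cst; last exact: measurable_gt.
  rewrite [X in _ * X](_ : _ = (expR (- (lam * s)))%:E); last exact: etaE.
  by rewrite muleC.
rewrite -integral_gt; apply: eq_integral => r _; case: ifPn => sr.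
  transitivity (\int[Q y]_z (g y)%:E); last first.
    by rewrite integral_cst// prob_kernel mule1.
  apply: eq_integral => z _; transitivity (\int[law z]_o (g y)%:E); last first.
    by rewrite integral_cst// lawT mule1.
  apply: eq_integral => w _.
  by rewrite process_hcons sr indicE mem_set ?mule1//= hold_hcons.
apply: integral0_eq => z _; apply: integral0_eq => w _.
by rewrite indicE memNset ?mule0// /D/= hold_hcons; exact/negP.
Qed.

Let I_ge0 s y : 0 <= I s y. Proof. by apply: integral_ge0. Qed.

Let I_le s y : (0 <= s)%R -> I s y <= (N * q s)%:E.
Proof.
move=> s0; apply: (@le_trans _ _ (\int[law y]_(o in [set o | (hold o <= s)%R]) N%:E)).
  by apply: ge0_le_integral => //; [exact: measurable_funTS|move=> o _; rewrite lee_fin].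
rewrite integral_cst// EFinM lee_wpmul2l ?lee_fin//; first exact: N0 y.
exact: law_hold.
Qed.

Let u_ge0 s y : 0 <= u s y. Proof. by apply: integral_ge0. Qed.

Let u_le s y : u s y <= N%:E.
Proof.
rewrite -[leRHS]mule1 -(lawT y) -integral_cst//.
by apply: ge0_le_integral => // o _; rewrite lee_fin.
Qed.

Let u_upper s y : (0 <= s)%R -> u s y <= (g y + N * q s)%:E.
Proof.
move=> s0; rewrite uE// EFinD leeD ?I_le// lee_fin ler_piMl//.
by rewrite -expR0 ler_expR oppr_le0 mulr_ge0// ltW.
Qed.

Let u_lower s y : (0 <= s)%R -> (g y)%:E <= u s y + (N * q s)%:E.
Proof.
move=> s0; rewrite uE// addeAC -EFinD (@le_trans _ _ (expR (- (lam * s)) * g y + N * q s)%:E)//.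
  rewrite lee_fin -lerBlDl -{1}[g y]mul1r -mulrBl -/(q s) mulrC.
  by rewrite ler_wpM2r// q_ge0.
by rewrite leeDl.
Qed.

Let G x := \int[Q x]_y (g y)%:E.

Let mIr x t : measurable_fun setT (fun r : RT => \int[Q x]_y \int[law y]_o
  ((g (process t (hcons x r o)))%:E * (\1_[set o | (hold o <= t)%R] (hcons x r o))%:E)).
Proof.
apply: (@measurable_renewal x (fun o => (g (process t o))%:E *
   (\1_[set o | (hold o <= t)%R] o)%:E)).
  by move=> o; rewrite mule_ge0 ?lee_fin.
by apply: emeasurable_funM => //; exact: measurable_EFin_indic.
Qed.

Let inner x t r : (0 <= t)%R -> \int[Q x]_y \int[law y]_o
  ((g (process t (hcons x r o)))%:E * (\1_[set o | (hold o <= t)%R] (hcons x r o))%:E) =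
  if (r <= t)%R then \int[Q x]_y u (t - r) y else 0.
Proof.
move=> t0; case: ifPn => rt; last first.
  apply: integral0_eq => y _; apply: integral0_eq => o _.
  by rewrite indicE memNset ?mule0//= hold_hcons; exact/negP.
apply: eq_integral => y _; apply: eq_integral => o _.
by rewrite process_hcons ltNge rt /= indicE mem_set ?mule1.
Qed.

Let mu s : measurable_fun setT (u s).
Proof.
apply: (eq_measurable_fun (fun y => \int[transition s y]_z (g z)%:E)).
  by move=> y _; rewrite integral_transition.
by apply: (@measurable_integral_pullback _ _ _ _ _ _ _ (transition s) id _
  (fun z => (g z.2)%:E)) => //; exact: (measurableT_comp mgE measurable_snd).
Qed.

Let mind (v : R) : measurable_fun setT
  (fun r : RT => (\1_[set r | (r <= v)%R] r)%:E : \bar R).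
Proof. by apply: measurable_EFin_indic; exact: measurable_le. Qed.

Let G_ge0 x : 0 <= G x. Proof. exact: integral_ge0. Qed.

(** Integral of the majorant used in both bounds of [I]: [c1] on holding times up to [t], and a
    spare [c2] for the null set [r <= 0], where only crude bounds are available. *)
Let integral_two t (c1 c2 : \bar R) : (0 <= t)%R -> 0 <= c1 -> 0 <= c2 ->
  \int[eta]_r (c1 * (\1_[set r | (r <= t)%R] r)%:E + c2 * (\1_[set r | (r <= 0)%R] r)%:E)
  = c1 * (q t)%:E.
Proof.
move=> t0 c10 c20; rewrite ge0_integralD//; last 4 first.
- by move=> r _; rewrite mule_ge0 ?lee_fin.
- exact: measurable_funeM.
- by move=> r _; rewrite mule_ge0 ?lee_fin.
- exact: measurable_funeM.
rewrite !ge0_integralZl// !integral_indic ?setIT//; [|exact: measurable_le|exact: measurable_le].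
rewrite [X in _ * X + _](_ : _ = (q t)%:E); last exact: (holding_le etaE t0).
rewrite [X in _ + _ * X](_ : _ = 0); last exact: (holding_le0 etaE (lexx 0%R)).
by rewrite mule0 adde0.
Qed.

(** After a first jump into [y] at a time [r] in []0, t]], the expectation [u (t - r) y] exceeds
    [g y] by at most [N q(t)], and such a jump has probability [q t]. *)
Let I_upper t x : (0 <= t)%R -> I t x <= (G x + (N * q t)%:E) * (q t)%:E.
Proof.
move=> t0; have Nq : (0 <= N * q t)%R by rewrite mulr_ge0 ?q_ge0// (N0 x).
have P0 : 0 <= G x + (N * q t)%:E by apply: adde_ge0; [exact: G_ge0|rewrite lee_fin].
rewrite -(@integral_two t _ N%:E)//; last by rewrite lee_fin (N0 x).
rewrite /I (integral_law_in x (mhold t) (gp0 t) (mgp t)).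
apply: ge0_le_integral => //.
- by move=> r _; rewrite inner//; case: ifP => // _; apply: integral_ge0.
- by apply: emeasurable_funD; exact: measurable_funeM.
- move=> r _; rewrite inner//.
  have [r0|r0] := leP r 0%R.
    apply: (@le_trans _ _ N%:E).
      case: ifP => // _; last by rewrite lee_fin (N0 x).
      rewrite -[leRHS]mule1 -(prob_kernel (s := Q) x) -integral_cst//.
      exact: ge0_le_integral.
    rewrite [X in _ + _ * X%:E]indicE mem_set// mule1 leeDr//.
    by apply: mule_ge0; [exact: P0|rewrite lee_fin].
  have [rt|tr] := leP r t; last first.
    by apply: adde_ge0; apply: mule_ge0; rewrite ?lee_fin ?(N0 x).
  rewrite [X in _ * X%:E + _]indicE mem_set// mule1.
  apply: (@le_trans _ _ (G x + (N * q t)%:E)); last first.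
    by rewrite leeDl// mule_ge0 ?lee_fin// (N0 x).
  rewrite -[X in _ + X]mule1 -(prob_kernel (s := Q) x) -integral_cst// -ge0_integralD//.
  apply: ge0_le_integral => //.
  + exact: emeasurable_funD.
  + move=> y _; rewrite (le_trans (u_upper _ _)) ?subr_ge0// lee_fin lerD2l.
    by rewrite ler_wpM2l ?(N0 x)// q_le// gerBl ltW.
Qed.

Let I_lower t x : (0 <= t)%R -> G x * (q t)%:E <= I t x + (N * q t)%:E * (q t)%:E.
Proof.
move=> t0; have Nq : (0 <= N * q t)%R by rewrite mulr_ge0 ?q_ge0// (N0 x).
have Nx : 0 <= N%:E by rewrite lee_fin (N0 x).
rewrite -(@integral_two t (G x) 0)// -(@integral_two t (N * q t)%:E N%:E)//.
rewrite /I (integral_law_in x (mhold t) (gp0 t) (mgp t)) -ge0_integralD//; last 3 first.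
- by move=> r _; rewrite inner//; case: ifP => // _; apply: integral_ge0.
- by move=> r _; rewrite adde_ge0 ?mule_ge0 ?lee_fin.
- by apply: emeasurable_funD; exact: measurable_funeM.
apply: ge0_le_integral => //.
- by move=> r _; rewrite adde_ge0 ?mule_ge0 ?lee_fin.
- by apply: emeasurable_funD; exact: measurable_funeM.
- by apply: emeasurable_funD => //; apply: emeasurable_funD; exact: measurable_funeM.
- move=> r _; rewrite mul0e adde0 inner//.
  have [r0|r0] := leP r 0%R.
    rewrite (le_trans r0 t0); apply: (@le_trans _ _ N%:E).
      rewrite -[leRHS]mule1.
      apply: (@le_trans _ _ (N%:E * 1)); last by rewrite mule1.
      apply: lee_pmul => //; last by rewrite lee_fin indicE; case: (_ \in _).
      rewrite -[leRHS]mule1 -(prob_kernel (s := Q) x) -integral_cst//.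
      by apply: ge0_le_integral => // y _; rewrite lee_fin.
    rewrite [X in _ + (_ + _ * X%:E)]indicE mem_set// mule1 addeA leeDr//.
    by rewrite adde_ge0 ?mule_ge0 ?lee_fin//; apply: integral_ge0.
  have [rt|tr] := leP r t; last first.
    by rewrite indicE memNset ?mule0 ?adde_ge0 ?mule_ge0 ?lee_fin//= leNgt tr.
  rewrite indicE mem_set// !mule1 addeA.
  apply: (@le_trans _ _ (\int[Q x]_y u (t - r) y + (N * q t)%:E)); last first.
    by rewrite leeDl// mule_ge0 ?lee_fin.
  rewrite -[X in _ + X]mule1 -(prob_kernel (s := Q) x) -integral_cst// -ge0_integralD//.
  apply: ge0_le_integral => //.
  + exact: emeasurable_funD.
  + move=> y _; apply: (le_trans (u_lower y (_ : (0 <= t - r)%R))); first by rewrite subr_ge0.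
    by rewrite leeD2l// lee_fin ler_wpM2l ?(N0 x)// q_le// gerBl ltW.
Qed.

(** Put [a = lam t], [b = q t], let [c] be the mean of [g] under [Q x] and [i] the jumped part. The
    quantity equals [(i - b c) + (b - a)(c - g x)]. Each summand is at most [N a^2] in absolute
    value: the first because [b <= a], the second because [a - b <= a^2]. *)
Lemma ge0_generator_estimate t x : (0 <= t)%R ->
  (`|fine (\int[transition t x]_y (g y)%:E) - g x -
     lam * t * (fine (\int[Q x]_y (g y)%:E) - g x)| <= 2 * N * (lam * t) ^+ 2)%R.
Proof.
move=> t0; rewrite integral_transition//.
have Nx : (0 <= N)%R by exact: N0 x.
have GN : G x <= N%:E.
  rewrite -[leRHS]mule1 -(prob_kernel (s := Q) x) -integral_cst//.
  by apply: ge0_le_integral => // y _; rewrite lee_fin.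
have Gf : G x \is a fin_num by rewrite ge0_fin_numE// (le_lt_trans GN) ?ltry.
have If : I t x \is a fin_num by rewrite ge0_fin_numE// (le_lt_trans (I_le x t0)) ?ltry.
have := uE x t0; rewrite /u => ->.
have := I_upper x t0; have := I_lower x t0; rewrite -/(G x).
move: GN (G_ge0 x); rewrite -(fineK Gf) -(fineK If).
move: (fine (G x)) (fine (I t x)) => c i.
rewrite -!(EFinD, EFinM) !lee_fin /= => cN c0 il iu.
have a0 : (0 <= lam * t)%R by rewrite mulr_ge0// ltW.
have qE : expR (- (lam * t)) = (1 - q t)%R by rewrite /q opprB addrC subrK.
have qa : (q t <= lam * t)%R.
  by rewrite /q lerBlDr -lerBlDl; have := expR_ge1Dx (- (lam * t)); rewrite addrC.
have aq : (lam * t - q t <= (lam * t) ^+ 2)%R.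
  rewrite /q; have ea : (expR (- (lam * t)) * (1 + lam * t) <= 1)%R.
    rewrite -[leRHS]expR0 -(addNr (lam * t)%R) expRD ler_pM2l ?expR_gt0//.
    exact: expR_ge1Dx.
  have e0 := expR_gt0 (- (lam * t)).
  move: (lam * t)%R (expR _) a0 ea e0 => a e a0 ea e0; nra.
have q0 := q_ge0 t0.
rewrite qE; move: (lam * t)%R (q t) (g x) (g0 x) (gN x) a0 qa aq q0 il iu {qE} =>
  a b gx gx0 gxN a0 qa aq q0 il iu.
have h1 : (`|i - b * c| <= N * a ^+ 2)%R.
  have : (N * b * b <= N * a ^+ 2)%R by rewrite -mulrA ler_wpM2l// expr2 ler_pM.
  by move=> Nb; rewrite ler_norml; apply/andP; split; lra.
have h2 : (`|(b - a) * (c - gx)| <= N * a ^+ 2)%R.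
  rewrite normrM mulrC; apply: ler_pM => //; rewrite ler_norml; apply/andP; split; lra.
rewrite (_ : (_ - _ = (i - b * c) + (b - a) * (c - gx))%R); last by ring.
apply: (le_trans (ler_normD _ _)); lra.
Qed.

End Generator.

End JumpProcess.

(** * The Cauchy problem for a bounded generator *)

Section BoundedRintegral.
Context d (T : measurableType d) (R : realType) (mu : {measure set T -> \bar R}).
Hypothesis mu1 : mu setT = 1%E.

Lemma bounded_Rintegrable (f : T -> R) (M : R) : measurable_fun setT f ->
  (forall x, `|f x| <= M) -> mu.-integrable setT (EFin \o f).
Proof.
move=> mf fM; apply: (@bounded_integrable _ _ _ _ _ M).
- by rewrite mu1 ltry.
- exact/measurable_EFinP.
- by move=> x; rewrite lee_fin.
Qed.

Lemma Rintegral_prob_cst (r : R) : \int[mu]_x r = r.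
Proof. by rewrite Rintegral_cst// mu1 mulr1. Qed.

Lemma normr_Rintegral_le (f : T -> R) (M : R) : measurable_fun setT f ->
  (forall x, `|f x| <= M) -> `|\int[mu]_x f x| <= M.
Proof.
move=> mf fM; have fi := bounded_Rintegrable mf fM.
apply: (le_trans (le_normr_Rintegral _ fi)) => //.
rewrite -[leRHS]Rintegral_prob_cst; apply: le_Rintegral => //.
  apply: (@bounded_Rintegrable _ M); first exact: measurableT_comp.
  by move=> x; rewrite normr_id.
by apply: (@bounded_Rintegrable _ `|M|).
Qed.

Lemma Rintegral_shift (f : T -> R) (M c : R) : measurable_fun setT f ->
  (forall x, `|f x| <= M) ->
  fine (\int[mu]_x (f x + c)%:E) = \int[mu]_x f x + c.
Proof.
move=> mf fM; rewrite -[X in _ + X]Rintegral_prob_cst -RintegralD//.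
  exact: bounded_Rintegrable fM.
by apply: (@bounded_Rintegrable _ `|c|).
Qed.

Lemma Rintegral_dist (f g : T -> R) (M N e : R) :
  measurable_fun setT f -> measurable_fun setT g ->
  (forall x, `|f x| <= M) -> (forall x, `|g x| <= N) ->
  (forall x, `|f x - g x| <= e) -> `|\int[mu]_x f x - \int[mu]_x g x| <= e.
Proof.
move=> mf mg fM gN fge; rewrite -RintegralB//; last 2 first.
- exact: bounded_Rintegrable fM.
- exact: bounded_Rintegrable gN.
by apply: normr_Rintegral_le => //; exact: measurable_funB.
Qed.

End BoundedRintegral.

Lemma uniform_cvgP (R : realType) (X : ptopologicalType) (F : set_system R)
    (h : R -> X -> R) (l : X -> R) : Filter F ->
  {uniform, h @ F --> l} <->
  forall e, 0 < e -> \forall s \near F, forall x, `|h s x - l x| < e.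
Proof.
move=> FF; split => [hl e e0|hl P /uniform_nbhs[E [entE EP]]].
  apply: (hl [set g | forall x, `|g x - l x| < e]); apply/uniform_nbhs.
  exists [set xy | `|xy.1 - xy.2| < e]; split.
    by rewrite -entourage_ballE; exists e.
  by move=> g /= lg x; rewrite distrC; exact: lg.
move: entE; rewrite -entourage_ballE => -[e /= e0 eE].
have := hl e e0; rewrite /nbhs /=; apply: filterS => s hs.
by apply: EP => y _; apply: eE; rewrite /ball /= distrC; exact: hs.
Qed.

Lemma continuous_borel (R : realType) (X : ptopologicalType) (f : X -> R) :
  continuous f -> measurable_fun setT (f : borel X -> measurableTypeR R).
Proof.
move=> /continuousP cf; apply: (measurability _ (RGenOpens.measurableE R)).
move=> _ [_ [a [b ->] <-]]; rewrite setTI; apply: sub_sigma_algebra.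
exact/cf/interval_open.
Qed.

(** * The semigroup and the Cauchy problem it solves *)

Section BoundedGenerator.
Context (R : realType) (X : ptopologicalType).
Variables (Q : R.-pker (borel X) ~> (borel X)) (lam : R).
Hypothesis lam0 : 0 < lam.

Definition generator (psi : X -> R) (x : X) : R :=
  lam * (\int[Q x]_y psi y - psi x).

Let Q1 x : Q x setT = 1%E. Proof. exact: prob_kernel. Qed.

Let bound_ge0 (psi : X -> R) M : (forall x, `|psi x| <= M) -> 0 <= M.
Proof. by move=> /(_ point); exact: le_trans. Qed.

Lemma generator_dist (f g : X -> R) (M N e : R) :
  measurable_fun setT (f : borel X -> _) -> measurable_fun setT (g : borel X -> _) ->
  (forall x, `|f x| <= M) -> (forall x, `|g x| <= N) ->
  (forall x, `|f x - g x| <= e) ->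
  forall x, `|generator f x - generator g x| <= 2 * lam * e.
Proof.
move=> mf mg fM gN fge x; rewrite /generator.
have := Rintegral_dist (Q1 x) mf mg fM gN fge; have := fge x.
move: (\int[Q x]_y f y) (\int[Q x]_y g y) => a b h1 h2.
rewrite (_ : _ - _ = lam * (a - b - (f x - g x))); last by ring.
rewrite normrM gtr0_norm// [2 * lam]mulrC -mulrA ler_pM2l//.
by apply: (le_trans (ler_normB _ _)); lra.
Qed.

Lemma generator_bound (f : X -> R) (M : R) :
  measurable_fun setT (f : borel X -> _) -> (forall x, `|f x| <= M) ->
  forall x, `|generator f x| <= 2 * lam * M.
Proof.
move=> mf fM x; rewrite /generator normrM gtr0_norm// [2 * lam]mulrC -mulrA ler_pM2l//.
have := normr_Rintegral_le (Q1 x) mf fM; have := fM x => h1 h2.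
by apply: (le_trans (ler_normB _ _)); lra.
Qed.

Variable eta : probability (measurableTypeR R) R.
Hypothesis etaE : forall s, 0 <= s ->
  eta [set r | s < r] = (expR (- (lam * s)))%:E.

Local Notation law := (law Q eta).
Local Notation trans := (transition Q eta).

Definition semigroup t (g : X -> R) (x : X) : R := \int[trans t x]_y g y.

Let tr1 t x : trans t x setT = 1%E. Proof. exact: transitionT. Qed.

Lemma semigroup_bound t (g : X -> R) M : measurable_fun setT (g : borel X -> _) ->
  (forall x, `|g x| <= M) -> forall x, `|semigroup t g x| <= M.
Proof. by move=> mg gM x; exact: (normr_Rintegral_le (tr1 t x)). Qed.

(** The integrals over histories were treated for non-negative functions; adding [M] reduces a
    function bounded by [M] to that case, with the bound [2 M]. *)
Let shifted (g : X -> R) M : (forall x, `|g x| <= M) ->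
  (forall x, 0 <= g x + M) /\ (forall x, g x + M <= 2 * M).
Proof. by move=> gM; split => x; have := gM x; rewrite ler_norml => /andP[]; lra. Qed.

Let mshift (g : X -> R) M : measurable_fun setT (g : borel X -> _) ->
  measurable_fun setT (fun x : borel X => (g x + M)%:E).
Proof. by move=> mg; apply/measurable_EFinP; exact: measurable_funD. Qed.

Let semigroupE t (g : X -> R) M : measurable_fun setT (g : borel X -> _) ->
  (forall x, `|g x| <= M) -> forall x,
  (\int[trans t x]_y (g y + M)%:E)%E = (semigroup t g x + M)%:E.
Proof.
move=> mg gM x; rewrite -(Rintegral_shift (tr1 t x) M mg gM) fineK//.
have [g0 g2] := shifted gM.
apply: integrable_fin_num => //.
apply: (@bounded_Rintegrable _ _ _ _ (tr1 t x) _ (2 * M)).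
  by apply: measurable_funD.
by move=> y; rewrite ger0_norm.
Qed.

Lemma measurable_semigroup t (g : X -> R) M : measurable_fun setT (g : borel X -> _) ->
  (forall x, `|g x| <= M) -> measurable_fun setT (semigroup t g : borel X -> _).
Proof.
move=> mg gM; have [g0 _] := shifted gM.
apply/measurable_EFinP.
apply: (eq_measurable_fun (fun x : borel X =>
    (\int[trans t x]_y (g y + M)%:E - M%:E)%E)).
  by move=> x _; rewrite (semigroupE t mg gM) -EFinB addrK.
apply: emeasurable_funB => //.
apply: (@measurable_integral_pullback _ _ _ _ _ _ _ (trans t) id _
  (fun z => (g z.2 + M)%:E)) => //.
  by move=> z; rewrite lee_fin.
exact: (measurableT_comp (mshift M mg) measurable_snd).
Qed.

Lemma semigroupD s t (g : X -> R) M : 0 <= s -> 0 <= t ->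
  measurable_fun setT (g : borel X -> _) -> (forall x, `|g x| <= M) ->
  forall x, semigroup (s + t) g x = semigroup s (semigroup t g) x.
Proof.
move=> s0 t0 mg gM x; have [g0 _] := shifted gM.
apply: (addIr M); apply: EFin_inj.
rewrite -[LHS](semigroupE (s + t) mg gM x).
transitivity (\int[trans s x]_y \int[trans t y]_z (g z + M)%:E)%E.
  apply: (@integral_chapman_kolmogorov _ _ _ Q eta lam); [exact: lam0|exact: etaE| | | |].
  - exact: s0.
  - exact: t0.
  - by move=> y; rewrite lee_fin.
  - exact: mshift.
rewrite -[RHS](semigroupE s (measurable_semigroup t mg gM) (semigroup_bound t mg gM) x).
by apply: eq_integral => y _; rewrite (semigroupE t mg gM y).
Qed.

(** The expansion for [g + M], which lies between 0 and [2 M]: the constant [2 N] becomes [4 M], and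
    the shift cancels everywhere else. *)
Lemma semigroup_estimate t (g : X -> R) M : 0 <= t ->
  measurable_fun setT (g : borel X -> _) -> (forall x, `|g x| <= M) ->
  forall x, `|semigroup t g x - g x - t * generator g x| <= 4 * M * (lam * t) ^+ 2.
Proof.
move=> t0 mg gM x; have [g0 g2] := shifted gM.
have mgs : measurable_fun setT (fun x : borel X => g x + M) by exact: measurable_funD.
have := @ge0_generator_estimate _ _ _ Q eta lam lam0 etaE _ _ mgs g0 g2 t x t0.
rewrite (semigroupE _ mg gM) (Rintegral_shift (Q1 x) M mg gM) /generator /=.
move: (semigroup t g x) (\int[Q x]_y g y) => a b.
rewrite (_ : a + M - _ - _ = a - g x - t * (lam * (b - g x))); last by ring.
by rewrite !mulrA (_ : (2 * 2 = 4 :> R)) -?natrM.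
Qed.

Lemma semigroup0 (g : X -> R) M :
  measurable_fun setT (g : borel X -> _) -> (forall x, `|g x| <= M) ->
  forall x, semigroup 0 g x = g x.
Proof.
move=> mg gM x; apply/eqP; rewrite -subr_eq0 -normr_le0.
by have := semigroup_estimate (lexx 0) mg gM x; rewrite mul0r subr0 mulr0 expr0n mulr0.
Qed.

Lemma semigroup_near_id t (g : X -> R) M : 0 <= t -> t <= 1 ->
  measurable_fun setT (g : borel X -> _) -> (forall x, `|g x| <= M) ->
  forall x, `|semigroup t g x - g x| <= (2 * lam * M + 4 * M * lam ^+ 2) * t.
Proof.
move=> t0 t1 mg gM x; have M0 := bound_ge0 gM.
have := semigroup_estimate t0 mg gM x; have := generator_bound mg gM x.
move: (semigroup t g x - g x) (generator g x) => a b hb hab.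
have : `|t * b| <= 2 * lam * M * t.
  by rewrite normrM ger0_norm// mulrC ler_wpM2r.
have : 4 * M * (lam * t) ^+ 2 <= 4 * M * lam ^+ 2 * t.
  have t2 : t ^+ 2 <= t by rewrite expr2 ler_piMl.
  have K0 : 0 <= 4 * M * lam ^+ 2 by rewrite mulr_ge0 ?sqr_ge0// mulr_ge0.
  by rewrite exprMn mulrA; exact: ler_wpM2l.
move=> h1 h2; rewrite -[a](subrK (t * b)); apply: (le_trans (ler_normD _ _)).
lra.
Qed.

Hypothesis generator_continuous : forall psi : X -> R,
  bounded_continuous psi -> continuous (generator psi).

Let bcm (psi : X -> R) : bounded_continuous psi -> measurable_fun setT (psi : borel X -> _).
Proof. by move=> [cpsi _]; exact: continuous_borel. Qed.

(* [semigroup t g] is the uniform limit of [(1 + (t / n) generator)^n g]. *)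
Lemma semigroup_continuous t (g : X -> R) : 0 <= t ->
  bounded_continuous g -> bounded_continuous (semigroup t g).
Proof.
move=> t0 bg; have mg := bcm bg; have [cg [M gM]] := bg.
split; last by exists M; exact: semigroup_bound.
have M0 := bound_ge0 gM.
(* One Euler step. For [a lam <= 1] it is a convex combination of [psi x] and the mean of [psi]
   under [Q x], hence non-expansive in sup norm and compatible with the bound [M]; it preserves
   continuity because the generator does. *)
pose A a (psi : X -> R) x := psi x + a * generator psi x.
have AM a psi : 0 <= a -> a * lam <= 1 -> bounded_continuous psi ->
    (forall x, `|psi x| <= M) -> bounded_continuous (A a psi) /\
    (forall x, `|A a psi x| <= M).
  move=> a0 a1 bpsi psiM; have mpsi := bcm bpsi.
  have AM' x : `|A a psi x| <= M.
    rewrite /A /generator (_ : _ + _ = (1 - a * lam) * psi x + a * lam * \int[Q x]_y psi y);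
      last by ring.
    apply: (le_trans (ler_normD _ _)); rewrite !normrM.
    rewrite (ger0_norm (_ : 0 <= 1 - a * lam)) ?subr_ge0//.
    rewrite (ger0_norm a0) (gtr0_norm lam0).
    have := psiM x; have := normr_Rintegral_le (Q1 x) mpsi psiM => h1 h2.
    apply: (@le_trans _ _ ((1 - a * lam) * M + a * lam * M)); last lra.
    by apply: lerD; apply: ler_wpM2l => //; rewrite ?subr_ge0// mulr_ge0// ltW.
  split => //; split; last by exists M.
  move=> x; apply: cvgD; first exact: (bpsi.1 x).
  by apply: cvgMr; exact: generator_continuous.
have Aiter a n : 0 <= a -> a * lam <= 1 -> bounded_continuous (iter n (A a) g) /\
    (forall x, `|iter n (A a) g x| <= M).
  by move=> a0 a1; elim: n => [|n [IH1 IH2]] //=; exact: AM.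
have Adist a (f1 f2 : X -> R) e : 0 <= a -> a * lam <= 1 ->
    measurable_fun setT (f1 : borel X -> _) -> measurable_fun setT (f2 : borel X -> _) ->
    (forall x, `|f1 x| <= M) -> (forall x, `|f2 x| <= M) ->
    (forall x, `|f1 x - f2 x| <= e) -> forall x, `|A a f1 x - A a f2 x| <= e.
  move=> a0 a1 mf1 mf2 f1M f2M f12 x; rewrite /A /generator.
  have := Rintegral_dist (Q1 x) mf1 mf2 f1M f2M f12; have := f12 x.
  move: (\int[Q x]_y f1 y) (\int[Q x]_y f2 y) => b c h1 h2.
  rewrite (_ : _ - _ = (1 - a * lam) * (f1 x - f2 x) + a * lam * (b - c)); last by ring.
  apply: (le_trans (ler_normD _ _)); rewrite !normrM.
  rewrite (ger0_norm (_ : 0 <= 1 - a * lam)) ?subr_ge0//.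
  rewrite (ger0_norm a0) (gtr0_norm lam0).
  apply: (@le_trans _ _ ((1 - a * lam) * e + a * lam * e)); last lra.
  by apply: lerD; apply: ler_wpM2l => //; rewrite ?subr_ge0// mulr_ge0// ltW.
(* Errors only add up: every step makes the local error of [semigroup_estimate], and the earlier
   error is not enlarged by [A a]. *)
have key a n : 0 <= a -> a * lam <= 1 -> forall x,
    `|semigroup (a *+ n) g x - iter n (A a) g x| <= (4 * M * (lam * a) ^+ 2) *+ n.
  move=> a0 a1; elim: n => [|n IH] x.
    by rewrite !mulr0n /= (semigroup0 mg gM) subrr normr0.
  have an0 : 0 <= a *+ n by rewrite mulrn_wge0.
  have [bi iM] := Aiter a n a0 a1.
  have ms := measurable_semigroup (a *+ n) mg gM.
  have sM := semigroup_bound (a *+ n) mg gM.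
  rewrite mulrS (semigroupD a0 an0 mg gM) /=.
  rewrite -(subrKA (A a (semigroup (a *+ n) g) x)).
  apply: (le_trans (ler_normD _ _)); rewrite mulrS; apply: lerD.
    have := semigroup_estimate a0 ms sM x; rewrite /A.
    by rewrite opprD addrA.
  by apply: Adist => //; exact: bcm.
move=> x; apply/cvgrPdist_lt => e e0.
pose C := 4 * M * (lam * t) ^+ 2.
have C0 : 0 <= C by rewrite mulr_ge0 ?sqr_ge0// mulr_ge0.
(* Large enough for two needs: steps of length [t / n] satisfy [a lam <= 1], and the total error
   [C / n] is below [e / 3]. *)
pose n := (Num.truncn (t * lam + C / (e / 3))).+1.
have nE : t * lam + C / (e / 3) < n%:R by exact: Num.Theory.truncnS_gt.
have n0 : 0 < n%:R :> R by rewrite ltr0n.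
have Ce : 0 <= C / (e / 3) by rewrite divr_ge0// divr_ge0// ltW.
have tl : 0 <= t * lam by rewrite mulr_ge0// ltW.
pose a := t / n%:R.
have a0 : 0 <= a by rewrite divr_ge0// ltW.
have a1 : a * lam <= 1.
  by rewrite /a mulrAC ler_pdivrMr// mul1r; lra.
have an : a *+ n = t by rewrite -mulr_natr /a divfK// gt_eqF.
have close y : `|semigroup t g y - iter n (A a) g y| < e / 3.
  have := key a n a0 a1 y; rewrite an => /le_lt_trans; apply.
  have -> : 4 * M * (lam * a) ^+ 2 *+ n = C / n%:R.
    by rewrite -mulr_natr /C /a; field; rewrite gt_eqF.
  rewrite ltr_pdivrMr// -ltr_pdivrMl ?divr_gt0// mulrC.
  by lra.
have [[ci _] _] := Aiter a n a0 a1.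
have /cvgrPdist_lt/(_ (e / 3)) := ci x.
rewrite divr_gt0// => /(_ isT); apply: filterS => y.
have := close x; have := close y.
move: (semigroup t g x) (semigroup t g y) (iter n (A a) g x) (iter n (A a) g y).
move=> u v u' v'; rewrite !ltr_norml => /andP[h1 h2] /andP[h3 h4] /andP[h5 h6].
by apply/andP; split; lra.
Qed.

(** For left difference quotients. The expansion runs forward from the earlier time, so the
    generator there, [e], is exchanged for the generator at the later time, [f]. The constant is the
    sum of [4 M lam^2] and [2 lam (2 lam M + 4 M lam^2)]. *)
Let second_order (M dd a c e f : R) : 0 <= dd ->
  `|a - c - dd * e| <= 4 * M * (lam * dd) ^+ 2 ->
  `|e - f| <= 2 * lam * ((2 * lam * M + 4 * M * lam ^+ 2) * dd) ->
  `|c - a - - dd * f| <= (8 * M * lam ^+ 2 + 8 * M * lam ^+ 3) * dd ^+ 2.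
Proof.
move=> d0 est gd.
have gd' : `|dd * (e - f)| <= dd * (2 * lam * ((2 * lam * M + 4 * M * lam ^+ 2) * dd)).
  by rewrite normrM ger0_norm// ler_wpM2l.
rewrite (_ : c - a - - dd * f = - (a - c - dd * e) - dd * (e - f)); last by ring.
apply: (le_trans (ler_normB _ _)); rewrite normrN.
apply: (le_trans (lerD est gd')); rewrite le_eqVlt; apply/orP; left; apply/eqP; ring.
Qed.

Let semigroup_diff t (g : X -> R) M : 0 <= t ->
  measurable_fun setT (g : borel X -> _) -> (forall x, `|g x| <= M) ->
  forall s, 0 <= s -> `|s - t| <= 1 -> forall x,
  `|semigroup s g x - semigroup t g x - (s - t) * generator (semigroup t g) x| <=
  (8 * M * lam ^+ 2 + 8 * M * lam ^+ 3) * (s - t) ^+ 2 /\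
  `|semigroup s g x - semigroup t g x| <= (2 * lam * M + 4 * M * lam ^+ 2) * `|s - t|.
Proof.
move=> t0 mg gM s s0 st x; have M0 := bound_ge0 gM.
have m u := measurable_semigroup u mg gM.
have b u := semigroup_bound u mg gM.
have l2 : 0 <= lam ^+ 2 by rewrite sqr_ge0.
have l3 : 0 <= lam ^+ 3 by rewrite exprn_ge0// ltW.
have M2 : 0 <= M * lam ^+ 2 by rewrite mulr_ge0.
have M3 : 0 <= M * lam ^+ 3 by rewrite mulr_ge0.
have [ts|st'] := leP t s.
  have d0 : 0 <= s - t by rewrite subr_ge0.
  rewrite ger0_norm// in st *.
  have E y : semigroup s g y = semigroup (s - t) (semigroup t g) y.
    by rewrite -(semigroupD d0 t0 mg gM) subrK.
  rewrite E; split; last exact: semigroup_near_id.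
  apply: (le_trans (semigroup_estimate d0 (m t) (b t) x)).
  rewrite exprMn mulrA ler_wpM2r ?sqr_ge0//; lra.
have d0 : 0 <= t - s by rewrite subr_ge0 ltW.
have d1 : t - s <= 1 by rewrite distrC ger0_norm in st.
have E y : semigroup t g y = semigroup (t - s) (semigroup s g) y.
  by rewrite -(semigroupD d0 s0 mg gM) subrK.
have near y := semigroup_near_id d0 d1 (m s) (b s) y.
have est := semigroup_estimate d0 (m s) (b s) x.
have gd : `|generator (semigroup s g) x - generator (semigroup t g) x| <=
    2 * lam * ((2 * lam * M + 4 * M * lam ^+ 2) * (t - s)).
  apply: (generator_dist (m s) (m t) (b s) (b t)) => y.
  by rewrite distrC E; exact: near.
split; last first.
  rewrite distrC [X in _ <= _ * X]distrC [X in _ <= _ * X]ger0_norm// E; exact: near.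
rewrite -E in est.
have sE : s - t = - (t - s) by rewrite opprB.
by rewrite sE sqrrN; exact: second_order d0 est gd.
Qed.

Lemma semigroup_solution (h0 : X -> R) : bounded_continuous h0 ->
  cauchy_solution generator h0 (fun t => semigroup t h0).
Proof.
move=> bh; have mh := bcm bh; have [ch [M hM]] := bh.
have M0 := bound_ge0 hM.
pose c1 := 8 * M * lam ^+ 2 + 8 * M * lam ^+ 3.
pose c2 := 2 * lam * M + 4 * M * lam ^+ 2.
have l2 : 0 <= lam ^+ 2 by rewrite sqr_ge0.
have l3 : 0 <= lam ^+ 3 by rewrite exprn_ge0// ltW.
have M1 : 0 <= lam * M by rewrite mulr_ge0// ltW.
have M2 : 0 <= M * lam ^+ 2 by rewrite mulr_ge0.
have M3 : 0 <= M * lam ^+ 3 by rewrite mulr_ge0.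
have c10 : 0 <= c1 by rewrite /c1; lra.
have c20 : 0 <= c2 by rewrite /c2; lra.
split.
- by move=> t t0; exact: semigroup_continuous.
- by apply/funext => x; exact: semigroup0 mh hM x.
- move=> t t0; apply/uniform_cvgP => e e0.
  rewrite /within /= /dnbhs /=; apply/nbhs_ballP.
  (* The minimum with 1 keeps [s] in the range of [semigroup_diff]; the added 1 covers [c1 = 0]. *)
  exists (Num.min 1 (e / (c1 + 1))) => /=.
    by rewrite lt_min ltr01 divr_gt0// ltr_wpDl.
  move=> s; rewrite /ball /= lt_min => /andP[s1 se] st s0 x.
  rewrite distrC in s1 se.
  have st0 : s - t != 0 by rewrite subr_eq0.
  have [h _] := semigroup_diff t0 mh hM s0 (ltW s1) x.
  rewrite /= -[X in `|X|](_ : (s - t)^-1 * (semigroup s h0 x - semigroup t h0 x -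
     (s - t) * generator (semigroup t h0) x) = _); last first.
    by rewrite mulrBr mulKf.
  rewrite normrM normfV mulrC ltr_pdivrMr ?normr_gt0//.
  apply: (le_lt_trans h); rewrite -[(s - t) ^+ 2]real_normK ?num_real// [`|_| ^+ 2]expr2 mulrA.
  rewrite ltr_pM2r ?normr_gt0// -/c1.
  apply: (@le_lt_trans _ _ ((c1 + 1) * `|s - t|)).
    by rewrite ler_wpM2r// lerDl.
  by rewrite mulrC -ltr_pdivlMr// ltr_wpDl.
- move=> t t0; apply/uniform_cvgP => e e0; apply/nbhs_ballP.
  exists (Num.min (Num.min 1 t) (e / (2 * lam * c2 + 1))) => /=.
    by rewrite !lt_min ltr01 t0 divr_gt0// ltr_wpDl// mulr_ge0// mulr_ge0// ltW.
  move=> s; rewrite /ball /= !lt_min => /andP[/andP[s1 st] se] x.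
  have s0 : 0 <= s by move: st; rewrite ltr_norml => /andP[_]; lra.
  rewrite distrC in s1 se.
  have m u := measurable_semigroup u mh hM.
  have b u := semigroup_bound u mh hM.
  apply: (@le_lt_trans _ _ (2 * lam * (c2 * `|s - t|))).
    apply: (generator_dist (m s) (m t) (b s) (b t)) => y.
    by have [_] := semigroup_diff (ltW t0) mh hM s0 (ltW s1) y.
  apply: (@le_lt_trans _ _ ((2 * lam * c2 + 1) * `|s - t|)).
    by rewrite mulrA ler_wpM2r// lerDl.
  by rewrite mulrC -ltr_pdivlMr// ltr_wpDl// mulr_ge0// mulr_ge0// ltW.
Qed.

Let is_derive_ball (f : R -> R) (t l : R) :
  (forall e, 0 < e -> exists2 dl, 0 < dl & forall s, s != t -> `|s - t| < dl ->
     `|(s - t)^-1 * (f s - f t) - l| < e) -> is_derive t 1 f l.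
Proof.
move=> fl.
have cv : (fun h : R => h^-1 *: (f (h *: 1 + t) - f t)) @ 0^' --> l.
  apply/cvgrPdist_lt => e /fl[dl dl0 hd]; rewrite /dnbhs /within /=.
  apply/nbhs_ballP; exists dl => //= h; rewrite /ball /= sub0r normrN => hdl h0.
  have := hd (h + t); rewrite -subr_eq0 addrK => /(_ h0 hdl).
  by rewrite distrC /GRing.scale /= mulr1.
by apply: DeriveDef; [apply/cvg_ex; exists l|exact: cvg_lim].
Qed.

(** * Uniqueness: a solution starting from zero vanishes *)

Section Uniqueness.
Variables (v : R -> X -> R).
Hypotheses (v0 : forall x, v 0 x = 0)
  (bv : forall t, 0 <= t -> bounded_continuous (v t))
  (dv : forall t e, 0 <= t -> 0 < e -> exists2 dl, 0 < dl & forall s, 0 <= s -> s != t ->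
     `|s - t| < dl -> forall x, `|(s - t)^-1 * (v s x - v t x) - generator (v t) x| < e).

Let v_bounded t : 0 <= t -> exists2 M, 0 <= M & forall x, `|v t x| <= M.
Proof.
by move=> t0; have [_ [M hM]] := bv t0; exists M => //; exact: bound_ge0 hM.
Qed.

Let v_continuous t e : 0 <= t -> 0 < e -> exists2 dl, 0 < dl & forall s, 0 <= s ->
  `|s - t| < dl -> forall x, `|v s x - v t x| <= e.
Proof.
move=> t0 e0; have [M M0 hM] := v_bounded t0.
have [dl dl0 hd] := dv t0 ltr01.
have K0 : 0 < 1 + 2 * lam * M by rewrite ltr_wpDr// mulr_ge0// mulr_ge0// ltW.
exists (Num.min dl (e / (1 + 2 * lam * M))).
  by rewrite lt_min dl0 divr_gt0.
move=> s s0; rewrite lt_min => /andP[sdl se] x.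
have [->|st] := eqVneq s t; first by rewrite subrr normr0 ltW.
have st0 : s - t != 0 by rewrite subr_eq0.
have gb := generator_bound (bcm (bv t0)) hM x.
have h := hd s s0 st sdl x.
rewrite -[v s x - v t x](mulVKf st0) normrM.
rewrite ltr_pdivlMr// in se.
apply: (le_trans _ (ltW se)); rewrite ler_wpM2l//.
rewrite -[X in `|X|](subrK (generator (v t) x)).
by apply: (le_trans (ler_normD _ _)); rewrite lerD// ltW.
Qed.

Let supn t := sup [set `|v t x| | x in setT].

Let supn_ub t x : 0 <= t -> `|v t x| <= supn t.
Proof.
move=> t0; have [M M0 hM] := v_bounded t0; apply: ub_le_sup; last by exists x.
by exists M => _ [y _ <-].
Qed.

Let supn_le t M : (forall x, `|v t x| <= M) -> supn t <= M.
Proof.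
by move=> hM; apply: ge_sup; [exists `|v t point|; exists point|move=> _ [y _ <-]].
Qed.

Let max_dist (s t : R) : `|Num.max s 0 - Num.max t 0| <= `|s - t|.
Proof.
have [s0|s0] := leP 0 s; have [t0|t0] := leP 0 t => //.
- by rewrite subr0 !ger0_norm ?subr_ge0//; lra.
- by rewrite sub0r normrN (ger0_norm t0) ltr0_norm; lra.
- by rewrite subrr normr0.
Qed.

Let max0_ge0 (t : R) : 0 <= Num.max t 0. Proof. by rewrite le_max lexx orbT. Qed.

(** The sup norm of [v] is continuous in time, so it has a maximum on [[0, T]]. Time is clamped at 0
    to obtain a function continuous on the whole line, as [v] is controlled only at non-negative
    times. *)
Let bounded_on T : 0 <= T -> exists2 B, 0 <= B & forall s, 0 <= s <= T -> forall x, `|v s x| <= B.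
Proof.
move=> T0; pose f t := supn (Num.max t 0).
have cf : continuous f.
  move=> t; apply/cvgrPdist_le => e e0; apply/nbhs_ballP.
  have [dl dl0 hd] := v_continuous (max0_ge0 t) e0; exists dl => // s.
  rewrite /ball /= distrC => sdl.
  have h := hd _ (max0_ge0 s) (le_lt_trans (max_dist s t) sdl).
  rewrite ler_distlC; apply/andP; split.
    rewrite lerBlDr; apply: supn_le => x; rewrite -(subrK (v (Num.max s 0) x) (v _ x)).
    by rewrite (le_trans (ler_normD _ _))// addrC lerD ?supn_ub// distrC.
  apply: supn_le => x; rewrite -(subrK (v (Num.max t 0) x) (v _ x)).
  by rewrite (le_trans (ler_normD _ _))// addrC lerD ?supn_ub.
have [c _ hc] := EVT_max T0 (continuous_subspaceT cf).
exists `|f c| => // s /andP[s0 sT] x; rewrite (le_trans (supn_ub x s0))//.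
have := hc s; rewrite in_itv /= s0 => /(_ sT); rewrite {1}/f (max_idPl s0) => h.
exact: le_trans h (ler_norm _).
Qed.

(* On an interval of length [tau] with [2 lam tau <= 1/2] a bound for [v] can be halved. *)
Let vanish_step a tau : 0 <= a -> 0 < tau -> 2 * lam * tau <= 2^-1 ->
  (forall x, v a x = 0) -> forall s, a <= s <= a + tau -> forall x, v s x = 0.
Proof.
move=> a0 tau0 tl va.
have [B B0 hB] := bounded_on (addr_ge0 a0 (ltW tau0)).
have half C : 0 <= C -> (forall s, a <= s <= a + tau -> forall x, `|v s x| <= C) ->
    forall s, a <= s <= a + tau -> forall x, `|v s x| <= C / 2.
  move=> C0 hC s /andP[as_ sat] x.
  have nn u : a <= u -> 0 <= u by exact: le_trans.
  have dvx u : u \in `]a, s[ ->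
      is_derive u 1 (fun t => v (Num.max t 0) x) (generator (v u) x).
    rewrite in_itv /= => /andP[au us]; apply: is_derive_ball => e e0.
    have u0 : 0 < u by exact: le_lt_trans a0 au.
    have [dl dl0 hd] := dv (ltW u0) e0.
    exists (Num.min dl u); first by rewrite lt_min dl0.
    move=> r ru; rewrite lt_min => /andP[rdl rru].
    have r0 : 0 <= r by move: rru; rewrite ltr_norml => /andP[]; lra.
    by rewrite !(max_idPl _) ?(ltW u0)//; exact: hd.
  have cvx : continuous (fun t : R => v (Num.max t 0) x).
    move=> t; apply/cvgrPdist_le => e e0; apply/nbhs_ballP.
    have [dl dl0 hd] := v_continuous (max0_ge0 t) e0; exists dl => // r.
    rewrite /ball /= distrC => sdl; rewrite distrC; apply: hd => //.
    exact: le_lt_trans (max_dist r t) sdl.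
  (* At fixed [x], [v s x] is [s - a] times the generator at an intermediate time, which is at most
     [2 lam C]; the condition on [tau] turns this into [C / 2]. *)
  have [c] := MVT_segment as_ dvx (continuous_subspaceT cvx).
  rewrite (max_idPl a0) (max_idPl (nn _ as_)) in_itv /= va subr0 => /andP[ac cs] ->.
  have cI : a <= c <= a + tau by rewrite ac (le_trans cs).
  have gb := generator_bound (bcm (bv (nn _ ac))) (hC c cI) x.
  rewrite normrM (ger0_norm (_ : 0 <= s - a)) ?subr_ge0//.
  apply: (@le_trans _ _ (2 * lam * C * tau)).
    by apply: ler_pM => //; rewrite ?subr_ge0// lerBlDl.
  rewrite mulrAC mulrC; exact: ler_wpM2l.
have iter n : forall s, a <= s <= a + tau -> forall x, `|v s x| <= B / 2 ^+ n.
  elim: n => [|n IH].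
    by move=> s /andP[as_ sat] x; rewrite expr0 divr1; apply: hB; rewrite sat (le_trans a0).
  rewrite exprSr invfM mulrA; apply: half => //.
  by rewrite divr_ge0// exprn_ge0.
move=> s sI x; apply/eqP; rewrite -normr_le0; apply/ler_addgt0Pr => e e0; rewrite add0r.
pose n := (Num.truncn (B / e)).+1.
have nE : B / e < n%:R by exact: Num.Theory.truncnS_gt.
apply: (le_trans (iter n s sI x)); rewrite ler_pdivrMr ?exprn_gt0//.
rewrite ltr_pdivrMr// in nE; rewrite mulrC; apply: (le_trans (ltW nE)).
by rewrite ler_wpM2r ?ltW// -natrX ltr_nat ltn_expl.
Qed.

Lemma generator_unique t x : 0 <= t -> v t x = 0.
Proof.
(* The longest step that [vanish_step] admits: [2 lam tau] is exactly one half. *)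
move=> t0; pose tau := (4 * lam)^-1.
have tau0 : 0 < tau by rewrite invr_gt0 mulr_gt0.
have tl : 2 * lam * tau <= 2^-1.
  by rewrite /tau le_eqVlt; apply/orP; left; apply/eqP; field; rewrite gt_eqF.
have H n : forall s, 0 <= s <= tau *+ n -> forall y, v s y = 0.
  elim: n => [|n IH] s.
    by rewrite mulr0n => /andP[s0 s1] y; rewrite (_ : s = 0)//; apply/eqP; rewrite eq_le s1.
  have n0 : 0 <= tau *+ n by rewrite mulrn_wge0// ltW.
  move=> /andP[s0 sn]; have [sn'|ns] := leP s (tau *+ n); first by apply: IH; rewrite s0.
  apply: (vanish_step n0 tau0 tl); last by rewrite (ltW ns) -mulrSr.
  by move=> y; apply: IH; rewrite n0 lexx.
pose n := (Num.truncn (t / tau)).+1.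
have nE : t / tau < n%:R by exact: Num.Theory.truncnS_gt.
apply: (H n); rewrite t0 -mulr_natl.
by rewrite ltr_pdivrMr// in nE; rewrite ltW.
Qed.

End Uniqueness.

Lemma cauchy_unique (h0 : X -> R) (h h' : R -> X -> R) :
  cauchy_solution generator h0 h -> cauchy_solution generator h0 h' ->
  forall t x, 0 <= t -> h' t x = h t x.
Proof.
move=> [bh hh0 dh _] [bh' hh0' dh' _] t x t0.
apply/eqP; rewrite -subr_eq0; apply/eqP.
apply: (generator_unique (v := fun t x => h' t x - h t x)) => //.
- by move=> y; rewrite hh0 hh0' subrr.
- move=> s s0; have [c [M hM]] := bh s s0; have [c' [M' hM']] := bh' s s0.
  split; first by move=> y; apply: cvgB; [exact: c'|exact: c].
  by exists (M' + M) => y; apply: (le_trans (ler_normB _ _)); rewrite lerD.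
- move=> s e s0 e0.
  have [c [M hM]] := bh s s0; have [c' [M' hM']] := bh' s s0.
  have e2 : 0 < e / 2 by rewrite divr_gt0.
  have /uniform_cvgP/(_ _ e2) := dh s s0.
  have /uniform_cvgP/(_ _ e2) := dh' s s0.
  rewrite /within /dnbhs /= => /nbhs_ballP[d' /= d'0 hd'] /nbhs_ballP[dd /= dd0 hd].
  exists (Num.min d' dd); first by rewrite lt_min d'0.
  move=> r r0 rs; rewrite lt_min => /andP[rd' rd] y.
  have := hd' r; have := hd r; rewrite /ball /= [`|s - r|]distrC.
  move=> /(_ rd rs r0 y) h1 /(_ rd' rs r0 y) h2.
  rewrite (_ : generator _ y = generator (h' s) y - generator (h s) y); last first.
    rewrite /generator (RintegralB _ (bounded_Rintegrable (Q1 y) (bcm (conj c' (ex_intro _ M' hM'))) hM')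
      (bounded_Rintegrable (Q1 y) (bcm (conj c (ex_intro _ M hM))) hM))//.
    by ring.
  rewrite (_ : _ - _ = ((r - s)^-1 * (h' r y - h' s y) - generator (h' s) y) -
     ((r - s)^-1 * (h r y - h s y) - generator (h s) y)); last by ring.
  by apply: (le_lt_trans (ler_normB _ _)); rewrite [e]splitr ltrD.
Qed.

End BoundedGenerator.

Section ProbabilityOfMeasure.
Context d (T : measurableType d) (R : realType).
Variables (m : {measure set T -> \bar R}) (m1 : m setT = 1%E).

Definition probability_of & m setT = 1%E : set T -> \bar R := m.

HB.instance Definition _ := Measure.copy (probability_of m1) m.
HB.instance Definition _ :=
  Measure_isProbability.Build _ _ _ (probability_of m1) m1.

End ProbabilityOfMeasure.

(** A solution evaluates the operator only on its own time slices, which are bounded continuous at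
    non-negative times; in the last clause the times close to [t > 0] are eventually non-negative.
    It lets the Laplacian be replaced by the generator, which agrees with it on such functions. *)
Lemma cauchy_solution_eq (R : realType) (X : ptopologicalType)
    (L1 L2 : (X -> R) -> X -> R) (h0 : X -> R) (h : R -> X -> R) :
  (forall psi, bounded_continuous psi -> L1 psi = L2 psi) ->
  cauchy_solution L1 h0 h -> cauchy_solution L2 h0 h.
Proof.
move=> E [bh hh0 dh ch]; split => // t t0.
  by have := dh _ t0; rewrite (E _ (bh _ t0)).
have := ch _ t0; rewrite (E _ (bh _ (ltW t0))) => /uniform_cvgP c.
apply/uniform_cvgP => e e0; have {}c := c _ e0; near=> s.
have cs : forall x, `|L1 (h s) x - L2 (h t) x| < e by near: s.
have s0 : 0 <= s by rewrite ltW//; near: s; exact: lt_nbhsr.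
by move=> x; rewrite -(E _ (bh _ s0)).
Unshelve. all: by end_near. Qed.

(** * The regular version of the process, and the theorem for a bounded generator *)

Section JumpProcessTheorem.
Context (R : realType) (X : ptopologicalType).
Variables (Q : R.-pker (borel X) ~> (borel X)) (lam : R).
Hypothesis lam0 : 0 < lam.
Hypothesis generator_continuous : forall psi : X -> R,
  bounded_continuous psi -> continuous (generator Q lam psi).
Hypothesis measurable_set1 : forall x : X, measurable ([set x] : set (borel X)).
Variable L : (X -> R) -> X -> R.
Hypothesis LE : forall psi, bounded_continuous psi -> L psi = generator Q lam psi.

Variable eta : probability (measurableTypeR R) R.
Hypothesis etaE : forall s, 0 <= s ->
  eta [set r | s < r] = (expR (- (lam * s)))%:E.

Local Notation W := (histories R (borel X)).

(* Exploding histories form a null set, but the regularity of the paths is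
   required of every history. *)
Definition regular_process (s : R) (o : W) : X :=
  if `[< exploded o >] then point else process s o.

Let measurable_regular s : measurable_fun setT (regular_process s : W -> borel X).
Proof.
move=> _ A mA; rewrite setTI.
rewrite (_ : _ @^-1` A = (@exploded R _ (borel X) `&` [set o | A point]) `|`
    (~` (@exploded R _ (borel X)) `&` process s @^-1` A)).
  apply: measurableU; apply: measurableI.
  - exact: measurable_exploded.
  - have [Ap|nAp] := pselect (A point).
      by rewrite (_ : [set o | _] = setT)//; apply/seteqP; split.
    by rewrite (_ : [set o | _] = set0)//; apply/seteqP; split.
  - by apply: measurableC; exact: measurable_exploded.
  - by rewrite -[X in measurable X]setTI; exact: measurable_process.
apply/seteqP; split => o; rewrite /regular_process /=.
  by case: asboolP => eo Ao; [left|right].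
by case: asboolP => eo [[]|[]].
Qed.

(** On a history that does not explode, the jump count [n s] is finite and monotone in [s]. It is
    constant just after any time, and constant just before [t] at the largest value it takes
    there. *)
Lemma regular_process_paths : right_continuous_with_jumps regular_process.
Proof.
move=> o; rewrite /regular_process; case: asboolP => eo.
  by split => t t0; [exact: cvg_cst|exists point; exact: cvg_cst].
have ex s : exists n, at_jump n s o by exact: not_exploded eo.
pose n s := ex_minn (ex s).
have nP s : at_jump (n s) s o by rewrite /n; case: ex_minnP.
have pE s m : at_jump m s o -> process s o = state m o by exact: process_at.
have n_mono s t : s <= t -> (n s <= n t)%N.
  move=> st; have [m mn am] := at_jumpW st (nP t).
  by rewrite (at_jump_inj (nP s) am).
have right_const m s : at_jump m s o ->
    exists2 dl, 0 < dl & forall u, s <= u -> u < s + dl -> at_jump m u o.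
  elim: m s (o) => [|m IH] s o' /=.
    move=> sh; exists (hold o' - s); first by rewrite subr_gt0.
    by move=> u _; rewrite addrC subrK.
  move=> /andP[hs am]; have [dl dl0 hd] := IH _ _ am; exists dl => // u su us.
  rewrite (le_trans hs su) /=; apply: hd; first exact: lerB.
  by rewrite ltrBlDr addrAC subrK.
split => t t0.
  have [dl dl0 hd] := right_const _ _ (nP t).
  rewrite (pE _ _ (nP t)); apply: cvg_near_cst.
  near=> s; have ts : t <= s by near: s; exact: nbhs_right_ge.
  have sd : s < t + dl by near: s; apply: nbhs_right_lt; rewrite ltrDl.
  by rewrite (pE _ _ (hd _ ts sd)).
pose P k := `[< exists s, s < t /\ n s = k >].
have exP : exists k, P k.
  by exists (n (t - 1)); apply/asboolP; exists (t - 1); split => //; rewrite gtrBl.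
have ubP k : P k -> (k <= n t)%N.
  by move=> /asboolP[s [st <-]]; exact/n_mono/ltW.
have [k /asboolP[s [st nsk]] kmax] := ex_maxnP exP ubP.
exists (state k o); apply: cvg_near_cst; near=> u; apply/esym.
have su : s <= u by rewrite ltW//; near: u; exact: nbhs_left_gt.
have ut : u < t by near: u; exact: nbhs_left_lt.
rewrite (pE _ _ (nP u)); congr (state _ o); apply/eqP; rewrite eqn_leq.
apply/andP; split; first by rewrite -nsk; exact: n_mono.
by apply: kmax; apply/asboolP; exists u.
Unshelve. all: by end_near. Qed.

Let null x (B : set W) : measurable B ->
  law Q eta x (B `&` @exploded R _ (borel X)) = 0%E.
Proof.
have me := @measurable_exploded R _ (borel X).
move=> mB; apply/eqP; rewrite -measure_le0 -(law_exploded Q lam0 etaE x).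
apply: le_measure; last exact: subIsetr.
  by rewrite inE; exact: measurableI.
by rewrite inE.
Qed.

Let law_ae x (B C : set W) : measurable B -> measurable C ->
  (forall o, ~ exploded o -> B o <-> C o) -> law Q eta x B = law Q eta x C.
Proof.
have me := @measurable_exploded R _ (borel X).
move=> mB mC BC.
have D (E : set W) : measurable E ->
    law Q eta x E = law Q eta x (E `\` @exploded R _ (borel X)).
  move=> mE; rewrite [LHS](measureDI _ mE me).
  by rewrite [X in (_ + X)%E](null x mE) adde0.
rewrite (D B)// (D C)//; congr (law _ _ _ _).
by apply/seteqP; split => o [] /= Bo eo; split => //; apply/BC.
Qed.

Let Px (x : X) : probability W R := probability_of (lawT Q eta x).
Let P (t : R) (x : X) : probability (borel X) R :=
  probability_of (transitionT Q eta t x).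

(** The expansion at [t = 0] has error zero; it is applied to the indicator of [B]. *)
Let P0 x (B : set (borel X)) : measurable B -> P 0 x B = \d_(x : borel X) B.
Proof.
move=> mB; have mi : measurable_fun setT (\1_B : borel X -> R) by exact: measurable_indic.
have bi y : `|\1_B y : R| <= 1 by rewrite indicE; case: (_ \in _); rewrite ?normr1 ?normr0.
have := semigroup0 Q lam0 etaE mi bi x.
rewrite /semigroup /Rintegral integral_indic// setIT => h.
rewrite diracE.
have -> : (x \in B)%:R = \1_B x :> R by rewrite indicE.
rewrite -h; transitivity (transition Q eta 0 x B); first by [].
rewrite fineK// ge0_fin_numE//; apply: le_lt_trans (ltry 1).
by rewrite -(transitionT Q eta 0 x); apply: le_measure; rewrite ?inE.
Qed.

(** Passing to the regular version alters the past only inside the null set of explosions, which is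
    how the Markov property carries over. *)
Let past_regular s B : past regular_process s B ->
  exists2 B', past_events s B' & forall o, ~ exploded o -> B o <-> B' o.
Proof.
move: B; apply: smallest_sub.
  split.
  - by exists set0 => //; apply: sigma_algebra0; exact: smallest_sigma_algebra.
  - move=> A [B pB AB]; exists (~` B).
      by rewrite -setTD; apply: sigma_algebraCD => //; exact: smallest_sigma_algebra.
    by move=> o eo; rewrite setTD; split=> nA Ao; apply: nA; apply/(AB _ eo).
  - move=> A hA; have {}hA n : exists B, past_events s B /\
        forall o, ~ exploded o -> A n o <-> B o by have [B ? ?] := hA n; exists B.
    have [B hB] := choice hA; exists (\bigcup_n B n).
      by apply: sigma_algebra_bigcup => n; exact: (hB n).1.
    by move=> o eo; split=> -[n _ /(hB n).2 ?]; exists n => //; auto.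
move=> B [u us] [A mA <-]; exists (process u @^-1` A).
  by apply: sub_sigma_algebra; exists u => //; exists A => //; rewrite setTI.
by move=> o eo; rewrite setTI /= /regular_process; case: asboolP.
Qed.

Let markov : markov_process P Px regular_process.
Proof.
have mp s (A : set (borel X)) : measurable A -> measurable ((process s : W -> borel X) @^-1` A).
  by move=> mA; rewrite -[X in measurable X]setTI; exact: measurable_process.
have mr s (A : set (borel X)) : measurable A -> measurable (regular_process s @^-1` A).
  by move=> mA; rewrite -[X in measurable X]setTI; exact: measurable_regular.
have PxE t x (A : set (borel X)) : 0 <= t -> measurable A ->
    Px x (regular_process t @^-1` A) = P t x A.
  move=> t0 mA; transitivity (law Q eta x (process t @^-1` A)).
    apply: law_ae; [exact: mr|exact: mp|] => o eo /=.
    by rewrite /regular_process; case: asboolP.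
  by [].
split => //.
- by move=> x; rewrite PxE// P0// diracE mem_set.
- move=> s t x A B s0 t0 mA pB; have [B' pB' BB'] := past_regular pB.
  have mB' := past_events_measurable pB'.
  have mB : measurable B.
    move: pB; apply: smallest_sub; first exact: sigma_algebra_measurable.
    by move=> _ [u us] [E mE <-]; rewrite setTI; exact: mr.
  transitivity (law Q eta x (B' `&` process (s + t) @^-1` A)).
    apply: law_ae.
    - by apply: measurableI => //; exact: mr.
    - by apply: measurableI => //; exact: mp.
    - move=> o eo; rewrite /= /regular_process; case: asboolP => // _.
      by split=> -[? ?]; split => //; apply/BB'.
  rewrite (markov_property Q lam0 etaE x s0 t0 mA pB').
  have mtr : measurable_fun setT (fun y : borel X => transition Q eta t y A).
    exact: measurable_transition.
  have mtp : measurable_fun setT (fun o : W => transition Q eta t (process s o) A).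
    by apply: (measurableT_comp mtr); exact: measurable_process.
  have mtR : measurable_fun setT
      (fun o : W => transition Q eta t (regular_process s o) A).
    by apply: (measurableT_comp mtr); exact: measurable_regular.
  transitivity (\int[law Q eta x]_(o in B)
      transition Q eta t (regular_process s o) A)%E; last by [].
  rewrite [LHS]integral_mkcond [RHS]integral_mkcond.
  apply: ge0_ae_eq_integral => //.
  - by apply/(measurable_restrictT _ mB'); exact: measurable_funTS.
  - by apply/(measurable_restrictT _ mB); exact: measurable_funTS.
  - by move=> o _; apply: erestrict_ge0.
  - by move=> o _; apply: erestrict_ge0.
  exists (@exploded R _ (borel X)); split.
  - exact: measurable_exploded.
  - exact: (law_exploded Q lam0 etaE x).
  move=> o /= no; apply: contrapT => eo; apply: no => _.
  rewrite !patchE /regular_process; case: asboolP => // _.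
  by congr (if _ then _ else _); apply/idP/idP; rewrite !inE => ?; apply/BB'.
Qed.

Lemma regular_process_theorem : exists P : R -> X -> probability (borel X) R,
  (forall h0 : X -> R, bounded_continuous h0 ->
     let h := fun (t : R) (x : X) => \int[P t x]_y h0 y in
     cauchy_solution L h0 h /\
     forall h' : R -> X -> R, cauchy_solution L h0 h' ->
       forall t x, 0 <= t -> h' t x = h t x) /\
  transition_function P /\
  exists (d : measure_display) (W : measurableType d)
      (Px : X -> probability W R) (Y : R -> W -> X),
    markov_process P Px Y /\ right_continuous_with_jumps Y.
Proof.
exists P; split; [|split].
- move=> h0 bh h.
  have solL : cauchy_solution L h0 h.
    apply: (@cauchy_solution_eq _ _ (generator Q lam)).
      by move=> psi bpsi; rewrite LE.
    exact: (semigroup_solution lam0 etaE generator_continuous bh).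
  have solG h' : cauchy_solution L h0 h' -> cauchy_solution (generator Q lam) h0 h'.
    by apply: cauchy_solution_eq => psi bpsi; rewrite LE.
  split => // h' /solG sh' t x t0; exact: (cauchy_unique lam0 (solG _ solL) sh').
- split.
  + by move=> t B t0 mB; exact: measurable_transition.
  + by move=> x B mB; exact: P0.
  + by move=> s t x B s0 t0 mB; exact: (chapman_kolmogorov Q lam0 etaE x s0 t0 mB).
- exists _, W, Px, regular_process; split; first exact: markov.
  exact: regular_process_paths.
Qed.
End JumpProcessTheorem.

Lemma jump_process_exists (R : realType) (X : ptopologicalType)
    (Q : R.-pker (borel X) ~> (borel X)) (lam : R) (L : (X -> R) -> X -> R) :
  0 < lam ->
  (forall psi : X -> R, bounded_continuous psi ->
     continuous (generator Q lam psi)) ->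
  (forall x : X, measurable ([set x] : set (borel X))) ->
  (forall psi, bounded_continuous psi -> L psi = generator Q lam psi) ->
  exists P : R -> X -> probability (borel X) R,
    (forall h0 : X -> R, bounded_continuous h0 ->
       let h := fun (t : R) (x : X) => \int[P t x]_y h0 y in
       cauchy_solution L h0 h /\
       forall h' : R -> X -> R, cauchy_solution L h0 h' ->
         forall t x, 0 <= t -> h' t x = h t x) /\
    transition_function P /\
    exists (d : measure_display) (W : measurableType d)
        (Px : X -> probability W R) (Y : R -> W -> X),
      markov_process P Px Y /\ right_continuous_with_jumps Y.
Proof.
move=> lam0 gc ms LE; have [eta etaE] := holding_time_exists lam0.
exact: (regular_process_theorem lam0 gc ms LE etaE).
Qed.

(** * Moebius transformations and discs *)

Section Ultrametric.
Context (R : realType) (F : nafield R).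
Implicit Types x y : line F.

Lemma absv_ge0 x : 0 <= absv x. Proof. exact: na_abs_ge0. Qed.

Lemma absv0 : absv (0 : line F) = 0. Proof. exact: na_abs0. Qed.

Lemma absv1 : absv (1 : line F) = 1. Proof. exact: na_abs1. Qed.

Lemma absvM x y : absv (x * y) = absv x * absv y. Proof. exact: na_absM. Qed.

Lemma absvD x y : absv (x + y) <= Num.max (absv x) (absv y).
Proof. exact: na_absD. Qed.

Lemma absv_eq0 x : (absv x == 0) = (x == 0).
Proof.
by apply/eqP/eqP => [/na_abs_eq0//|->]; exact: absv0.
Qed.

Lemma absv_gt0 x : (0 < absv x) = (x != 0).
Proof. by rewrite lt_def absv_eq0 absv_ge0 andbT. Qed.

Lemma absvN x : absv (- x) = absv x.
Proof.
have N1 : absv (-1 : line F) = 1.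
  apply/eqP; rewrite -(@pexpr_eq1 _ _ 2) ?absv_ge0//.
  by rewrite expr2 -absvM mulrNN mulr1 absv1.
by rewrite -mulN1r absvM N1 mul1r.
Qed.

Lemma absvBC x y : absv (x - y) = absv (y - x).
Proof. by rewrite -opprB absvN. Qed.

Lemma absvD_lt x y (e : R) : absv x < e -> absv y < e -> absv (x + y) < e.
Proof. by move=> xe ye; rewrite (le_lt_trans (absvD x y))// gt_max xe. Qed.

Lemma absvD_le x y (e : R) : absv x <= e -> absv y <= e -> absv (x + y) <= e.
Proof. by move=> xe ye; rewrite (le_trans (absvD x y))// ge_max xe. Qed.

Lemma absvB_lt x y (e : R) : absv x < e -> absv y < e -> absv (x - y) < e.
Proof. by move=> xe ye; apply: absvD_lt => //; rewrite absvN. Qed.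

Lemma absvB_le x y (e : R) : absv x <= e -> absv y <= e -> absv (x - y) <= e.
Proof. by move=> xe ye; apply: absvD_le => //; rewrite absvN. Qed.

Lemma absvD_eqr x y : absv x < absv y -> absv (x + y) = absv y.
Proof.
move=> xy; apply/eqP; rewrite eq_le absvD_le ?(ltW xy)//=.
rewrite leNgt; apply/negP => xyy.
by have := absvB_lt xyy xy; rewrite addrAC subrr add0r ltxx.
Qed.

Lemma absvV x : absv x^-1 = (absv x)^-1.
Proof.
have [->|x0] := eqVneq x 0; first by rewrite invr0 absv0 invr0.
by apply: (mulIf (x := absv x)); rewrite ?absv_eq0// -absvM !mulVf ?absv1 ?absv_eq0.
Qed.

Lemma absv_dist x y z (e : R) :
  absv (x - y) < e -> absv (y - z) < e -> absv (x - z) < e.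
Proof. by move=> xy yz; rewrite -(subrKA y); exact: absvD_lt. Qed.

Lemma absv_sum_le (I : Type) (r : seq I) (P : pred I) (h : I -> line F) (e : R) :
  0 <= e -> (forall i, P i -> absv (h i) <= e) ->
  absv (\sum_(i <- r | P i) h i) <= e.
Proof.
move=> e0 he; elim/big_ind : _ => //; first by rewrite absv0.
by move=> a b; exact: absvD_le.
Qed.

Lemma absv_lt_congr x y (e : R) :
  absv (x - y) < e -> (absv x < e) = (absv y < e).
Proof.
move=> xy; apply/idP/idP => h; last by rewrite -(subrK y x); exact: absvD_lt.
by rewrite -(subKr x y); exact: absvB_lt.
Qed.

Lemma absv_le_congr x y (e : R) :
  absv (x - y) <= e -> (absv x <= e) = (absv y <= e).
Proof.
move=> xy; apply/idP/idP => h; last by rewrite -(subrK y x); exact: absvD_le.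
by rewrite -(subKr x y); exact: absvB_le.
Qed.

End Ultrametric.

Lemma finite_lower_bound (R : realType) (T : finType) (h : T -> R) :
  (forall t, 0 < h t) -> exists2 r, 0 < r & forall t, r <= h t.
Proof.
move=> h0; exists (\big[Num.min/1]_t h t).
  by elim/big_ind : _ => // a b a0 b0; rewrite lt_min a0.
by move=> t; rewrite (bigD1 t)//= ge_min lexx.
Qed.

Lemma finite_upper_bound (R : realType) (T : finType) (h : T -> R) :
  exists r, forall t, h t <= r.
Proof.
exists (\big[Num.max/0]_t h t) => t.
by rewrite (bigD1 t)//= le_max lexx.
Qed.

(** * Moebius maps in homogeneous coordinates *)

Section Homogeneous.
Context (R : realType) (F : nafield R).
Implicit Types (A B : 'M[line F]_2) (z : P1 F).

(** With [hy], homogeneous coordinates in which infinity is [[1 : 0]]; matrices then act linearly up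
    to a nonzero factor, without case splits at infinity or at poles. *)
Definition hx z : line F := if z is Some x then x else 1.
Definition hy z : line F := if z is Some _ then 1 else 0.

Lemma mulmx2E A B i j : (A *m B) i j = A i 0 * B 0 j + A i 1 * B 1 j.
Proof.
rewrite mxE !big_ord_recl big_ord0 addr0.
by rewrite (_ : lift ord0 ord0 = 1)//; exact: val_inj.
Qed.

Lemma unitmx2 A : (A \in unitmx) = (A 0 0 * A 1 1 - A 0 1 * A 1 0 != 0).
Proof. rewrite unitmxE unitfE (expand_det_row _ 0) !big_ord_recl big_ord0 addr0.
rewrite /cofactor !det_mx11 !mxE /= expr0 expr1 mul1r.
have e1 (i : 'I_1) : lift (0 : 'I_2) i = 1 by apply: val_inj; rewrite (ord1 i).
have e0 (i : 'I_1) : lift (1 : 'I_2) i = 0 by apply: val_inj; rewrite (ord1 i).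
by rewrite !e1 e0 mulN1r mulrN.
Qed.

Lemma hom_mobius A z : A \in unitmx -> exists2 c : line F, c != 0 &
  A 0 0 * hx z + A 0 1 * hy z = c * hx (mobius A z) /\
  A 1 0 * hx z + A 1 1 * hy z = c * hy (mobius A z).
Proof.
rewrite unitmx2 => dA; case: z => [z|] /=; rewrite ?mulr1 ?mulr0 ?addr0; last first.
  have [c0|c0] := eqVneq (A 1 0) 0.
    exists (A 0 0); last by rewrite c0 mulr1 mulr0.
    by apply: contra_neq dA => ->; rewrite c0 mul0r mulr0 subr0.
  by exists (A 1 0) => //=; rewrite mulr1 mulrC divfK.
have [c0|c0] := eqVneq (A 1 0 * z + A 1 1) 0; last first.
  exists (A 1 0 * z + A 1 1) => //=.
  by split; [rewrite [RHS]mulrC divfK|rewrite mulr1].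
exists (A 0 0 * z + A 0 1); last by rewrite c0 /= mulr1 mulr0.
apply: contra_neq dA => b0.
have -> : A 1 1 = - (A 1 0 * z) by apply/eqP; rewrite -addr_eq0 addrC c0.
have -> : A 0 1 = - (A 0 0 * z) by apply/eqP; rewrite -addr_eq0 addrC b0.
by ring.
Qed.

Lemma hom_inj (c : line F) z z' :
  c != 0 -> hx z = c * hx z' -> hy z = c * hy z' -> z = z'.
Proof.
move=> c0; case: z z' => [z|] [z'|] //=; rewrite ?mulr1 ?mulr0.
- by move=> -> <-; rewrite mul1r.
- by move=> _ /eqP; rewrite oner_eq0.
- by move=> _ /esym /eqP; rewrite (negbTE c0).
Qed.

Lemma mobiusM A B z : A \in unitmx -> B \in unitmx ->
  mobius (A *m B) z = mobius A (mobius B z).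
Proof.
move=> uA uB.
have uAB : A *m B \in unitmx by rewrite unitmx_mul uA.
have [c c0 [cx cy]] := hom_mobius z uAB.
have [b b0 [bx by_]] := hom_mobius z uB.
have [a a0 [ax ay]] := hom_mobius (mobius B z) uA.
apply: (@hom_inj (b * a / c)); first by rewrite !mulf_neq0 ?invr_eq0.
  apply: (mulfI c0); rewrite -cx.
  transitivity (b * (a * hx (mobius A (mobius B z)))); last by field.
  by rewrite -ax mulrDr mulrCA -bx [b * (A 0 1 * _)]mulrCA -by_ !mulmx2E; ring.
apply: (mulfI c0); rewrite -cy.
transitivity (b * (a * hy (mobius A (mobius B z)))); last by field.
by rewrite -ay mulrDr mulrCA -bx [b * (A 1 1 * _)]mulrCA -by_ !mulmx2E; ring.
Qed.

Lemma mobius_scale (c : line F) A z : c != 0 -> mobius (c *: A) z = mobius A z.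
Proof.
move=> c0; case: z => [z|]; rewrite /mobius !mxE.
  rewrite -!mulrA -!mulrDr mulf_eq0 (negbTE c0) /=; case: ifP => // /negbT n0.
  by congr Some; rewrite invfM mulrACA divff// mul1r.
rewrite mulf_eq0 (negbTE c0) /=; case: ifP => // /negbT n0.
by congr Some; rewrite invfM mulrACA divff// mul1r.
Qed.

Lemma mobius1 z : mobius 1%:M z = z.
Proof.
case: z => [z|]; rewrite /mobius !mxE /=; last by rewrite eqxx.
by rewrite mul0r add0r oner_eq0 mul1r addr0 divr1.
Qed.

Lemma mobiusK A z : A \in unitmx -> mobius (invmx A) (mobius A z) = z.
Proof. by move=> uA; rewrite -mobiusM ?unitmx_inv// mulVmx// mobius1. Qed.

Lemma mobiusVK A z : A \in unitmx -> mobius A (mobius (invmx A) z) = z.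
Proof. by move=> uA; rewrite -mobiusM ?unitmx_inv// mulmxV// mobius1. Qed.

End Homogeneous.

(** * Discs and their preimages under Moebius maps *)

Section Discs.
Context (R : realType) (K C : nafield R).
Context (iota : {rmorphism line K -> line C}).
Hypothesis isoI : forall x : line K, absv (iota x) = absv x.
Implicit Types (A M : 'M[line K]_2) (z : P1 C) (d : disc K).

Local Notation mobiusC := (mobiusC iota).
Local Notation open_disc := (open_disc iota).
Local Notation closed_disc := (closed_disc iota).
Local Notation P1_inj := (P1_inj iota).

Lemma mobiusC_unit A : A \in unitmx -> map_mx iota A \in unitmx.
Proof. by rewrite map_unitmx. Qed.

Lemma mobiusCM A B z : A \in unitmx -> B \in unitmx ->
  mobiusC (A *m B) z = mobiusC A (mobiusC B z).
Proof.
by move=> uA uB; rewrite /Defs.mobiusC map_mxM mobiusM ?mobiusC_unit.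
Qed.

Lemma mobiusC_scale (c : line K) A z :
  c != 0 -> mobiusC (c *: A) z = mobiusC A z.
Proof. by move=> c0; rewrite /Defs.mobiusC map_mxZ mobius_scale// fmorph_eq0. Qed.

Lemma mobiusC1 z : mobiusC 1%:M z = z.
Proof. by rewrite /Defs.mobiusC map_mx1 mobius1. Qed.

Lemma mobiusCK A z : A \in unitmx -> mobiusC (invmx A) (mobiusC A z) = z.
Proof. by move=> uA; rewrite -mobiusCM ?unitmx_inv// mulVmx// mobiusC1. Qed.

Lemma mobiusCVK A z : A \in unitmx -> mobiusC A (mobiusC (invmx A) z) = z.
Proof. by move=> uA; rewrite -mobiusCM ?unitmx_inv// mulmxV// mobiusC1. Qed.

Lemma P1_inj_mobius A (z : P1 K) : P1_inj (mobius A z) = mobiusC A (P1_inj z).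
Proof.
case: z => [z|]; rewrite /Defs.mobiusC /mobius /= !mxE.
  rewrite -!rmorphM -!rmorphD fmorph_eq0; case: ifP => //= _.
  by rewrite fmorph_div.
by rewrite fmorph_eq0; case: ifP => //= _; rewrite fmorph_div.
Qed.

(* Row-reducing M by matrices preserving |x| < |y| brings any such set to the
   form of a disc; this makes images of discs under Moebius maps discs. *)
Definition form_disc M : set (P1 C) := [set z |
  absv (iota (M 0 0) * hx z + iota (M 0 1) * hy z) <
  absv (iota (M 1 0) * hx z + iota (M 1 1) * hy z)].

Lemma form_disc_mobius M A z : A \in unitmx ->
  form_disc M (mobiusC A z) <-> form_disc (M *m A) z.
Proof.
move=> uA; rewrite /form_disc /=.
have [c c0 [cx cy]] := hom_mobius z (mobiusC_unit uA).
rewrite -(ltr_pM2l (x := absv c)) ?absv_gt0// -!absvM !mulrDr !mulrA -![c * iota _]mulrC.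
rewrite -!mulrA -/(mobiusC A z) -cx -cy !mulmx2E !rmorphD !rmorphM !mxE.
set l := absv _; set r := absv _; set l' := absv _; set r' := absv _.
rewrite (_ : l = l'); last by rewrite /l /l'; congr absv; ring.
by rewrite (_ : r = r')//; rewrite /r /r'; congr absv; ring.
Qed.

Lemma open_disc_form d : d_radius d != 0 ->
  exists2 M, M \in unitmx & open_disc d = form_disc M.
Proof.
case: d => i a c /= c0.
(* The rows are the linear forms whose comparison is the homogeneous version of [|c| < |z - a|],
   respectively [|z - a| < |c|]. *)
pose M : 'M[line K]_2 := if i then \matrix_(u, v)
     (if u == 0 then (if v == 0 then 0 else c) else if v == 0 then 1 else - a)
  else \matrix_(u, v)
     (if u == 0 then (if v == 0 then 1 else - a) else if v == 0 then 0 else c).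
exists M.
  rewrite unitmx2 /M; case: (i); rewrite !mxE /=.
    by rewrite mul0r sub0r mulr1 oppr_eq0.
  by rewrite mul1r mulr0 subr0.
apply/seteqP; split => -[z|]; rewrite /form_disc /Defs.open_disc /M /=;
  case: (i); rewrite !mxE /= ?rmorph0 ?rmorph1 ?rmorphN ?mul0r ?mulr0 ?mul1r ?mulr1
  ?addr0 ?add0r ?isoI ?absv0 ?absv1 ?ltr01 ?ltr10 //.
Qed.

(** The row whose coefficient of [hx] is smaller is cleared of [hx] by subtracting a multiple, of
    size at most 1, of the other row; by the ultrametric inequality the comparison is unchanged. The
    case [|a| < |c|] is the one where infinity belongs to the set. *)
Lemma form_disc_open M : M \in unitmx ->
  exists2 d, d_radius d != 0 & form_disc M = open_disc d.
Proof.
rewrite unitmx2; set a := M 0 0; set b := M 0 1; set c := M 1 0; set e := M 1 1.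
move=> dM; have [ac|ca] := ltP (absv a) (absv c).
  have c0 : c != 0 by rewrite -absv_gt0 (le_lt_trans (absv_ge0 a)).
  exists (Disc true (- (e / c)) ((b - a * e / c) / c)).
    rewrite /= mulf_neq0 ?invr_eq0//.
    have -> : b - a * e / c = - (a * e - b * c) / c by field.
    by rewrite mulf_neq0 ?invr_eq0// oppr_eq0.
  apply/seteqP.
  suff E z : form_disc M z <->
      open_disc (Disc true (- (e / c)) ((b - a * e / c) / c)) z.
    by split => z /E.
  rewrite /form_disc /= -/a -/b -/c -/e.
  pose x := iota a * hx z + iota b * hy z; pose y := iota c * hx z + iota e * hy z.
  have lam1 : absv (iota (a / c)) < 1.
    by rewrite isoI absvM absvV ltr_pdivrMr ?absv_gt0// mul1r.
  have key : (absv x < absv y) = (absv (x - iota (a / c) * y) < absv y).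
    have [y0|y0] := eqVneq y 0; first by rewrite y0 mulr0 subr0.
    apply: absv_lt_congr; rewrite subKr absvM gtr_pMl// ?absv_gt0//.
  rewrite -/x -/y key.
  have ic : iota c != 0 by rewrite fmorph_eq0.
  have -> : x - iota (a / c) * y = iota c * (iota ((b - a * e / c) / c) * hy z).
    rewrite /x /y !(rmorphM, rmorphB, fmorphV); field.
    by rewrite ic.
  have -> : y = iota c * (hx z - iota (- (e / c)) * hy z).
    by rewrite /y !(rmorphM, rmorphN, fmorphV); field; rewrite ic.
  rewrite !absvM ltr_pM2l ?absv_gt0//.
  case: z {x y key} => [z|] /=; rewrite ?mulr1 ?mulr0 ?subr0 ?absv1 ?mulr1 ?isoI// absv0 mulr0.
  by split=> // _; exact: ltr01.
have a0 : a != 0.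
  apply: contra_neq dM => a0; move: ca; rewrite a0 absv0 le_eqVlt ltNge absv_ge0 orbF.
  by rewrite absv_eq0 => /eqP ->; rewrite mul0r mulr0 subr0.
have ia : iota a != 0 by rewrite fmorph_eq0.
exists (Disc false (- (b / a)) ((e - c * b / a) / a)).
  rewrite /= mulf_neq0 ?invr_eq0//.
  have -> : e - c * b / a = (a * e - b * c) / a by field.
  by rewrite mulf_neq0 ?invr_eq0.
apply/seteqP.
suff E z : form_disc M z <->
    open_disc (Disc false (- (b / a)) ((e - c * b / a) / a)) z.
  by split => z /E.
rewrite /form_disc /= -/a -/b -/c -/e.
pose x := iota a * hx z + iota b * hy z; pose y := iota c * hx z + iota e * hy z.
have lam1 : absv (iota (c / a)) <= 1.
  by rewrite isoI absvM absvV ler_pdivrMr ?absv_gt0// mul1r.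
have key : (absv x < absv y) = (absv x < absv (y - iota (c / a) * x)).
  have lx : absv (iota (c / a) * x) <= absv x.
    by rewrite absvM ler_piMl ?absv_ge0.
  have lx' : absv (y - (y - iota (c / a) * x)) <= absv x by rewrite subKr.
  by rewrite !ltNge (absv_le_congr lx').
rewrite -/x -/y key.
have -> : y - iota (c / a) * x = iota a * (iota ((e - c * b / a) / a) * hy z).
  rewrite /x /y !(rmorphM, rmorphB, fmorphV); field.
  by rewrite ia.
have -> : x = iota a * (hx z - iota (- (b / a)) * hy z).
  by rewrite /x !(rmorphM, rmorphN, fmorphV); field; rewrite ia.
rewrite !absvM ltr_pM2l ?absv_gt0//.
case: z {x y key} => [z|] /=; rewrite ?mulr1 ?mulr0 ?subr0 ?absv1 ?mulr1 ?isoI// absv0 mulr0.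
by rewrite ltr10.
Qed.

Lemma mobius_disc A d : A \in unitmx -> d_radius d != 0 ->
  exists2 d', d_radius d' != 0 &
    forall z, open_disc d (mobiusC A z) <-> open_disc d' z.
Proof.
move=> uA /open_disc_form[M uM dM].
have [|d' d'0 E] := @form_disc_open (M *m A); first by rewrite unitmx_mul uM.
by exists d' => // z; rewrite dM -E; exact: form_disc_mobius.
Qed.

Lemma disc_near d (z z' : line C) : absv (z' - z) < absv (d_radius d) ->
  (open_disc d (Some z') <-> open_disc d (Some z)) /\
  (closed_disc d (Some z') <-> closed_disc d (Some z)).
Proof.
move=> zz; have {}zz : absv (z' - iota (d_center d) - (z - iota (d_center d))) <
    absv (d_radius d) by rewrite opprB addrA subrK.
rewrite /Defs.open_disc /Defs.closed_disc /=; case: (d_infty d).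
  by rewrite !ltNge (absv_le_congr (ltW zz)) -!ltNge !leNgt (absv_lt_congr zz).
by rewrite (absv_lt_congr zz) (absv_le_congr (ltW zz)).
Qed.

Lemma disc_far d (z : line C) :
  absv (d_center d) < absv z -> absv (d_radius d) < absv z ->
  (open_disc d (Some z) <-> d_infty d) /\ (closed_disc d (Some z) <-> d_infty d).
Proof.
move=> az cz; rewrite /Defs.open_disc /Defs.closed_disc /=.
have -> : absv (z - iota (d_center d)) = absv z.
  by rewrite addrC absvD_eqr// absvN isoI.
case: (d_infty d); first by rewrite cz (ltW cz).
by rewrite ltNge (ltW cz) leNgt cz.
Qed.

Lemma open_disc_open d : d_radius d != 0 -> open (open_disc d : set (P1 C)).
Proof.
rewrite -absv_gt0 => d0; split.
  move=> z dz; exists (absv (d_radius d)) => // z' /disc_near[h _].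
  exact/h.
move=> dN; exists (Num.max (absv (d_center d)) (absv (d_radius d))) => z.
by rewrite gt_max => /andP[az cz]; apply/(disc_far az cz).1.
Qed.

Lemma P1_inj_continuous : continuous P1_inj.
Proof.
apply/continuousP => U [oU iU]; split.
  move=> z Uz; have [r r0 rU] := oU _ Uz; exists r => // z' zz; apply: rU.
  by rewrite -rmorphB isoI.
by move=> /iU[r rU]; exists r => z rz; apply: rU; rewrite isoI.
Qed.

(** Continuity of Moebius maps: a disc about [u] with radius in the value group of [K] has a disc as
    preimage, and discs are open. *)
Lemma mobius_nbhs A (z : P1 K) (u : line K) (e : R) : A \in unitmx ->
  mobius A z = Some u -> (exists2 c : line K, c != 0 & absv c <= e) ->
  nbhs z [set z' | exists2 u', mobius A z' = Some u' & absv (u' - u) < e].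
Proof.
move=> uA Az [c c0 ce]; have [d' d0 dE] := @mobius_disc A (Disc false u c) uA c0.
have : nbhs z (P1_inj @^-1` (open_disc d')).
  apply: P1_inj_continuous; apply: open_nbhs_nbhs; split; first exact: open_disc_open.
  by apply/dE; rewrite -P1_inj_mobius Az /= subrr absv0 absv_gt0.
apply: filterS => z' /=; rewrite -dE -P1_inj_mobius.
case: (mobius A z') => [u'|] //= uu; exists u' => //.
by rewrite -isoI rmorphB (lt_le_trans uu).
Qed.

End Discs.

(** * Fundamental domains of Schottky groups *)

Section PingPong.
Context (R : realType) (K C : nafield R).
Context (iota : {rmorphism line K -> line C}).
Hypothesis isoI : forall x : line K, absv (iota x) = absv x.
Context (G : set 'M[line K]_2) (g : nat) (gam : 'I_g -> 'M[line K]_2).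
Context (D : bool -> 'I_g -> disc K).
Hypothesis subG : pgl_subgroup G.
Hypothesis hD : good_domain iota G gam D.

Local Notation mobiusC := (mobiusC iota).
Local Notation open_disc := (open_disc iota).
Local Notation closed_disc := (closed_disc iota).
Local Notation letter := ('I_g * bool)%type.
Implicit Types (l m : letter) (s : seq letter) (A : 'M[line K]_2) (z : P1 C).

(** Letters are the generators and their inverses. Each throws the complement of the disc of its
    opposite into its own disc, so that no later argument has to tell the two kinds apart. *)
Definition letter_disc l : disc K := D l.2 l.1.
Definition opposite l : letter := (l.1, ~~ l.2).
Definition letter_mx l := if l.2 then gam l.1 else invmx (gam l.1).

Lemma group_unit A : G A -> A \in unitmx. Proof. by case: subG => + _ _ _; apply. Qed.

Lemma groupM A B : G A -> G B -> G (A *m B).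
Proof. by case: subG => _ _ + _; apply. Qed.

Lemma groupV A : G A -> G (invmx A). Proof. by case: subG => _ _ _; apply. Qed.

Lemma group1 : G 1%:M.
Proof. by case: subG => _ /(_ 1) + _ _; apply; exact: oner_neq0. Qed.

Lemma letter_mxG l : G (letter_mx l).
Proof.
case: hD => -[[hg _] _] _ _ _ _.
by rewrite /letter_mx; case: ifP => _; [exact: hg|exact/groupV/hg].
Qed.

Let unit_gam i : gam i \in unitmx.
Proof. by apply: group_unit; exact: (letter_mxG (i, true)). Qed.

Lemma letter_mx_unit l : letter_mx l \in unitmx.
Proof. exact/group_unit/letter_mxG. Qed.

Lemma letter_radius l : d_radius (letter_disc l) != 0.
Proof. by case: hD => _ + _ _ _; apply. Qed.

Lemma open_closed_disc d z : open_disc d z -> closed_disc d z.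
Proof. by case: z => [z|] //=; case: (d_infty d) => /ltW. Qed.

Lemma letter_disjoint l m z :
  closed_disc (letter_disc l) z -> closed_disc (letter_disc m) z -> l = m.
Proof.
move=> lz mz; apply: contrapT => lm; case: hD => _ _ /(_ l.2 l.1 m.2 m.1) + _ _.
move=> H; suff : set0 z by [].
rewrite -H; first by split.
by case=> e2 e1; apply: lm; case: l m e1 e2 {lz mz H} => [? ?] [? ?] /= -> ->.
Qed.

Lemma letter_open l z : ~ closed_disc (letter_disc (opposite l)) z ->
  open_disc (letter_disc l) (mobiusC (letter_mx l) z).
Proof.
case: l => i [] /= nz; case: hD => _ _ _ ec eo; rewrite /letter_disc /letter_mx /=.
  by rewrite -eo; exists z.
apply: contrapT => no; apply: nz; rewrite /letter_disc /= -ec.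
by exists (mobiusC (invmx (gam i)) z) => //; rewrite mobiusCVK.
Qed.

Lemma letter_closed l z : ~ open_disc (letter_disc (opposite l)) z ->
  closed_disc (letter_disc l) (mobiusC (letter_mx l) z).
Proof.
case: l => i [] /= nz; case: hD => _ _ _ ec eo; rewrite /letter_disc /letter_mx /=.
  by rewrite -ec; exists z.
apply: contrapT => no; apply: nz; rewrite /letter_disc /= -eo.
by exists (mobiusC (invmx (gam i)) z) => //; rewrite mobiusCVK.
Qed.

Lemma letter_exit l z : open_disc (letter_disc l) z ->
  ~ closed_disc (letter_disc (opposite l)) (mobiusC (invmx (letter_mx l)) z).
Proof.
case: l => i [] /=; case: hD => _ _ _ ec eo; rewrite /letter_disc /letter_mx /=.
  by rewrite -eo => -[y ny <-]; rewrite mobiusCK.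
rewrite invmxK => zo; rewrite -ec => -[y yo /(congr1 (mobiusC (invmx (gam i))))].
by rewrite !mobiusCK// => yz; apply: yo; rewrite yz.
Qed.

Lemma domainP z : domain iota D z <-> forall l, ~ open_disc (letter_disc l) z.
Proof.
split=> [dz [i b] zo|nz [b _ [i _ zo]]]; last exact: nz (i, b) zo.
by apply: dz; exists b => //; exists i.
Qed.

Lemma word_cons l s : word_mx gam (l :: s) = letter_mx l *m word_mx gam s.
Proof. by rewrite /word_mx big_cons. Qed.

Lemma word_nil : word_mx gam [::] = 1%:M.
Proof. by rewrite /word_mx big_nil. Qed.

Lemma word_mxG s : G (word_mx gam s).
Proof.
elim: s => [|l s IH]; first by rewrite word_nil; exact: group1.
by rewrite word_cons; apply: groupM => //; exact: letter_mxG.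
Qed.

Lemma word_unit s : word_mx gam s \in unitmx.
Proof. exact/group_unit/word_mxG. Qed.

Lemma not_opposite l m : (l.1 != m.1) || (l.2 == m.2) -> m <> opposite l.
Proof.
case: l m => i b [j c] /= H [ji cb]; move: H; rewrite ji cb eqxx /=.
by case: b {cb}.
Qed.

Lemma letter_next l m z : m <> opposite l -> closed_disc (letter_disc m) z ->
  open_disc (letter_disc l) (mobiusC (letter_mx l) z).
Proof. by move=> ml mz; apply: letter_open => oz; apply: ml; exact: letter_disjoint mz oz. Qed.

(** The disc is closed only on account of the first letter applied, since the starting point may lie
    on a boundary circle; every further letter lands strictly inside. *)
Lemma reduced_word_closed l s z : reduced_word (l :: s) -> domain iota D z ->
  closed_disc (letter_disc l) (mobiusC (word_mx gam (l :: s)) z).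
Proof.
move=> + dz; elim: s l => [|m s IH] l rs.
  rewrite word_cons word_nil mulmx1; apply: letter_closed.
  exact: (domainP z).1.
move: rs => /= /andP[lm rs]; rewrite word_cons mobiusCM ?word_unit ?letter_mx_unit//.
by apply/open_closed_disc/(letter_next (not_opposite lm))/IH.
Qed.

Lemma reduced_word_open l m s z : reduced_word [:: l, m & s] ->
  domain iota D z ->
  open_disc (letter_disc l) (mobiusC (word_mx gam [:: l, m & s]) z).
Proof.
move=> /= /andP[lm rs] dz.
rewrite word_cons mobiusCM ?word_unit ?letter_mx_unit//.
exact/(letter_next (not_opposite lm))/reduced_word_closed.
Qed.

Lemma word_reduce s :
  exists2 s', reduced_word s' & word_mx gam s = word_mx gam s'.
Proof.
elim: s => [|l s [s' rs' E]]; first by exists [::].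
rewrite word_cons E; case: s' {E} rs' => [|m s'] rs'.
  by exists [:: l] => //; rewrite word_cons.
have [lm|] := boolP ((l.1 != m.1) || (l.2 == m.2)).
  by exists [:: l, m & s']; [rewrite /reduced_word /= lm|rewrite [RHS]word_cons].
rewrite negb_or negbK => /andP[/eqP l1 l2]; exists s'; first exact: path_sorted rs'.
have -> : letter_mx l = invmx (letter_mx m).
  rewrite /letter_mx l1; case: (l.2) (m.2) l2 => [] [] //= _.
  by rewrite invmxK.
by rewrite word_cons mulKmx// letter_mx_unit.
Qed.

Lemma group_word A : G A -> exists (c : line K) s,
  [/\ c != 0, reduced_word s & A = c *: word_mx gam s].
Proof.
case: hD => -[[_ hg] _] _ _ _ _ /hg[c [s [c0 ->]]].
by have [s' rs' ->] := word_reduce s; exists c, s'.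
Qed.

(** A reduced word of two or more letters sends the domain into an open disc, hence off itself.
    Single letters survive because they identify boundary circles. *)
Lemma domain_stabilizer A z : G A -> domain iota D z ->
  domain iota D (mobiusC A z) -> exists (c : line K) s,
  [/\ c != 0, (size s <= 1)%N & A = c *: word_mx gam s].
Proof.
move=> /group_word[c [s [c0 rs ->]]] dz; rewrite mobiusC_scale// => dAz.
exists c, s; split => //; case: s rs dAz => [|l [|m s]]// rs /domainP/(_ l) [].
exact: reduced_word_open.
Qed.

(** One letter remains to be excluded. An inverse generator lands in a closed disc [D false i],
    against strictness of the image; a generator, by strictness of [z], lands in the open disc
    [D true i], against the image being in the domain. *)
Lemma strict_unique A z : G A ->
  domain iota D z -> (forall i, ~ closed_disc (D false i) z) ->
  domain iota D (mobiusC A z) ->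
  (forall i, ~ closed_disc (D false i) (mobiusC A z)) -> mobiusC A z = z.
Proof.
move=> GA dz sz; have [c [s [c0 rs ->]]] := group_word GA.
rewrite mobiusC_scale//; case: s rs => [|l [|m s]] rs dAz sAz.
- by rewrite word_nil mobiusC1.
- have := reduced_word_closed rs dz; move: dAz sAz.
  rewrite word_cons word_nil mulmx1; case: l {rs} => i [] dAz sAz cl; last first.
    by case: (sAz i).
  by case: ((domainP _).1 dAz (i, true)); apply: letter_open; exact: sz.
- by case: ((domainP _).1 dAz l); exact: reduced_word_open.
Qed.

Lemma compl_discs_open (T : finType) (d : T -> disc K) :
  (forall t, d_radius (d t) != 0) ->
  open ([set z | forall t, ~ open_disc (d t) z] : set (P1 C)).
Proof.
move=> d0; split.
  move=> z dz; have [|r r0 rd] := @finite_lower_bound R T (fun t => absv (d_radius (d t))).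
    by move=> t; rewrite absv_gt0.
  exists r => // z' zz t /(disc_near _ (lt_le_trans zz (rd t))).1.
  exact: dz.
move=> dN; have [r rd] := finite_upper_bound (fun t => absv (d_radius (d t))).
have [r' rd'] := finite_upper_bound (fun t => absv (d_center (d t))).
exists (Num.max r r') => z; rewrite gt_max => /andP[rz rz'] t.
move=> /(disc_far isoI (le_lt_trans (rd' t) rz') (le_lt_trans (rd t) rz)).1.
exact: dN.
Qed.

(** Preimages of discs are discs, and the complement of finitely many of them is open, because
    ultrametric discs are both open and closed. *)
Lemma domain_translate_open A : A \in unitmx ->
  open ([set z | domain iota D (mobiusC A z)] : set (P1 C)).
Proof.
move=> uA.
have /choice[d hd] l : exists d, d_radius d != 0 /\
    forall z, open_disc (letter_disc l) (mobiusC A z) <-> open_disc d z.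
  by have [d d0 dE] := mobius_disc isoI uA (letter_radius l); exists d.
rewrite (_ : [set z | _] = [set z | forall l, ~ open_disc (d l) z]).
  by apply: compl_discs_open => l; exact: (hd l).1.
apply/seteqP; split => z.
  by move=> /domainP dz l /((hd l).2 z)/dz.
by move=> dz; apply/domainP => l /((hd l).2 z)/dz.
Qed.

(** If [u n q] tends to [A z], it eventually stays in the open translate of the domain by [A]. The
    elements [B n] comparing later terms with the [N]th then keep a domain point in the domain; they
    fall into finitely many classes, so two terms of the sequence would be proportional. *)
Lemma domain_not_limit A z : G A -> domain iota D z ->
  ~ limit_set iota G (mobiusC A z).
Proof.
move=> GA dz [q [u [Gu du uq]]]; have uA := group_unit GA.
have [N _ uN] : \forall n \near \oo,
    domain iota D (mobiusC (invmx A) (mobiusC (u n) q)).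
  apply: (uq [set y | domain iota D (mobiusC (invmx A) y)]).
  apply: open_nbhs_nbhs; split; first by apply: domain_translate_open; rewrite unitmx_inv.
  by rewrite /= mobiusCK.
have uu n := group_unit (Gu n).
pose B n := invmx A *m u (N + n)%N *m invmx (u N) *m A.
have BG n : G (B n).
  by do !apply: groupM => //; do ?exact: groupV.
have hB n : exists (o : option letter) (c : line K), c != 0 /\
    B n = c *: (if o is Some l then letter_mx l else 1%:M).
  have [||c [s [c0 s1 BE]]] := @domain_stabilizer (B n) (mobiusC (invmx A) (mobiusC (u N) q)) (BG n).
  - by apply: uN => /=.
  - rewrite /B -!mobiusCM ?unitmx_mul ?unitmx_inv ?uu ?uA//.
    rewrite mulmxK// mulmxKV// mobiusCM ?unitmx_inv//.
    by apply: uN => /=; rewrite leq_addr.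
  case: s s1 BE => [|l [|//]] _ BE.
    by exists None, c; rewrite BE word_nil.
  by exists (Some l), c; rewrite BE word_cons word_nil mulmx1.
have [t ht] := choice hB.
(* One index more than there are classes: the identity and the single letters. *)
pose h (i : 'I_(#|{: option letter}|.+1)) := t i.
have [inj|] := pselect (injective h).
  by have := leq_card h inj; rewrite card_ord ltnn.
apply => i j hij; apply: contrapT => ij.
have [ci [ci0 Bi]] := ht i; have [cj [cj0 Bj]] := ht j.
have ijn : (N + i)%N <> (N + j)%N by move=> /addnI /val_inj.
apply: (du _ _ ijn (ci / cj)).
have BE : B i = (ci / cj) *: B j.
  by rewrite Bi Bj -/(h i) -/(h j) hij scalerA divfK.
have BK n : u (N + n)%N = A *m B n *m invmx A *m u N.
  by rewrite /B !mulmxA mulmxV// mul1mx mulmxK// mulmxKV.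
by rewrite BK BE -scalemxAr -!scalemxAl -BK.
Qed.

(** Adding the radius to the centre gives a point exactly on the boundary circle. Such points lie in
    the domain and show that nested discs differ. *)
Definition boundary_point (d : disc K) : P1 C :=
  Some (iota (d_center d + d_radius d)).

Lemma boundary_pointP d :
  closed_disc d (boundary_point d) /\ ~ open_disc d (boundary_point d).
Proof.
rewrite /Defs.closed_disc /Defs.open_disc /= -rmorphB isoI addrAC subrr add0r.
by case: (d_infty d); rewrite lexx ltxx.
Qed.

Lemma boundary_point_domain l : domain iota D (boundary_point (letter_disc l)).
Proof.
have [cl no] := boundary_pointP (letter_disc l).
apply/domainP => m om; have E := letter_disjoint cl (open_closed_disc om).
by apply: no; rewrite [in X in open_disc X]E.
Qed.

End PingPong.

(** * Existence: points outside the limit set have a translate in the domain *)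

Section Exit.
Context (R : realType) (K C : nafield R).
Context (iota : {rmorphism line K -> line C}).
Hypothesis isoI : forall x : line K, absv (iota x) = absv x.
Context (pi : line K).
Hypotheses (pi0 : pi != 0) (pi1 : absv pi < 1).
Hypothesis discrete : forall x : line K, absv x < 1 -> absv x <= absv pi.

Local Notation mobiusC := (mobiusC iota).
Local Notation open_disc := (open_disc iota).
Local Notation closed_disc := (closed_disc iota).

Let discrete_lt (x y : line K) : y != 0 -> absv x < absv y ->
  absv x <= absv pi * absv y.
Proof.
move=> y0 xy; rewrite -ler_pdivrMr ?absv_gt0// -absvV -absvM; apply: discrete.
by rewrite absvM absvV ltr_pdivrMr ?absv_gt0// mul1r.
Qed.

Lemma pi_power_small (e : R) : 0 < e ->
  exists N, forall n, (N <= n)%N -> absv pi ^+ n < e.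
Proof.
move=> e0; have : (fun n => absv pi ^+ n) @ \oo --> (0 : R).
  by apply: cvg_expr; rewrite ger0_norm// absv_ge0.
move=> /cvgrPdist_lt/(_ _ e0)[N _ NE]; exists N => n /NE.
by rewrite /= sub0r normrN ger0_norm// exprn_ge0// absv_ge0.
Qed.

(** Around infinity a larger radius means a smaller disc. Passing from a disc around infinity to a
    finite one gives no comparison of radii, but in a nested chain this happens at most once. *)
Lemma disc_shrink (d d' : disc K) : d_radius d != 0 -> d_radius d' != 0 ->
  open_disc d' `<=` open_disc d -> (exists2 x, open_disc d x & ~ open_disc d' x) ->
  if d_infty d' then d_infty d /\ absv (d_radius d) < absv (d_radius d') /\
     absv (d_center d - d_center d') <= absv (d_radius d')
  else ~~ d_infty d -> absv (d_radius d') < absv (d_radius d).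
Proof.
case: d d' => [i a c] [i' a' c'] /=; rewrite -!absv_gt0 => c0 c'0 sub [x dx nx].
case: i' sub nx => sub nx.
  have i1 : i by exact: (sub None).
  have aa : absv (a - a') <= absv c'.
    rewrite leNgt; apply/negP => aa; have := sub (Some (iota a)).
    rewrite /Defs.open_disc /= i1 -!rmorphB !isoI subrr absv0 => /(_ aa).
    by rewrite ltNge absv_ge0.
  split=> //; split=> //; rewrite ltNge; apply/negP => cc; apply: nx.
  move: dx; rewrite /Defs.open_disc /= i1; case: x => [x|]//; rewrite !ltNge.
  apply: contra => xa; rewrite -(subrKA (iota a')) absvD_le ?(le_trans xa)//.
  by rewrite -rmorphB isoI absvBC (le_trans aa).
move=> i0; move: sub dx; rewrite /Defs.open_disc /= (negbTE i0) => sub.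
rewrite ltNge; case: x nx => [x|]//; rewrite /Defs.open_disc /= => nx xa.
apply/negP => cc; apply: nx.
have aa : absv (iota a' - iota a) < absv c.
  by have := sub (Some (iota a')); rewrite /= subrr absv0; apply.
apply: absv_dist (lt_le_trans xa cc) _.
by rewrite absvBC (lt_le_trans aa).
Qed.

(* The radii of a strictly decreasing chain shrink by the factor |pi|. *)
Lemma nested_discs (d : nat -> disc K) (z : P1 C) (U : set (P1 C)) :
  (forall n, d_radius (d n) != 0) ->
  (forall n, open_disc (d n.+1) `<=` open_disc (d n)) ->
  (forall n, exists2 x, open_disc (d n) x & ~ open_disc (d n.+1) x) ->
  (forall n, open_disc (d n) z) -> nbhs z U ->
  exists N, forall n, (N <= n)%N -> open_disc (d n) `<=` U.
Proof.
move=> d0 dS dP dz; rewrite nbhsE => -[V [[oV iV] Vz] VU].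
have shr n := disc_shrink (d0 n) (d0 n.+1) (@dS n) (dP n).
have dSm n k : open_disc (d (n + k)%N) `<=` open_disc (d n).
  elim: k => [|k IH]; first by rewrite addn0.
  by rewrite addnS; exact: subset_trans (@dS _) IH.
(* Either the discs become finite and their radii tend to 0, or all of them surround infinity and
   their radii grow without bound, which forces [z] to be infinity. *)
have [[N fN]|/forallNP inf] := pselect (exists N, ~~ d_infty (d N)).
  have fk k : ~~ d_infty (d (N + k)%N).
    by apply: contra fN => ik; apply: (dSm _ k None).
  have rk k : absv (d_radius (d (N + k)%N)) <= absv pi ^+ k * absv (d_radius (d N)).
    elim: k => [|k IH]; first by rewrite addn0 expr0 mul1r.
    have := shr (N + k)%N; rewrite -addnS (negbTE (fk k.+1)) => /(_ (fk k)).
    move=> /(discrete_lt (d0 _))/le_trans; apply; rewrite exprS -mulrA.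
    by rewrite ler_wpM2l ?absv_ge0.
  case: z dz Vz => [z|] dz Vz; last by have := dz N; rewrite /= (negbTE fN).
  have [e e0 eV] := oV _ Vz.
  have [|M Me] := @pi_power_small (e / absv (d_radius (d N))).
    by rewrite divr_gt0 ?absv_gt0.
  exists (N + M)%N => n Nn x dx.
  have [k Mk nE] : exists2 k, (M <= k)%N & n = (N + k)%N.
    by exists (n - N)%N; rewrite ?subnKC ?leq_subRL ?(leq_trans (leq_addr _ _) Nn).
  have rn : absv (d_radius (d n)) < e.
    by rewrite nE (le_lt_trans (rk k))// -ltr_pdivlMr ?absv_gt0// Me.
  apply: VU; have := dz n; move: dx; case: x => [x|].
    rewrite /Defs.open_disc /= nE (negbTE (fk k)) -nE => xa za; apply: eV.
    by apply: (@absv_dist _ _ _ (iota (d_center (d n)))); rewrite ?(absvBC _ z) (lt_trans _ rn).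
  by rewrite /Defs.open_disc /= nE (negbTE (fk k)).
have ii n : d_infty (d n) by apply: contrapT => /negP; exact: inf.
have rk k : (absv pi ^+ k)^-1 * absv (d_radius (d 0%N)) <= absv (d_radius (d k)).
  elim: k => [|k IH]; first by rewrite expr0 invr1 mul1r.
  have := shr k; rewrite ii => -[_ [/(discrete_lt (d0 _)) h _]].
  rewrite exprS invfM -mulrA ler_pdivrMl ?absv_gt0//; exact: le_trans IH h.
have aa k : absv (d_center (d 0%N) - d_center (d k)) <= absv (d_radius (d k)).
  have mono j : absv (d_radius (d j)) < absv (d_radius (d j.+1)).
    by have := shr j; rewrite ii => -[_ []].
  elim: k => [|k IH]; first by rewrite subrr absv0 absv_ge0.
  rewrite -(subrKA (d_center (d k))) absvD_le//.
    exact: le_trans IH (ltW (mono k)).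
  by have := shr k; rewrite ii => -[_ []].
(* The centres drift by no more than the current radius, so every disc may be recentred at the first
   centre. *)
have out k (x : line C) : open_disc (d k) (Some x) ->
    absv (d_radius (d k)) < absv (x - iota (d_center (d 0%N))).
  rewrite /Defs.open_disc /= ii !ltNge; apply: contra => xa.
  by rewrite -(subrKA (iota (d_center (d 0%N)))) absvD_le// -rmorphB isoI.
have big (r : R) : exists N, forall n, (N <= n)%N -> r < absv (d_radius (d n)).
  have [|N Nr] := @pi_power_small (absv (d_radius (d 0%N)) / (`|r| + 1)).
    by rewrite divr_gt0 ?absv_gt0// ltr_wpDl.
  exists N => n /Nr; rewrite ltr_pdivlMr ?ltr_wpDl// => h.
  apply: lt_le_trans (rk n); rewrite mulrC ltr_pdivlMr ?exprn_gt0 ?absv_gt0//.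
  apply: le_lt_trans h; rewrite mulrC ler_wpM2l ?exprn_ge0 ?absv_ge0//.
  by rewrite (le_trans (ler_norm r))// lerDl.
case: z dz Vz => [z|] dz Vz.
  have [N Nz] := big (absv (z - iota (d_center (d 0%N)))).
  by have := lt_trans (Nz N (leqnn _)) (out _ _ (dz N)); rewrite ltxx.
have [r rV] := iV Vz.
have [N Nr] := big (Num.max r (absv (d_center (d 0%N)))).
exists N => n /Nr; rewrite gt_max => /andP[rn an] [x|] dx; apply: VU => //.
apply: rV; have xr := out _ _ dx; rewrite ltNge; apply/negP => xr'.
have : absv (x - iota (d_center (d 0%N))) <= absv (d_radius (d n)).
  by apply: absvB_le; [exact: le_trans xr' (ltW rn)|rewrite isoI ltW].
by rewrite leNgt xr.
Qed.

Context (G : set 'M[line K]_2) (g : nat) (gam : 'I_g -> 'M[line K]_2).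
Context (D : bool -> 'I_g -> disc K).
Hypothesis subG : pgl_subgroup G.
Hypothesis hD : good_domain iota G gam D.
Hypothesis g0 : (0 < g)%N.

Local Notation letter := ('I_g * bool)%type.
Local Notation letter_disc := (letter_disc D).
Local Notation letter_mx := (letter_mx gam).

Section Itinerary.
Variables (z : P1 C) (l0 : letter).
Hypothesis nodomain : forall A, G A -> ~ domain iota D (mobiusC A z).

Let enter (y : P1 C) : letter := xget l0 [set l | open_disc (letter_disc l) y].

(** Prefixes of the infinite word read off by pulling [z] back, again and again, through the disc in
    which it is found. The default [l0] of [enter] never occurs, as [z] has no translate in the
    domain. *)
Fixpoint itinerary_mx n : 'M[line K]_2 :=
  if n is k.+1 then
    itinerary_mx k *m letter_mx (enter (mobiusC (invmx (itinerary_mx k)) z))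
  else 1%:M.

Let u := itinerary_mx.
Let zn n := mobiusC (invmx (u n)) z.
Let l n := enter (zn n).

Let uS n : u n.+1 = u n *m letter_mx (l n). Proof. by []. Qed.

Let uG n : G (u n).
Proof.
by elim: n => [|n IH]; [exact: group1|apply: groupM => //; exact: (letter_mxG subG hD)].
Qed.

Let uu n : u n \in unitmx. Proof. exact: (group_unit subG). Qed.

Let lu i : letter_mx i \in unitmx. Proof. exact: (letter_mx_unit subG hD). Qed.

Let zn_in n : open_disc (letter_disc (l n)) (zn n).
Proof.
have /existsNP[i /contrapT oi] :
    ~ forall i, ~ open_disc (letter_disc i) (zn n).
  by move/domainP; apply: nodomain; exact: groupV.
exact: (@xgetPex _ l0 [set i | open_disc (letter_disc i) (zn n)] (ex_intro _ i oi)).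
Qed.

(** Pulling a point out of a disc by its letter puts it outside the closed disc of the opposite
    letter; hence the itinerary never backtracks. *)
Let l_next n : l n.+1 <> opposite (l n).
Proof.
move=> E; have := zn_in n.+1; rewrite E => /open_closed_disc.
rewrite /zn uS (_ : invmx (u n *m letter_mx (l n)) = invmx (letter_mx (l n)) *m invmx (u n)).
  by rewrite mobiusCM ?unitmx_inv//; exact: (letter_exit subG hD (zn_in n)).
apply: (can_inj (mulKmx (_ : u n *m letter_mx (l n) \in unitmx))).
  by rewrite unitmx_mul uu lu.
by rewrite mulmxV ?unitmx_mul ?uu ?lu// -mulmxA (mulmxA _ _ (invmx (u n))) mulmxV// mul1mx mulmxV.
Qed.

(** Translates of the letter discs along the itinerary: all contain [z], and they are strictly
    nested. *)
Let B n := [set x | open_disc (letter_disc (l n)) (mobiusC (invmx (u n)) x)].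

Let BE n y : B n (mobiusC (u n) y) = open_disc (letter_disc (l n)) y.
Proof. by rewrite /B /= mobiusCK. Qed.

Let B_enter n y : closed_disc (letter_disc (l n.+1)) y -> B n (mobiusC (u n.+1) y).
Proof.
move=> cy; rewrite uS mobiusCM// BE.
exact: (letter_next subG hD (@l_next n) cy).
Qed.

Let B_sub n : B n.+1 `<=` B n.
Proof.
move=> x xB; rewrite -(mobiusCVK iota x (uu n.+1)); apply: B_enter.
exact: open_closed_disc.
Qed.

Let u_word n k : u (n + k) = u n *m word_mx gam [seq l i | i <- seq.iota n k].
Proof.
elim: k n => [|k IH] n; first by rewrite addn0 word_nil mulmx1.
by rewrite addnS -addSn IH uS /= word_cons mulmxA.
Qed.

Let l_reduced n k : reduced_word [seq l i | i <- seq.iota n k].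
Proof.
case: k => //= k; elim: k n => //= k IH n; rewrite IH andbT.
have := @l_next n; rewrite /opposite; case: (l n.+1) (l n) => [i b] [j c] /= H.
rewrite -implyNb negbK; apply/implyP => /eqP ij; apply/eqP.
by apply: contrapT => cb; apply: H; rewrite ij; congr pair; case: (b) (c) cb => [] [].
Qed.

(** The prefixes carry a domain point down the nested discs to [z], and freeness makes them pairwise
    non-proportional. *)
Lemma itinerary_limit : limit_set iota G z.
Proof.
pose q : P1 C := boundary_point iota (letter_disc l0).
have dq : domain iota D q by exact: (boundary_point_domain isoI hD).
(* The shift by two: the last letter of [u n.+2] takes [q] into the closed disc of the letter at
   index [n.+1], and [B_enter] places that disc, moved by [u n.+1], inside [B n]. *)
exists q, (fun n => u n.+2); split => // [m n mn c E|].
  wlog ltmn : m n c mn E / (m < n)%N.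
    move=> wl; have [|nm] := ltnP m n; first exact: wl E.
    have c0 : c != 0.
      apply: contraTneq (uu m.+2) => c0; rewrite E c0 scale0r.
      by rewrite unitmxE det0 unitr0.
    apply: (wl n m c^-1).
    - exact: nesym.
    - by rewrite E scalerA mulVf ?scale1r.
    - by rewrite ltn_neqAle nm andbT; apply/eqP/nesym.
  have := u_word m.+2 (n - m); rewrite !addSn subnKC ?(ltnW ltmn)// => En.
  have nn : [seq l i | i <- seq.iota m.+2 (n - m)] != [::].
    by rewrite -size_eq0 size_map size_iota subn_eq0 -ltnNge.
  case: hD => -[_ /(_ _ nn (l_reduced _ _))] /negP + _ _ _ _; apply.
  have c0 : c != 0.
    apply: contraTneq (uu m.+2) => c0; rewrite E c0 scale0r.
    by rewrite unitmxE det0 unitr0.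
  rewrite (_ : word_mx _ _ = (c^-1)%:M) ?scalar_mx_is_scalar//.
  apply: (can_inj (mulKmx (uu m.+2))).
  by rewrite -En mul_mx_scalar E scalerA mulVf// scale1r.
have /choice[d hd] n : exists d, d_radius d != 0 /\ forall x, B n x <-> open_disc d x.
  have [|d d0 dE] := @mobius_disc _ _ _ _ isoI (invmx (u n)) (letter_disc (l n)) _
    (letter_radius hD (l n)); first by rewrite unitmx_inv.
  by exists d.
move=> U Uz; have [|||||N NU] := @nested_discs d z U => //.
- by move=> n; exact: (hd n).1.
- by move=> n x /((hd n.+1).2) xB; apply/(hd n).2; exact: B_sub.
- move=> n; have [cb nb] := boundary_pointP isoI (letter_disc (l n.+1)).
  exists (mobiusC (u n.+1) (boundary_point iota (letter_disc (l n.+1)))).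
    by apply/(hd n).2; exact: B_enter.
  by move=> /((hd n.+1).2); rewrite BE.
- by move=> n; apply/(hd n).2; exact: zn_in.
exists N => // n Nn; apply: NU (Nn : (N <= n)%N) _ _; apply/(hd n).2.
rewrite uS mobiusCM//; apply: B_enter.
by apply: (letter_closed subG hD); exact: (domainP iota D q).1 dq _.
Qed.

End Itinerary.

Lemma domain_translates z : ~ limit_set iota G z ->
  exists2 A, G A & domain iota D (mobiusC A z).
Proof.
move=> nz; apply: contrapT => nA; apply: nz.
apply: (itinerary_limit (Ordinal g0, true)) => A GA dA.
by apply: nA; exists A.
Qed.

End Exit.

(** * Retraction onto the skeleton *)

Section GaussPoint.
Context (R : realType) (C : nafield R).
Implicit Types (a b c : line C) (r e : R) (P Q : {poly line C}).

Section Norm.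
Variables (a : line C) (r : R).
Hypothesis r0 : 0 < r.

Local Notation coefa P i := (absv ((P \Po ('X + a%:P))`_i) * r ^+ i).

Let size_shift P : size (P \Po ('X + a%:P)) = size P.
Proof. by apply: size_comp_poly2; exact: size_XaddC. Qed.

Lemma gauss_point_ge0 P : 0 <= gauss_point a r P.
Proof.
rewrite /gauss_point; elim/big_ind : _ => // [x y x0 y0|i _].
  by rewrite le_max x0.
by rewrite mulr_ge0 ?absv_ge0 ?exprn_ge0 ?ltW.
Qed.

Lemma gauss_point_ge P i : coefa P i <= gauss_point a r P.
Proof.
have [iP|Pi] := ltnP i (size P); last first.
  by rewrite nth_default ?size_shift// absv0 mul0r gauss_point_ge0.
by rewrite /gauss_point (bigD1 (Ordinal iP))//= le_max lexx.
Qed.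

Lemma gauss_point_le P e : 0 <= e -> (forall i, coefa P i <= e) ->
  gauss_point a r P <= e.
Proof.
move=> e0 Pe; rewrite /gauss_point; elim/big_ind : _ => // x y xe ye.
by rewrite ge_max xe.
Qed.

(** The pivot for the proof of multiplicativity: the least index attaining the maximum. For the zero
    polynomial index 0 does, both sides being 0. *)
Lemma gauss_point_first P : exists i, coefa P i = gauss_point a r P /\
  forall j, (j < i)%N -> coefa P j < gauss_point a r P.
Proof.
have ex : exists i, coefa P i == gauss_point a r P.
  have [P0|P0] := eqVneq P 0.
    by exists 0%N; rewrite P0 comp_poly0 coef0 absv0 mul0r /gauss_point size_poly0 big_ord0.
  apply: contrapT => /forallNP ne; have : gauss_point a r P < gauss_point a r P.
    rewrite {1}/gauss_point; elim/big_ind : _ => [|x y xe ye|i _].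
    - rewrite lt_neqAle gauss_point_ge0 andbT; apply/eqP => g0.
      have := gauss_point_ge P (size P).-1; rewrite -g0 -size_shift -lead_coefE.
      rewrite leNgt mulr_gt0 ?exprn_gt0// absv_gt0 lead_coef_eq0.
      by rewrite -size_poly_eq0 size_shift size_poly_eq0.
    - by rewrite gt_max xe.
    - by rewrite lt_neqAle gauss_point_ge andbT; apply/negP/ne.
  by rewrite ltxx.
case: (ex_minnP ex) => i /eqP Ei mini; exists i; split=> // j ji.
rewrite lt_neqAle gauss_point_ge andbT; apply/negP => /mini.
by rewrite leqNgt ji.
Qed.

(* Gauss's lemma: the product of the first coefficients of maximal norm cannot
   be cancelled. *)
Lemma gauss_point_seminorm : mult_seminorm (gauss_point a r).
Proof.
split.
- move=> c; apply/le_anti/andP; split.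
    apply: gauss_point_le; first exact: absv_ge0.
    move=> i; rewrite comp_polyC coefC; case: eqP => [->|_].
      by rewrite expr0 mulr1.
    by rewrite absv0 mul0r absv_ge0.
  by apply: le_trans (gauss_point_ge _ 0); rewrite comp_polyC coefC/= expr0 mulr1.
- move=> P Q; apply/le_anti/andP; split.
    apply: gauss_point_le => [|i]; first by rewrite mulr_ge0 ?gauss_point_ge0.
    rewrite comp_polyM coefM -ler_pdivlMr ?exprn_gt0//.
    apply: absv_sum_le => [|j _]; first by rewrite divr_ge0 ?mulr_ge0 ?gauss_point_ge0 ?exprn_ge0 ?ltW.
    rewrite ler_pdivlMr ?exprn_gt0// absvM -[i in r ^+ i](subnKC (leq_ord j)) exprD mulrACA.
    by apply: ler_pM; rewrite ?mulr_ge0 ?absv_ge0 ?exprn_ge0 ?(ltW r0) ?gauss_point_ge.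
  have [i [Ei mi]] := gauss_point_first P; have [j [Ej mj]] := gauss_point_first Q.
  apply: le_trans (gauss_point_ge _ (i + j)).
  have [z0|] := eqVneq (gauss_point a r P * gauss_point a r Q) 0.
    by rewrite z0 mulr_ge0 ?absv_ge0 ?exprn_ge0 ?ltW.
  rewrite -Ei -Ej mulrACA -exprD mulf_eq0 negb_or => /andP[n0 _].
  have rij := exprn_gt0 (i + j) r0; rewrite ler_pM2r//.
  rewrite -absvM in n0 *; rewrite absv_eq0 in n0.
  have ij : (i < (i + j).+1)%N by rewrite ltnS leq_addr.
  rewrite comp_polyM coefM (bigD1 (Ordinal ij))//= addKn addrC absvD_eqr//.
  (* Every other term of the convolution has one of its two indices below the corresponding pivot,
     hence is strictly smaller than the product of the pivots. *)
  elim/big_ind : _ => [|x y|k ki].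
  - by rewrite absv0 absv_gt0.
  - exact: absvD_lt.
  - have rE : r ^+ (i + j) = r ^+ k * r ^+ (i + j - k).
      by rewrite -exprD subnKC// leq_ord.
    rewrite -(ltr_pM2r rij) {1}rE exprD !absvM mulrACA [ltRHS]mulrACA Ei Ej.
    have gP : 0 < gauss_point a r P.
      rewrite -Ei mulr_gt0 ?exprn_gt0// absv_gt0.
      by apply: contraNneq n0 => ->; rewrite mul0r.
    have gQ : 0 < gauss_point a r Q.
      rewrite -Ej mulr_gt0 ?exprn_gt0// absv_gt0.
      by apply: contraNneq n0 => ->; rewrite mulr0.
    have [kli|ikl] := ltnP k i.
      apply: le_lt_trans (_ : _ <= coefa P k * gauss_point a r Q) _.
        by rewrite ler_wpM2l ?gauss_point_ge// mulr_ge0 ?absv_ge0 ?exprn_ge0 ?ltW.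
      by rewrite ltr_pM2r ?mi.
    have kj : (i + j - k < j)%N.
      rewrite ltn_subLR ?leq_ord// ltn_add2r ltn_neqAle ikl andbT.
      by apply: contra ki => /eqP ik; apply/eqP/val_inj.
    apply: le_lt_trans (_ : _ <= gauss_point a r P * coefa Q (i + j - k)%N) _.
      by rewrite ler_wpM2r ?gauss_point_ge// mulr_ge0 ?absv_ge0 ?exprn_ge0 ?ltW.
    by rewrite ltr_pM2l ?mj.
- move=> P Q; apply: gauss_point_le => [|i]; first by rewrite le_max gauss_point_ge0.
  rewrite comp_polyD coefD.
  apply: le_trans (_ : _ <= Num.max (coefa P i) (coefa Q i)) _.
    by rewrite -maxr_pMl ?exprn_ge0 ?(ltW r0)// ler_wpM2r ?exprn_ge0 ?(ltW r0)// absvD.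
  by rewrite ge_max !le_max !gauss_point_ge /= orbT.
Qed.

Lemma gauss_pointX b : gauss_point a r ('X - b%:P) = Num.max r (absv (a - b)).
Proof.
have E : ('X - b%:P) \Po ('X + a%:P) = 'X + (a - b)%:P.
  by rewrite comp_polyB comp_polyX comp_polyC polyCB addrA.
apply/le_anti/andP; split.
  apply: gauss_point_le => [|i]; first by rewrite le_max (ltW r0).
  rewrite E coefD coefX coefC; case: i => [|[|i]] /=.
  - by rewrite add0r expr0 mulr1 le_max lexx orbT.
  - by rewrite addr0 absv1 mul1r expr1 le_max lexx.
  - by rewrite addr0 absv0 mul0r le_max (ltW r0).
rewrite ge_max; apply/andP; split.
  apply: le_trans (gauss_point_ge _ 1).
  by rewrite E coefD coefX coefC /= addr0 absv1 mul1r expr1.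
apply: le_trans (gauss_point_ge _ 0).
by rewrite E coefD coefX coefC /= add0r expr0 mulr1.
Qed.

End Norm.

Lemma eval_point_seminorm c : mult_seminorm (eval_point c).
Proof.
split=> [b|P Q|P Q]; rewrite /eval_point ?hornerC// ?hornerM ?absvM// hornerD.
exact: absvD.
Qed.

Section Seminorm.
Variables (x : {poly line C} -> R).
Hypothesis sx : mult_seminorm x.

Lemma seminormXB a b :
  x ('X - b%:P) <= Num.max (x ('X - a%:P)) (absv (a - b)).
Proof.
case: sx => xC _ xD; rewrite -xC polyCB.
by have := xD ('X - a%:P) (a%:P - b%:P); rewrite subrKA.
Qed.

Lemma seminorm_dist a b :
  absv (a - b) <= Num.max (x ('X - a%:P)) (x ('X - b%:P)).
Proof.
case: sx => xC xM xD; rewrite -xC maxC.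
have -> : x ('X - a%:P) = x (- ('X - a%:P)).
  have -> : - ('X - a%:P) = (-1)%:P * ('X - a%:P) by rewrite polyCN polyC1 mulN1r.
  by rewrite xM xC absvN absv1 mul1r.
have -> : (a - b)%:P = ('X - b%:P) + - ('X - a%:P) by rewrite polyCB; ring.
exact: xD.
Qed.

End Seminorm.

Lemma berk_disc_recenter a b r : absv (a - b) < r ->
  berk_disc a r `<=` berk_disc b r.
Proof.
move=> ab x [sx xa]; split => //.
by rewrite (le_lt_trans (seminormXB sx a b))// gt_max xa.
Qed.

End GaussPoint.

(** * Local constancy of the retraction *)

Section Retraction.
Context (R : realType) (K C : nafield R).
Context (iota : {rmorphism line K -> line C}).
Hypothesis isoI : forall x : line K, absv (iota x) = absv x.
Context (g : nat) (D : bool -> 'I_g -> disc K) (S : set (P1 C)).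
Hypothesis radius0 : forall b i, d_radius (D b i) != 0.
Hypothesis bounded : ~ domain iota D None.

Local Notation domain := (domain iota D).
Local Notation dom := (domain_an_minus iota D S).
Local Notation retraction := (retraction iota D S).
Local Notation skeleton := (skeleton iota D S).

Let retract_set x := [set y | skeleton y /\
    (x = y \/ exists (a : line C) (r : R),
       [/\ 0 < r, berk_disc a r x, berk_disc a r `<=` dom &
           y = gauss_point a r])].

(** Two open discs sharing a point are nested. If the disc that reaches the skeleton is the larger
    one, it also contains [x']; were it the smaller, its Gauss point would lie inside the given disc
    and so off the skeleton. *)
Let retract_sub a r x x' : 0 < r -> berk_disc a r `<=` dom ->
  berk_disc a r x -> berk_disc a r x' -> retract_set x `<=` retract_set x'.
Proof.
move=> r0 sub ax ax' y [sy [xy|[b [s [s0 bx bsub yE]]]]].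
  by exfalso; case: sy => _; apply; exists a, r; rewrite -xy.
split => //; right; exists b, s; split => //.
have ab : absv (a - b) < Num.max r s.
  apply: le_lt_trans (seminorm_dist ax.1 a b) _.
  by rewrite gt_max !lt_max ax.2 bx.2 orbT.
have [rs|sr] := leP r s.
  apply: (@berk_disc_recenter _ _ a); first by move: ab; rewrite max_r.
  by split; [exact: ax'.1|exact: lt_le_trans ax'.2 rs].
exfalso; case: sy => dy; apply; exists a, r; split => //; split; first by case: dy.
rewrite yE gauss_pointX// gt_max sr absvBC.
by move: ab; rewrite max_l// ltW.
Qed.

Let domain_disc_iff (z : line C) : domain (Some z) <-> forall b i,
  if d_infty (D b i) then absv (z - iota (d_center (D b i))) <= absv (d_radius (D b i))
  else absv (d_radius (D b i)) <= absv (z - iota (d_center (D b i))).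
Proof.
split=> [dz b i|h [b _ [i _]]]; last first.
  by rewrite /open_disc /=; have := h b i; case: d_infty; rewrite leNgt => /negP.
have : ~ open_disc iota (D b i) (Some z) by move=> o; apply: dz; exists b => //; exists i.
by rewrite /open_disc /=; case: d_infty => /negP; rewrite -leNgt.
Qed.

Let eval_X (z c : line C) : eval_point z ('X - c%:P) = absv (z - c).
Proof. by rewrite /eval_point !hornerE. Qed.

(** The inequalities of the domain persist below the smallest radius, and [e] keeps the points of
    [S] away. Only those in the domain matter, since a classical point of the small disc satisfies
    the same inequalities. *)
Let dom_ball (z : line C) : domain (Some z) ->
  (exists2 e : R, 0 < e & forall s, S (Some s) -> domain (Some s) -> e <= absv (s - z)) ->
  exists2 r, 0 < r & berk_disc z r `<=` dom.
Proof.
move=> /domain_disc_iff dz [e e0 eS].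
have [|r r0 rd] := @finite_lower_bound R (bool * 'I_g)%type
    (fun t => absv (d_radius (D t.1 t.2))).
  by move=> t; rewrite absv_gt0.
exists (Num.min r e); first by rewrite lt_min r0.
move=> x [sx]; rewrite lt_min => /andP[xr xe].
have dx b i : if d_infty (D b i)
  then x ('X - (iota (d_center (D b i)))%:P) <= absv (d_radius (D b i))
  else absv (d_radius (D b i)) <= x ('X - (iota (d_center (D b i)))%:P).
  have xc := lt_le_trans xr (rd (b, i)); have := dz b i.
  case: d_infty => zc.
    by apply: le_trans (seminormXB sx z _) _; rewrite ge_max (ltW xc).
  rewrite leNgt; apply/negP => xc'.
  have := le_trans zc (seminorm_dist sx z (iota (d_center (D b i)))).
  by rewrite le_max !leNgt xc xc'.
split => // s Ss xs; have := eS s Ss; rewrite leNgt.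
have -> : absv (s - z) < e by rewrite -eval_X -xs.
suff ds : domain (Some s) by move/(_ ds).
by apply/domain_disc_iff => b i; rewrite -eval_X -xs.
Qed.

(* The largest disc around a classical point ends at the skeleton. *)
Let retract_nonempty (z : line C) r0 : domain (Some z) -> 0 < r0 ->
  berk_disc z r0 `<=` dom -> exists y, retract_set (eval_point z) y.
Proof.
move=> /domain_disc_iff dz r00 sub0.
pose T := [set r : R | 0 < r /\ berk_disc z r `<=` dom].
(* If [r] were larger, a Gauss point of radius strictly between would belong to the disc of radius
   [r] and yet violate the inequality of the removed disc around infinity. *)
have Tub b i : d_infty (D b i) -> ubound T (absv (d_radius (D b i))).
  move=> ii r [r1 rsub]; rewrite leNgt; apply/negP => cr.
  have c0 : 0 < absv (d_radius (D b i)) by rewrite absv_gt0.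
  pose s := (absv (d_radius (D b i)) + r) / 2.
  have [cs sr] : absv (d_radius (D b i)) < s /\ s < r by rewrite /s; split; lra.
  have s0 : 0 < s := lt_trans c0 cs.
  have [|_ /(_ b i) + _] := rsub (gauss_point z s).
    by split; [exact: gauss_point_seminorm|rewrite gauss_pointX// subrr absv0 max_l// ltW].
  by rewrite ii gauss_pointX// ge_max leNgt cs.
have [b [i ii]] : exists b i, d_infty (D b i).
  apply: contrapT => n; apply: bounded => -[b _ [i _ bi]]; apply: n.
  by exists b, i.
have T0 : T r0 by [].
have hsT : has_sup T by split; [exists r0|exists (absv (d_radius (D b i))); exact: Tub].
pose m := sup T; have r0m : r0 <= m by exact: sup_upper_bound hsT _ T0.
have m0 : 0 < m := lt_le_trans r00 r0m.
have msub : berk_disc z m `<=` dom.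
  move=> x [sx xm]; have [r [_ rsub] xr] := sup_gt hsT.1 xm.
  exact: rsub.
exists (gauss_point z m); split; last first.
  right; exists z, m; split => //; split; first exact: eval_point_seminorm.
  by rewrite eval_X subrr absv0.
split; last first.
  move=> [c [s [s0 [_ cs] csub]]]; move: cs; rewrite gauss_pointX// gt_max => /andP[ms zc].
  have Ts : T s.
    by split => //; apply: subset_trans csub; apply: berk_disc_recenter.
  by have := sup_upper_bound hsT Ts; rewrite leNgt ms.
split; first exact: gauss_point_seminorm.
  move=> b' i'; have := dz b' i'; rewrite gauss_pointX//; case: ifP => ii' zc.
    by rewrite ge_max zc andbT; apply: ge_sup; [exists r0|exact: Tub].
  by rewrite le_max zc orbT.
move=> s _ /(congr1 (fun x => x ('X - s%:P))); rewrite eval_X subrr absv0 gauss_pointX//.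
by move=> E; have : m <= 0 by [rewrite -E le_max lexx]; rewrite leNgt m0.
Qed.

(** The retraction is constant on any open disc contained in the punctured domain, so membership
    passes to all nearby [K]-points. *)
Lemma U_nbhd_open (A : set (line K)) (u : line K) :
  (exists2 e : R, 0 < e & forall s, S (Some s) -> domain (Some s) ->
     e <= absv (s - iota u)) ->
  U_nbhd iota D S A u ->
  exists2 r : R, 0 < r & forall u', absv (u' - u) < r -> U_nbhd iota D S A u'.
Proof.
move=> hS [du Su Uu]; have [r r0 sub] := dom_ball du hS.
exists r => // u' uu'.
have in_ball v : absv (v - u) < r -> berk_disc (iota u) r (eval_point (iota v)).
  by move=> vu; split; [exact: eval_point_seminorm|rewrite eval_X -rmorphB isoI].
have bu : berk_disc (iota u) r (eval_point (iota u)) by apply: in_ball; rewrite subrr absv0.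
have bu' := in_ball _ uu'; have [_ du' su'] := sub _ bu'.
have Edom : domainK iota D u'.
  by apply/domain_disc_iff => b i; rewrite -eval_X; exact: du'.
split => //; first by move=> Ss; exact: su' Ss erefl.
have E : retraction (eval_point (iota u')) = retraction (eval_point (iota u)).
  (* Non-emptiness matters: the default of [xget] is the point being retracted, which differs for
     [u] and [u']; on a common non-empty set the same element is chosen. *)
  have [y ry] := retract_nonempty du r0 sub.
  rewrite /Defs.retraction -/(retract_set _) -/(retract_set (eval_point (iota u))).
  rewrite (_ : retract_set (eval_point (iota u')) = retract_set (eval_point (iota u))).
    by rewrite /xget; case: pselect => // ne; case: ne; exists y; apply/asboolP.
  by apply/seteqP; split; exact: (retract_sub r0 sub).
by rewrite E.
Qed.

End Retraction.

(** * Continuity and compactness over the local field *)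

Section Continuity.
Context (R : realType) (K F : nafield R).

Definition absv_continuous_at (h : line K -> line F) (a : line K) :=
  forall e : R, 0 < e -> exists2 d : R, 0 < d &
    forall z, absv (z - a) < d -> absv (h z - h a) < e.

Implicit Types (h k : line K -> line F) (a : line K).

Lemma absv_continuous_cst (c : line F) a : absv_continuous_at (fun=> c) a.
Proof. by move=> e e0; exists 1 => // z _; rewrite subrr absv0. Qed.

Lemma absv_continuousD h k a : absv_continuous_at h a ->
  absv_continuous_at k a -> absv_continuous_at (fun z => h z + k z) a.
Proof.
move=> ch ck e e0; have [d d0 hd] := ch e e0; have [d' d'0 kd] := ck e e0.
exists (Num.min d d') => [|z]; first by rewrite lt_min d0.
by rewrite lt_min => /andP[/hd ? /kd ?]; rewrite opprD addrACA absvD_lt.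
Qed.

Lemma absv_continuousM h k a : absv_continuous_at h a ->
  absv_continuous_at k a -> absv_continuous_at (fun z => h z * k z) a.
Proof.
move=> ch ck e e0.
have ph : 0 < absv (h a) + 1 by rewrite ltr_wpDl ?absv_ge0.
have pk : 0 < absv (k a) + 1 by rewrite ltr_wpDl ?absv_ge0.
have [|d d0 hd] := ch (Num.min 1 (e / (absv (k a) + 1))).
  by rewrite lt_min ltr01 divr_gt0.
have [|d' d'0 kd] := ck (e / (absv (h a) + 1)); first by rewrite divr_gt0.
exists (Num.min d d') => [|z]; first by rewrite lt_min d0.
rewrite lt_min => /andP[/hd + /kd kz]; rewrite lt_min => /andP[h1 hz].
have -> : h z * k z - h a * k a = (h z - h a) * k a + h z * (k z - k a) by ring.
apply: absvD_lt; rewrite absvM.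
  apply: le_lt_trans (_ : _ <= absv (h z - h a) * (absv (k a) + 1)) _.
    by rewrite ler_wpM2l ?absv_ge0// lerDl.
  by rewrite -ltr_pdivlMr.
have hza : absv (h z) <= absv (h a) + 1.
  rewrite -(subrK (h a) (h z)) absvD_le ?lerDl//.
  by rewrite (le_trans (ltW h1))// lerDr absv_ge0.
apply: le_lt_trans (_ : _ <= (absv (h a) + 1) * absv (k z - k a)) _.
  by rewrite ler_wpM2r ?absv_ge0.
by rewrite mulrC -ltr_pdivlMr.
Qed.

Lemma absv_continuousV h a : h a != 0 -> absv_continuous_at h a ->
  absv_continuous_at (fun z => (h z)^-1) a.
Proof.
rewrite -absv_gt0 => ha ch e e0.
have [|d d0 hd] := ch (Num.min (absv (h a)) (e * (absv (h a) * absv (h a)))).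
  by rewrite lt_min ha !mulr_gt0.
exists d => // z /hd; rewrite lt_min => /andP[hz1 hz2].
have Ez : absv (h z) = absv (h a) by rewrite -[in LHS](subrK (h a) (h z)) absvD_eqr.
have z0 : h z != 0 by rewrite -absv_gt0 Ez.
have a0 : h a != 0 by rewrite -absv_gt0.
have -> : (h z)^-1 - (h a)^-1 = (h a - h z) / (h z * h a) by field; rewrite a0 z0.
by rewrite absvM absvV absvM Ez absvBC ltr_pdivrMr// mulr_gt0.
Qed.

Lemma absv_continuous_near h k a (r : R) : 0 < r ->
  (forall z, absv (z - a) < r -> h z = k z) ->
  absv_continuous_at h a -> absv_continuous_at k a.
Proof.
move=> r0 hk ch e e0; have [d d0 hd] := ch e e0.
exists (Num.min d r) => [|z]; first by rewrite lt_min d0.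
rewrite lt_min => /andP[/hd zd zr]; rewrite -!hk//.
by rewrite subrr absv0.
Qed.

Lemma absv_continuous_neq0 h a : absv_continuous_at h a -> h a != 0 ->
  exists2 r : R, 0 < r & forall z, absv (z - a) < r -> h z != 0.
Proof.
rewrite -absv_gt0 => ch ha; have [r r0 hr] := ch _ ha; exists r => // z /hr zr.
by rewrite -absv_gt0 -(subrK (h a) (h z)) absvD_eqr.
Qed.

Lemma absv_continuous_uniform (A : set (line K)) h a :
  (exists2 r : R, 0 < r & forall z, absv (z - a) < r -> A z) ->
  (forall e : R, 0 < e -> exists2 k, absv_continuous_at k a &
     forall z, A z -> absv (h z - k z) < e) ->
  absv_continuous_at h a.
Proof.
move=> [r r0 rA] hA e e0; have [k ck hk] := hA e e0; have [d d0 kd] := ck e e0.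
exists (Num.min d r) => [|z]; first by rewrite lt_min d0.
rewrite lt_min => /andP[/kd zd zr].
apply: (@absv_dist _ _ _ (k z)); first exact/hk/rA.
by apply: absv_dist zd _; rewrite absvBC; apply/hk/rA; rewrite subrr absv0.
Qed.

End Continuity.

Section AnalyticContinuity.
Context (R : realType) (K C : nafield R).
Context (iota : {rmorphism line K -> line C}).
Hypothesis isoI : forall x : line K, absv (iota x) = absv x.

Lemma absv_continuous_iota a : absv_continuous_at iota a.
Proof. by move=> e e0; exists e => // z; rewrite -rmorphB isoI. Qed.

Lemma absv_continuous_poly (P : {poly line C}) a :
  absv_continuous_at (fun z => P.[iota z]) a.
Proof.
elim/poly_ind: P => [|P c IH].
  apply: (@absv_continuous_near _ _ _ (fun=> 0) _ _ 1) => // [z _|].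
    by rewrite horner0.
  exact: absv_continuous_cst.
apply: (@absv_continuous_near _ _ _ (fun z => P.[iota z] * iota z + c) _ _ 1) => // [z _|].
  by rewrite !hornerE.
apply: absv_continuousD; last exact: absv_continuous_cst.
by apply: absv_continuousM => //; exact: absv_continuous_iota.
Qed.

(** A uniform limit, on a neighbourhood of [a], of rational functions without poles there. *)
Lemma analytic_on_continuous (A : set (P1 C)) (h : P1 C -> line C) a :
  analytic_on iota A h ->
  (exists2 r : R, 0 < r & forall z, absv (z - a) < r -> A (Some (iota z))) ->
  absv_continuous_at (fun z => h (Some (iota z))) a.
Proof.
move=> hA hr; apply: (absv_continuous_uniform (A := [set z | A (Some (iota z))])) => // e e0.
have [P [Q [[Q0 QA] hPQ]]] := hA e e0.
exists (fun z => rat_eval iota P Q (Some (iota z))); last by move=> z Az; exact: hPQ.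
apply: absv_continuousM; first exact: absv_continuous_poly.
apply: absv_continuousV; last exact: absv_continuous_poly.
by have [r r0 rA] := hr; apply: (QA (Some _)); apply: rA; rewrite subrr absv0.
Qed.

End AnalyticContinuity.

(** * Compactness of balls *)

Section LocalField.
Context (R : realType) (K : nafield R) (p f : nat) (pi : line K).
Hypothesis hK : local_field p f pi.

Let card_gt1 : (1 < p ^ f)%N.
Proof.
case: hK => _ [pp f0] _ _ _; case: f f0 => // n _.
by rewrite expnS (leq_trans (prime_gt1 pp))// leq_pmulr// expn_gt0 prime_gt0.
Qed.

Lemma uniformizer_gt0 : 0 < absv pi.
Proof. by case: hK => _ _ -> _ _; rewrite invr_gt0 ltr0n ltnW. Qed.

Lemma uniformizer_lt1 : absv pi < 1.
Proof. by case: hK => _ _ -> _ _; rewrite invf_lt1 ?ltr1n// ltr0n ltnW. Qed.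

Lemma uniformizer_neq0 : pi != 0.
Proof. by rewrite -absv_gt0 uniformizer_gt0. Qed.

Lemma uniformizer_small (e : R) : 0 < e -> exists n, absv (pi ^+ n) < e.
Proof.
move=> e0; have [N NE] := pi_power_small uniformizer_lt1 e0; exists N.
have -> : absv (pi ^+ N) = absv pi ^+ N.
  by elim: N {NE} => [|n IH]; rewrite ?expr0 ?absv1// !exprS absvM IH.
exact: NE.
Qed.

Section BallInduction.
Variable P : set (line K) -> Prop.
Hypotheses (Psub : forall A B, A `<=` B -> P B -> P A) (P0 : P set0)
  (PU : forall A B, P A -> P B -> P (A `|` B))
  (Ploc : forall a, exists2 r : R, 0 < r & P [set z | absv (z - a) < r]).

Let ball (a c : line K) := [set z : line K | absv (z - a) <= absv c].

Let P_bigU (s : nat) (A : 'I_s -> set (line K)) :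
  (forall i, P (A i)) -> P [set z | exists i, A i z].
Proof.
elim: s A => [|s IH] A PA; first by apply: Psub P0 => z [[]].
apply: Psub (PU (PA ord0) (IH (fun i => A (lift ord0 i)) (fun i => PA _))) => z [i Ai].
by case: (unliftP ord0 i) Ai => [j|] -> Az; [right; exists j|left].
Qed.

Let split_ball a c : c != 0 -> ~ P (ball a c) ->
  exists a', absv (a' - a) <= absv c /\ ~ P (ball a' (c * pi)).
Proof.
move=> c0 nP; case: hK => _ _ _ disc [e [e1 eP]].
apply: contrapT => /forallNP H; apply: nP.
apply: Psub (@P_bigU _ (fun i => ball (a + c * e i) (c * pi)) _) => [z za|i].
  have [|i [zi _]] := eP ((z - a) / c).
    by rewrite absvM absvV ler_pdivrMr ?absv_gt0// mul1r.
  exists i; rewrite /ball /= absvM -ler_pdivrMl ?absv_gt0//.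
  have -> : z - (a + c * e i) = c * ((z - a) / c - e i) by field.
  by rewrite absvM mulKf ?absv_eq0// disc.
have := H (a + c * e i); rewrite addrAC subrr add0r absvM.
move=> /not_andP[]; last exact: contrapT.
by rewrite ler_piMr ?absv_ge0.
Qed.

(** A failing ball is covered by [p ^ f] balls with radius smaller by the factor [|pi|], one of
    which fails. The centres chosen in this way converge by completeness and contradict [Ploc] at
    their limit. All compactness arguments over [K] go through this principle. *)
Lemma ball_induction (r : R) : P [set z | absv z <= r].
Proof.
have [c c0 rc] : exists2 c : line K, c != 0 & r <= absv c.
  have [|n nr] := @uniformizer_small ((`|r| + 1)^-1); first by rewrite invr_gt0 ltr_wpDl.
  have n0 : pi ^+ n != 0 by rewrite expf_neq0// uniformizer_neq0.
  exists (pi ^+ n)^-1; first by rewrite invr_eq0.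
  rewrite absvV; apply: le_trans (_ : _ <= `|r| + 1) _.
    by rewrite (le_trans (ler_norm r))// lerDl.
  by rewrite -[leLHS]invrK lef_pV2 ?posrE ?invr_gt0 ?absv_gt0 ?ltr_wpDl// ltW.
apply: (@Psub _ (ball 0 c)); first by move=> z zr; rewrite /ball /= subr0 (le_trans zr).
apply: contrapT => nP.
have /choice[nxt nxtP] (x : line K * nat) : exists a' : line K,
    ~ P (ball x.1 (c * pi ^+ x.2)) -> absv (a' - x.1) <= absv (c * pi ^+ x.2) /\
      ~ P (ball a' (c * pi ^+ x.2 * pi)).
  have [Px|nPx] := pselect (P (ball x.1 (c * pi ^+ x.2))); first by exists 0.
  have [|a' ha'] := split_ball _ nPx; last by exists a'.
  by rewrite mulf_neq0 ?expf_neq0 ?uniformizer_neq0.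
pose a := fix a n : line K := if n is k.+1 then nxt (a k, k) else 0.
have aP n : ~ P (ball (a n) (c * pi ^+ n)).
  elim: n => [|n IH]; first by rewrite expr0 mulr1.
  by have [_] := nxtP (a n, n) IH; rewrite -mulrA -exprSr.
have an n : absv (a n.+1 - a n) <= absv (c * pi ^+ n) by have [] := nxtP (a n, n) (aP n).
have pm n k : absv (c * pi ^+ (n + k)) <= absv (c * pi ^+ n).
  elim: k => [|k IH]; first by rewrite addn0.
  rewrite addnS exprSr mulrA absvM (le_trans _ IH)//.
  by rewrite ler_piMr ?absv_ge0// ltW// uniformizer_lt1.
have ank n k : absv (a (n + k)%N - a n) <= absv (c * pi ^+ n).
  elim: k => [|k IH]; first by rewrite addn0 subrr absv0 absv_ge0.
  rewrite addnS -(subrKA (a (n + k)%N)) absvD_le//.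
  exact: le_trans (an _) (pm n k).
have small (e : R) : 0 < e -> exists N, absv (c * pi ^+ N) < e.
  move=> e0; have [|N Ne] := @uniformizer_small (e / absv c).
    by rewrite divr_gt0 ?absv_gt0.
  by exists N; rewrite absvM mulrC -ltr_pdivlMr ?absv_gt0.
case: hK => complete _ _ _ _; have [|l al] := complete a.
  move=> e /small[N Ne]; exists N => m n Nm Nn.
  rewrite -(subnKC Nm) -(subnKC Nn); apply: le_lt_trans Ne.
  by rewrite -(subrKA (a N)) absvD_le// absvBC.
have [r' r'0 Pr] := Ploc l; have [N Nr] := small _ r'0.
apply: (aP N); apply: Psub Pr => z zN /=.
have [M _ Ml] : \forall n \near \oo, absv (a n - l) < r'.
  apply: (al [set z | absv (z - l) < r']); apply: open_nbhs_nbhs; split.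
    move=> y yl; exists r' => // y' yy'.
    by rewrite /= -(subrKA y); exact: absvD_lt.
  by rewrite /= subrr absv0.
have lN : absv (a N - l) < r'.
  rewrite -(subrKA (a (N + M)%N)) absvD_lt ?Ml//= ?leq_addl//.
  by rewrite absvBC (le_lt_trans (ank N M)).
by rewrite -(subrKA (a N)); apply: absvD_lt => //; exact: le_lt_trans zN Nr.
Qed.

End BallInduction.

End LocalField.

(** * Densities and thinned jump kernels *)

Section Density.
Context d (T : measurableType d) (R : realType).
Variables (mu m : {measure set T -> \bar R}) (phi : T -> R).
Hypotheses (mphi : measurable_fun setT phi) (phi0 : forall x, 0 <= phi x).
Hypothesis densityE : forall B, measurable B ->
  m B = (\int[mu]_(x in B) (phi x)%:E)%E.
Local Open Scope ereal_scope.

Import HBNNSimple.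

(** True for indicators by [densityE], for simple functions by linearity, and in general by monotone
    convergence on both sides. *)
Lemma ge0_integral_density (g : T -> \bar R) : measurable_fun setT g ->
  (forall x, 0 <= g x) -> \int[m]_x g x = \int[mu]_x (g x * (phi x)%:E).
Proof.
move=> mg g0; pose h := nnsfun_approx measurableT mg.
have mphiE : measurable_fun setT (fun x => (phi x)%:E) by exact/measurable_EFinP.
have hg (x : T) : (h n x)%:E @[n --> \oo] --> g x.
  by apply: cvg_nnsfun_approx => // y _; exact: g0.
have -> : \int[m]_x g x = lim (\int[m]_x (h n x)%:E @[n --> \oo]).
  have gE x : g x = lim ((h n x)%:E @[n --> \oo]) by apply/esym/cvg_lim.
  under eq_integral do rewrite gE.
  apply: monotone_convergence => //.
  - by move=> n; apply/measurable_EFinP; exact/measurable_funP.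
  - by move=> n x _; rewrite lee_fin.
  - by move=> x _ a b ab; rewrite lee_fin; exact/lefP/nd_nnsfun_approx.
have -> : \int[mu]_x (g x * (phi x)%:E) =
    lim (\int[mu]_x ((h n x)%:E * (phi x)%:E) @[n --> \oo]).
  have gE x : g x * (phi x)%:E = lim (((h n x)%:E * (phi x)%:E) @[n --> \oo]).
    by apply/esym/cvg_lim => //; apply: cvgeZr => //; exact: hg.
  under eq_integral do rewrite gE.
  apply: monotone_convergence => //.
  - move=> n; apply: emeasurable_funM => //.
    by apply/measurable_EFinP; exact/measurable_funP.
  - by move=> n x _; rewrite mule_ge0 ?lee_fin.
  - move=> x _ a b ab; rewrite lee_wpmul2r ?lee_fin//; exact/lefP/nd_nnsfun_approx.
suff suf n : \int[mu]_x ((h n x)%:E * (phi x)%:E) = \int[m]_x (h n x)%:E.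
  by under [in RHS]eq_fun do rewrite suf.
transitivity (\int[m]_x
   (\sum_(y \in range (h n)) (y * \1_(h n @^-1` [set y]) x)%:E)); last first.
  by apply: eq_integral => t tE; rewrite /= fimfunE -fsumEFin.
have indich k r : measurable_fun setT (fun x => (r * \1_(h k @^-1` [set r]) x)%:E).
  by apply: (measurable_comp measurableT) => //; exact: measurable_funM.
rewrite ge0_integral_fsum//; last by move=> y x _; exact: nnfun_muleindic_ge0.
transitivity (\int[mu]_x (\sum_(y \in range (h n))
    (y * \1_(h n @^-1` [set y]) x)%:E * (phi x)%:E)).
  under [RHS]eq_integral => x xE.
    rewrite -ge0_mule_fsuml => [|y]; last exact: nnfun_muleindic_ge0.
    rewrite fsumEFin // -(fimfunE _ x); over.
  by [].
rewrite ge0_integral_fsum//; last 2 first.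
  - by move=> y; apply: emeasurable_funM.
  - by move=> y x _; rewrite mule_ge0 ?lee_fin// -lee_fin; exact: nnfun_muleindic_ge0.
apply: eq_fsbigr => r rhn.
under [RHS]eq_integral do rewrite EFinM.
rewrite integralZl_indic_nnsfun//.
under eq_integral do rewrite EFinM -muleA.
have r0 : (0 <= r)%R by case/set_mem : rhn => x _ <-.
rewrite ge0_integralZl//.
- under eq_integral do rewrite muleC.
  rewrite (eq_integral (fun x => ((fun y => (phi y)%:E) \_ (h n @^-1` [set r])) x)).
    by rewrite -integral_mkcond integral_indic// setIT densityE.
  by move=> x _; rewrite epatch_indic.
- by apply: emeasurable_funM => //; exact/measurable_EFinP.
- by move=> x _; rewrite mule_ge0 ?lee_fin.
Qed.

Hypothesis mu_fin : mu setT < +oo.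
Hypothesis phi_bounded : exists M : R, forall x, (phi x <= M)%R.

Lemma Rintegral_density (g : T -> R) (N : R) : measurable_fun setT g ->
  (forall x, `|g x| <= N)%R ->
  (\int[m]_x g x = \int[mu]_x (g x * phi x))%R.
Proof.
move=> mg gN; have [M phiM] := phi_bounded.
have N0 : (0 <= N)%R := le_trans (normr_ge0 _) (gN point).
have M0 : (0 <= M)%R := le_trans (phi0 _) (phiM point).
have gN0 x : (0 <= g x + N)%R by have := gN x; rewrite ler_norml => /andP[? _]; lra.
have bi (k : T -> R) (c : R) : measurable_fun setT k -> (forall x, `|k x| <= c)%R ->
    mu.-integrable setT (EFin \o k).
  move=> mk kc; apply: (@bounded_integrable _ _ _ _ _ c mu_fin).
    exact/measurable_EFinP.
  by move=> x; rewrite lee_fin.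
have mphi_fin : m setT < +oo.
  have [] := integrableP _ _ _ (bi phi M mphi _).
    by move=> x; rewrite ger0_norm.
  move=> _; under eq_integral do rewrite /= ger0_norm//.
  by rewrite -densityE.
have bm (k : T -> R) (c : R) : measurable_fun setT k -> (forall x, `|k x| <= c)%R ->
    m.-integrable setT (EFin \o k).
  move=> mk kc; apply: (@bounded_integrable _ _ _ _ _ c mphi_fin).
    exact/measurable_EFinP.
  by move=> x; rewrite lee_fin.
have E (k : T -> R) : measurable_fun setT k -> (forall x, 0 <= k x)%R ->
    (\int[m]_x k x = \int[mu]_x (k x * phi x))%R.
  move=> mk k0; rewrite /Rintegral; congr fine.
  rewrite ge0_integral_density//; exact/measurable_EFinP.
have cN : (forall x : T, `|cst N x : R| <= N)%R by move=> x; rewrite ger0_norm.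
have gp x : (`|g x * phi x| <= N * M)%R.
  by rewrite normrM (ger0_norm (phi0 _)) ler_pM.
have np x : (`|N * phi x| <= N * M)%R.
  by rewrite normrM !ger0_norm// ler_wpM2l.
have := E (fun x => g x + N)%R (measurable_funD mg (measurable_cst _)) gN0.
rewrite (RintegralD _ (bm g N mg gN) (bm (cst N) N (measurable_cst _) cN))//.
rewrite (E (cst N)) => [|//|x]; last exact: N0.
move/(canRL (addrK _)) ->.
have -> : (\int[mu]_x ((g x + N) * phi x) =
    \int[mu]_x (g x * phi x) + \int[mu]_x (cst N x * phi x))%R.
  rewrite -RintegralD//.
  - by apply: eq_Rintegral => x _; rewrite mulrDl.
  - exact: (bi (fun x => g x * phi x)%R _ (measurable_funM mg mphi) gp).
  - exact: (bi (fun x => N * phi x)%R _ (measurable_funM (measurable_cst _) mphi) np).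
by rewrite addrK.
Qed.

End Density.

Lemma measurable_superlevel d (T : measurableType d) (R : realType) (h : T -> R) :
  (forall a, measurable [set z | a < h z]) -> measurable_fun setT h.
Proof.
move=> hm; apply: (measurability _ (RGenOInfty.measurableE R)).
move=> _ [_ [a ->] <-]; rewrite setTI.
rewrite (_ : _ @^-1` _ = [set z | a < h z])//.
by apply/seteqP; split => z /=; rewrite in_itv/= andbT.
Qed.

(** * Thinning: a probability kernel with a constant rate *)

Section Thinning.
Context (R : realType) (X : ptopologicalType).
Variables (nu : {measure set (borel X) -> \bar R}) (H : X -> X -> R) (M : R).
Hypotheses (nu0 : (0 < nu setT)%E) (nu_fin : (nu setT < +oo)%E).
Hypothesis mH : measurable_fun setT (fun z : borel X * borel X => H z.1 z.2).
Hypotheses (H0 : forall x y, 0 <= H x y) (HM : forall x y, H x y <= M).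
Hypothesis M0 : 0 < M.

Let p (z : borel X * borel X) : R := H z.1 z.2 / M.
Let p0 z : 0 <= p z. Proof. by rewrite divr_ge0// ltW. Qed.
Let q0 z : 0 <= 1 - p z.
Proof. by rewrite subr_ge0 ler_pdivrMr// mul1r. Qed.
Let mp : measurable_fun setT p.
Proof. by apply: measurable_funM => //; exact: mH. Qed.

(* A move to y, proposed from x, is accepted with probability H x y / M. *)
Definition accept (z : borel X * borel X) : {measure set (borel X) -> \bar R} :=
  measure_add (mscale (NngNum (p0 z)) (dirac z.2))
    (mscale (NngNum (q0 z)) (dirac z.1)).

Let acceptE z U : accept z U =
  ((p z)%:E * \d_(z.2) U + (1 - p z)%:E * \d_(z.1) U)%E.
Proof. by rewrite /accept /measure_add/= /msum !big_ord_recl big_ord0 adde0. Qed.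

Let measurable_accept U : measurable U -> measurable_fun setT (accept ^~ U).
Proof.
move=> mU; rewrite (_ : accept ^~ U = fun z : borel X * borel X =>
    ((p z)%:E * (\1_U z.2)%:E + (1 - p z)%:E * (\1_U z.1)%:E)%E); last first.
  by apply/funext => z; rewrite acceptE !diracE !indicE.
apply: emeasurable_funD; apply: emeasurable_funM.
- exact/measurable_EFinP.
- apply/measurable_EFinP; apply: (measurableT_comp (measurable_indic _)) => //.
- by apply/measurable_EFinP; exact: measurable_funB.
- apply/measurable_EFinP; apply: (measurableT_comp (measurable_indic _)) => //.
Qed.

HB.instance Definition _ := isKernel.Build _ _ _ _ _ accept measurable_accept.

Let acceptT z : accept z setT = 1%E.
Proof. by rewrite acceptE !diracT !mule1 -EFinD subrKC. Qed.

HB.instance Definition _ := Kernel_isProbability.Build _ _ _ _ _ accept acceptT.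

Let integral_accept z (g : X -> R) : measurable_fun setT (g : borel X -> R) ->
  (forall y, 0 <= g y) ->
  (\int[accept z]_y (g y)%:E = (p z * g z.2 + (1 - p z) * g z.1)%:E)%E.
Proof.
move=> mg g0; have mgE := (measurable_EFinP _ _).2 mg.
rewrite ge0_integral_measure_add//; [|by move=> y _; rewrite lee_fin].
rewrite !ge0_integral_mscale//; do ?by move=> y _; rewrite lee_fin.
by rewrite !integral_dirac// !diracT !mul1e EFinD !EFinM.
Qed.

Let c : R := fine (nu setT).
Let c0 : 0 < c. Proof. by rewrite fine_gt0// nu0. Qed.
Let nuE : nu setT = c%:E. Proof. by rewrite fineK// gt0_fin_numE. Qed.
Let cV0 : 0 <= c^-1. Proof. by rewrite invr_ge0 ltW. Qed.

Definition proposal (x : borel X) : {measure set (borel X) -> \bar R} :=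
  mscale (NngNum cV0) nu.

Let measurable_proposal U : measurable U -> measurable_fun setT (proposal ^~ U).
Proof. by move=> mU; exact: measurable_cst. Qed.

HB.instance Definition _ := isKernel.Build _ _ _ _ _ proposal measurable_proposal.

Let proposalT x : proposal x setT = 1%E.
Proof. by rewrite /proposal/= /mscale/= nuE -EFinM mulVf// gt_eqF. Qed.

HB.instance Definition _ := Kernel_isProbability.Build _ _ _ _ _ proposal proposalT.

Definition thinned : borel X -> {measure set (borel X) -> \bar R} :=
  mkcomp proposal accept.

HB.instance Definition _ := Kernel.on thinned.

Let thinnedT x : thinned x setT = 1%E.
Proof.
rewrite /thinned /mkcomp/= /kcomp; under eq_integral do rewrite acceptT.
by rewrite integral_cst// mul1e proposalT.
Qed.

HB.instance Definition _ := Kernel_isProbability.Build _ _ _ _ _ thinned thinnedT.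

(** A proposal has weight [1 / c], acceptance multiplies the increment by [H x y / M], and a
    rejection contributes no increment; the rate [c * M] cancels both factors. *)
Lemma thinned_generator (psi : X -> R) (N : R) x :
  measurable_fun setT (psi : borel X -> R) -> (forall y, `|psi y| <= N) ->
  generator thinned (c * M) psi x = \int[nu]_y (H x y * (psi y - psi x)).
Proof.
move=> mpsi psiN.
have psi0 y : 0 <= psi y + N by have := psiN y; rewrite ler_norml => /andP[? _]; lra.
have m1 : measurable_fun setT (fun y : borel X => psi y + N).
  exact: measurable_funD.
have mHx : measurable_fun setT (fun y : borel X => H x y).
  exact: (measurableT_comp mH (measurable_fun_pair (measurable_cst (x : borel X))
      (@measurable_id _ (borel X) setT))).
have Hb y : `|H x y * (psi y - psi x)| <= M * (N + N).
  rewrite normrM; apply: ler_pM => //; first by rewrite ger0_norm.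
  by apply: le_trans (ler_normB _ _) _; exact: lerD.
have mHpsi : measurable_fun setT (fun y : borel X => H x y * (psi y - psi x)).
  by apply: measurable_funM => //; exact: measurable_funB.
have iH : nu.-integrable setT (EFin \o (fun y : borel X => H x y * (psi y - psi x))).
  apply: (@bounded_integrable _ _ _ _ _ (M * (N + N)) nu_fin).
    exact/measurable_EFinP.
  by move=> y; rewrite lee_fin.
have ic (r : R) : nu.-integrable setT (EFin \o (cst r : borel X -> R)).
  apply: (@bounded_integrable _ _ _ _ _ `|r| nu_fin); last first.
    by move=> y; rewrite lee_fin.
  by apply/measurable_EFinP; exact: measurable_cst.
have key : fine (\int[thinned x]_y (psi y + N)%:E) =
    (\int[nu]_y (H x y * (psi y - psi x))) / (c * M) + (psi x + N).
  rewrite /thinned /mkcomp/= integral_kcomp; [|by move=> y; rewrite lee_fin|exact/measurable_EFinP].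
  under eq_integral do rewrite integral_accept//.
  have mg : measurable_fun setT (fun y : borel X =>
      (p (x, y) * (psi y + N) + (1 - p (x, y)) * (psi x + N))%:E).
    have mpx : measurable_fun setT (fun y : borel X => p (x, y)).
      exact: (measurableT_comp mp (measurable_fun_pair (measurable_cst (x : borel X))
        (@measurable_id _ (borel X) setT))).
    apply/measurable_EFinP; apply: measurable_funD; apply: measurable_funM => //.
    exact: measurable_funB.
  rewrite ge0_integral_mscale//; last first.
    by move=> y _; rewrite lee_fin addr_ge0// mulr_ge0.
  have -> : (\int[nu]_y (p (x, y) * (psi y + N) + (1 - p (x, y)) * (psi x + N))%:E =
      (\int[nu]_y (M^-1 * (H x y * (psi y - psi x)) + (psi x + N)))%:E)%E.
    rewrite /Rintegral fineK; last first.
      apply: integrable_fin_num => //.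
      exact: (integrableD measurableT (integrableZl measurableT M^-1 iH) (ic (psi x + N))).
    by apply: eq_integral => y _; congr EFin; rewrite /p; field; rewrite gt_eqF.
  rewrite RintegralD; [|by []|exact: (integrableZl measurableT M^-1 iH)|exact: (ic (psi x + N))].
  rewrite RintegralZl// Rintegral_cst// -EFinM/= nuE/=.
  by field; rewrite !gt_eqF.
rewrite /generator -(addrK N (\int[thinned x]_y psi y)).
rewrite -(Rintegral_shift (thinnedT x) N mpsi psiN) key.
by field; rewrite !gt_eqF.
Qed.

Lemma thinned_rate_gt0 : 0 < c * M. Proof. exact: mulr_gt0. Qed.

End Thinning.

Lemma jump_kernel_exists (R : realType) (X : ptopologicalType)
    (nu : {measure set (borel X) -> \bar R}) (H : X -> X -> R) (M : R) :
  (nu setT < +oo)%E ->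
  measurable_fun setT (fun z : borel X * borel X => H z.1 z.2) ->
  (forall x y, 0 <= H x y) -> (forall x y, H x y <= M) ->
  exists (Q : R.-pker (borel X) ~> (borel X)) (lam : R), 0 < lam /\
    forall (psi : X -> R), bounded_continuous psi ->
      (fun x => \int[nu]_y (H x y * (psi y - psi x))) = generator Q lam psi.
Proof.
move=> nu_fin mH H0 HM.
have M1 : 0 < `|M| + 1 by rewrite ltr_wpDl.
have HM1 x y : H x y <= `|M| + 1.
  by rewrite (le_trans (HM x y))// (le_trans (ler_norm M))// lerDl.
have [nu0|] := boolP (0 < nu setT)%E.
  exists (thinned nu0 nu_fin mH H0 HM1 M1), (fine (nu setT) * (`|M| + 1)).
  split; first exact: thinned_rate_gt0.
  move=> psi [cpsi [N psiN]]; apply/funext => x; apply/esym.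
  by apply: (thinned_generator _ _ _ _ _ _ _ _ psiN); exact: continuous_borel.
(* If [nu] is zero there is nothing to normalise, but the operator vanishes too, and it is the
   generator of the process that always jumps to where it is. *)
rewrite lt_neqAle measure_ge0 andbT negbK => /eqP nu0.
exists (kdirac (@measurable_id _ (borel X) setT)), 1; split => // psi [cpsi _].
apply/funext => x; rewrite /Rintegral null_set_integral//=; last first.
  apply/measurable_EFinP; apply: measurable_funM.
    exact: (measurableT_comp mH (measurable_fun_pair (measurable_cst (x : borel X))
      (@measurable_id _ (borel X) setT))).
  by apply: measurable_funB => //; exact: continuous_borel.
rewrite /generator mul1r /Rintegral integral_dirac//.
  by rewrite diracT mul1e subrr.
by apply/measurable_EFinP; exact: continuous_borel.
Qed.

(** * The Laplacian of a Mumford curve *)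

Section MumfordCurve.
Context (R : realType) (K : nafield R) (p f : nat) (pi : line K).
Hypothesis hK : local_field p f pi.
Context (C : nafield R) (iota : {rmorphism line K -> line C}).
Hypothesis isoI : forall x : line K, absv (iota x) = absv x.
Context (G : set 'M[line K]_2) (g : nat) (gam : 'I_g -> 'M[line K]_2).
Context (D : bool -> 'I_g -> disc K).
Hypotheses (subG : pgl_subgroup G) (g0 : (0 < g)%N).
Hypotheses (hD : good_domain iota G gam D) (hDK : ~ domain iota D None).

Local Notation mobiusC := (mobiusC iota).
Local Notation domain := (domain iota D).
Local Notation domainK := (domainK iota D).
Local Notation strict := (strict_domainK iota D).
Local Notation Omega := (Omega iota G).
Local Notation P1_inj := (P1_inj iota).

Let GU A : G A -> A \in unitmx. Proof. exact: group_unit. Qed.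

Lemma Omega_translate A z : G A -> domain z -> Omega (mobiusC A z).
Proof. exact: (domain_not_limit isoI subG hD). Qed.

Lemma domain_Omega z : domain z -> Omega z.
Proof. by move=> dz; rewrite -(mobiusC1 iota z); apply: Omega_translate => //; exact: group1. Qed.

Lemma Omega_domain z : Omega z -> exists2 A, G A & domain (mobiusC A z).
Proof.
case: hK => _ _ _ disc _.
exact: (domain_translates isoI (uniformizer_neq0 hK) (uniformizer_lt1 hK) disc subG hD g0).
Qed.

Lemma Omega_invariant A z : G A -> Omega z -> Omega (mobiusC A z).
Proof.
move=> GA /Omega_domain[B GB dB].
rewrite -(mobiusCK iota z (GU GB)) -mobiusCM ?unitmx_inv ?GU//.
by apply: Omega_translate => //; apply: groupM => //; exact: groupV.
Qed.

(** A domain point in the closed disc [D false i] lies on its boundary circle; [gam i] moves it to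
    the circle of [D true i], which the strict domain keeps. *)
Lemma domain_to_strict (z : P1 C) : domain z -> exists A,
  [/\ G A, domain (mobiusC A z) & forall i, ~ closed_disc iota (D false i) (mobiusC A z)].
Proof.
move=> dz; have [cz|nz] := pselect (exists i, closed_disc iota (D false i) z); last first.
  exists 1%:M; rewrite mobiusC1; split => //; first exact: group1.
  by move=> i ci; apply: nz; exists i.
have [i ci] := cz; pose l : 'I_g * bool := (i, true).
have lG : G (letter_mx gam l) := letter_mxG subG hD l.
have cl : closed_disc iota (letter_disc D l) (mobiusC (letter_mx gam l) z).
  by apply: (letter_closed subG hD); exact: (domainP iota D z).1 dz _.
have nl : ~ open_disc iota (letter_disc D l) (mobiusC (letter_mx gam l) z).
  by move=> /(letter_exit subG hD); rewrite mobiusCK ?GU//; apply.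
exists (letter_mx gam l); split => //.
  apply/domainP => m om; have E := letter_disjoint hD cl (open_closed_disc om).
  by rewrite -E in om; exact: nl om.
by move=> j cj; have := letter_disjoint hD cl (cj : closed_disc iota (letter_disc D (j, false)) _).
Qed.

Lemma Omega_strict (z : P1 K) : Omega (P1_inj z) ->
  exists A u, [/\ G A, mobius A z = Some u & strict u].
Proof.
move=> /Omega_domain[A GA /domain_to_strict[B [GB]]].
rewrite -mobiusCM ?GU// -P1_inj_mobius.
case E : (mobius (B *m A) z) => [u|] // dz sz.
by exists (B *m A), u; split => //; exact: groupM.
Qed.

Lemma strict_inequivalent A u u' : G A -> strict u -> strict u' ->
  mobius A (Some u) = Some u' -> u = u'.
Proof.
move=> GA [du su] [du' su'] E.
have Ei : mobiusC A (Some (iota u)) = Some (iota u').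
  by rewrite -[Some (iota u)]/(P1_inj (Some u)) -P1_inj_mobius E.
have := strict_unique subG hD GA du su.
by rewrite [mobiusC A _]Ei => /(_ du' su') [] /fmorph_inj.
Qed.

(** A move shorter than the radius of a disc does not change membership in it, and there are
    finitely many discs; the radius is uniform. *)
Lemma domain_locally_constant : exists2 r : R, 0 < r &
  forall z z', absv (z' - z) < r ->
    (domainK z' <-> domainK z) /\ (strict z' <-> strict z).
Proof.
have [|r r0 rd] := @finite_lower_bound R (bool * 'I_g)%type
    (fun t => absv (d_radius (D t.1 t.2))).
  by move=> t; rewrite absv_gt0; case: hD => _ + _ _ _; apply.
exists r => // z z' zz.
have near b i : absv (iota z' - iota z) < absv (d_radius (D b i)).
  by rewrite -rmorphB isoI (lt_le_trans zz)// (rd (b, i)).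
have E : domainK z' <-> domainK z.
  split=> dz [b _ [i _ oz]]; apply: dz; exists b => //; exists i => //.
    exact/(disc_near iota (near b i)).1.
  exact/(disc_near iota (near b i)).1.
split => //; split=> -[/E dz sz]; split => // i ci; apply: (sz i).
  exact/(disc_near iota (near false i)).2.
exact/(disc_near iota (near false i)).2.
Qed.

Lemma domain_bounded : exists M : R, forall z, domainK z -> absv z <= M.
Proof.
have [b [i ii]] : exists b i, d_infty (D b i).
  apply: contrapT => n; apply: hDK => -[b _ [i _ bi]]; apply: n.
  by exists b, i.
exists (Num.max (absv (d_radius (D b i))) (absv (d_center (D b i)))) => z dz.
have : ~ open_disc iota (D b i) (Some (iota z)).
  by move=> oz; apply: dz; exists b => //; exists i.
rewrite /open_disc /= ii => /negP; rewrite -leNgt -rmorphB isoI => zc.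
by rewrite -(subrK (d_center (D b i)) z) absvD_le ?le_max ?zc ?lexx ?orbT.
Qed.

Lemma mobius_near A (z : P1 K) (u : line K) (e : R) : A \in unitmx ->
  mobius A z = Some u -> 0 < e ->
  nbhs z [set z' | exists2 u', mobius A z' = Some u' & absv (u' - u) < e].
Proof.
move=> uA Az e0; apply: (mobius_nbhs isoI) => //.
have [n ne] := uniformizer_small hK e0.
by exists (pi ^+ n); [rewrite expf_neq0// (uniformizer_neq0 hK)|exact: ltW].
Qed.

Lemma mobius_near_line A (z u : line K) (e : R) : A \in unitmx ->
  mobius A (Some z) = Some u -> 0 < e ->
  exists2 d : R, 0 < d & forall z', absv (z' - z) < d ->
    exists2 u', mobius A (Some z') = Some u' & absv (u' - u) < e.
Proof.
move=> uA Az e0; have := mobius_near uA Az e0.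
rewrite nbhsE => -[V [[oV _] Vz] VU]; have [r r0 rV] := oV _ Vz.
by exists r => // z' zz; apply/VU/rV.
Qed.

(** * The form, the function and the kernel of the difference *)

Context (w : line C -> line C) (hw : regular_differential iota G w).
Local Notation S := (zeros_form iota G w).

Lemma affinoid_domain : affinoid iota domain.
Proof.
exists #|{: bool * 'I_g}|, (fun i => D (enum_val i).1 (enum_val i).2); split.
  by move=> i; case: hD => _ + _ _ _; apply.
apply/seteqP; split => z dz; [move=> [i _ oz]|move=> [b _ [i _ oz]]]; apply: dz.
  by exists (enum_val i).1 => //; exists (enum_val i).2.
by exists (enum_rank (b, i)) => //; rewrite enum_rankK.
Qed.

Let domainK_ball a : domainK a ->
  exists2 r : R, 0 < r & forall z, absv (z - a) < r -> domain (Some (iota z)).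
Proof.
have [r r0 rd] := domain_locally_constant => da; exists r => // z za.
exact/(rd _ _ za).1.
Qed.

Lemma form_continuous a : domainK a -> absv_continuous_at (fun z => w (iota z)) a.
Proof.
move=> da; have [/(_ _ affinoid_domain) wa _] := hw.
apply: (analytic_on_continuous isoI (wa _) (domainK_ball da)).
by move=> z dz; split; [exact: domain_Omega|move=> zN; apply: hDK; rewrite -zN].
Qed.

Lemma zeros_formE (z : line K) : domainK z -> S (Some (iota z)) <-> w (iota z) = 0.
Proof.
move=> dz; split=> [[Oz [A [z' [GA Az w0]]]]|w0].
  by have [_ /(_ _ _ _ GA Oz Az)] := hw; rewrite w0 mul0r => <-.
split; first exact: domain_Omega.
by exists 1%:M, (iota z); split => //; [exact: group1|exact: mobiusC1].
Qed.

Lemma zeros_form_invariant A z : G A -> S z -> S (mobiusC A z).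
Proof.
move=> GA [Oz [B [z' [GB Bz w0]]]]; split; first exact: Omega_invariant.
exists (B *m invmx A), z'; split => //; first by apply: groupM => //; exact: groupV.
by rewrite mobiusCM ?unitmx_inv ?GU// mobiusCK ?GU.
Qed.

Hypothesis hSK : K_rational iota S.

(** Here [s] ranges over [C], while continuity of [w] is known along [K]-points; rationality of the
    zeros makes a nearby zero a nearby [K]-point, where [w] does not vanish. *)
Lemma zeros_separated (u : line K) : domainK u -> ~ S (Some (iota u)) ->
  exists2 e : R, 0 < e &
    forall s, S (Some s) -> domain (Some s) -> e <= absv (s - iota u).
Proof.
move=> du Su; have wu : w (iota u) != 0 by apply/eqP => w0; apply/Su/zeros_formE.
have [r r0 rw] := absv_continuous_neq0 (form_continuous du) wu.
exists r => // s Ss ds; have [[s'|]// _ [Es]] := hSK Ss; subst s.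
rewrite leNgt; apply/negP; rewrite -rmorphB isoI => /rw.
by rewrite ((zeros_formE ds).1 Ss) eqxx.
Qed.

Context (F : P1 C -> P1 C) (hF : function_field iota G F).
Hypothesis hSF : S `<=` zero_set iota G F.

(** Where the value is finite the denominator of the coprime quotient is nonzero, and continuity
    passes to the quotient. *)
Lemma function_near (u : line K) c e : domainK u -> F (Some (iota u)) = Some c ->
  0 < e -> exists2 d : R, 0 < d & forall u', absv (u' - u) < d ->
    exists2 c', F (Some (iota u')) = Some c' & absv (c' - c) < e.
Proof.
move=> du Fu e0; have [hm _] := hF.
have [|h1 [h2 [a1 a2 _ hE]]] := hm _ affinoid_domain (fun z => @domain_Omega z).
  by exists (Some (iota u)).
have c1 := analytic_on_continuous isoI a1 (domainK_ball du).
have c2 := analytic_on_continuous isoI a2 (domainK_ball du).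
have [_] := hE _ du; rewrite Fu; case: eqVneq => // h20 [cE].
have [r r0 rd] := domainK_ball du.
have [r' r'0 rh] := absv_continuous_neq0 c2 h20.
have [d d0 dc] := absv_continuousM c1 (absv_continuousV h20 c2) e0.
exists (Num.min d (Num.min r r')); first by rewrite !lt_min d0 r0.
move=> u'; rewrite !lt_min => /and3P[/dc ud /rd ur /rh ur'].
have [_] := hE _ ur; rewrite (negbTE ur') => ->.
by eexists; [reflexivity|rewrite cE].
Qed.

Local Notation near := (near_poles iota G D S F).

Lemma near_poles_invariant A z z' : G A -> mobius A (Some z) = Some z' ->
  near z -> near z'.
Proof.
move=> GA Az [B [u [GB Uu Bu]]]; exists (A *m B), u; split => //; first exact: groupM.
by rewrite mobiusM ?GU// Bu.
Qed.

(** A pole is not a zero of [F], hence not in [S], so it belongs to its own neighbourhood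
    [U_nbhd]. *)
Lemma pole_near (u : line K) : domainK u -> F (Some (iota u)) = None -> near u.
Proof.
move=> du Fu; exists 1%:M, u; split; [exact: group1| |exact: mobius1].
split => //; first by move=> /hSF[_]; rewrite Fu.
exists (eval_point (iota u)) => //; exists u => //.
by split => //; split => //; exact: domain_Omega.
Qed.

Lemma near_poles_open z : near z ->
  exists2 r : R, 0 < r & forall z', absv (z' - z) < r -> near z'.
Proof.
move=> [A [u [GA Uu Au]]]; have radius0 b i : d_radius (D b i) != 0.
  by case: hD => _ + _ _ _; apply.
have [du Su _] := Uu.
have [r r0 rU] := U_nbhd_open isoI radius0 hDK (zeros_separated du Su) Uu.
have Az : mobius (invmx A) (Some z) = Some u by rewrite -Au mobiusK// GU.
have [|d d0 dz] := mobius_near_line _ Az r0; first by rewrite unitmx_inv GU.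
exists d => // z' /dz[u' Au' uu]; exists A, u'; split => //; first exact: rU.
by rewrite -Au' mobiusVK// GU.
Qed.

Local Notation kernel := (kernel_of_difference iota G D S F).

Lemma kernel_ge0 z : 0 <= kernel z.
Proof.
rewrite /kernel_of_difference; case: ifP => // _.
by case: F => [c|]//; exact: absv_ge0.
Qed.

(** The value of [F] and the cut-off are both invariant under the group, so questions about the
    kernel can be settled on the strict domain. *)
Let transport z : Omega (Some (iota z)) -> exists A u,
  [/\ G A, mobius A (Some z) = Some u, strict u,
      F (Some (iota u)) = F (Some (iota z)) & near u <-> near z].
Proof.
move=> Oz; have [A [u [GA Az su]]] := @Omega_strict (Some z) Oz.
exists A, u; split => //.
  by have [_ /(_ A _ GA Oz)] := hF; rewrite -[Some (iota z)]/(P1_inj (Some z)) -P1_inj_mobius Az.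
split; last exact: near_poles_invariant Az.
by apply: (near_poles_invariant (groupV subG GA)); rewrite -Az mobiusK ?GU.
Qed.

(** Compactness of the bounded domain: near a pole the kernel is cut off, and near any other point
    [|F|] is bounded by continuity. *)
Lemma kernel_bounded : exists M : R, forall z, kernel z <= M.
Proof.
pose P (A : set (line K)) := exists M : R, forall u c, A u -> domainK u -> ~ near u ->
  F (Some (iota u)) = Some c -> absv c <= M.
have [M0 dM0] := domain_bounded.
have [||||M PM] := @ball_induction _ _ _ _ _ hK P _ _ _ _ M0.
- by move=> A B AB [M PM]; exists M => u c /AB; exact: PM.
- by exists 0.
- move=> A B [M PM] [N PN]; exists (Num.max M N) => u c [Au|Bu] du nu Fu.
    by rewrite le_max (PM u c).
  by rewrite le_max (PN u c) ?orbT.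
- move=> a; have [r r0 rd] := domain_locally_constant.
  have [da|nda] := pselect (domainK a); last first.
    exists r => //; exists 0 => u c ua du; exfalso; apply: nda.
    exact/(rd _ _ ua).1.
  case Fa : (F (Some (iota a))) => [c|]; last first.
    have [r' r'0 nr] := near_poles_open (pole_near da Fa).
    by exists r' => //; exists 0 => u c /nr nu du /(_ nu).
  have [d d0 dc] := function_near da Fa ltr01.
  exists d => //; exists (absv c + 1) => u c' /dc[c'' -> cc] _ _ [<-].
  rewrite -(subrK c c'') absvD_le ?lerDl//.
  by rewrite (le_trans (ltW cc))// lerDr absv_ge0.
exists (Num.max 1 M) => z; rewrite /kernel_of_difference.
case: asboolP => [[Oz nz]|_]; last by rewrite le_max lexx.
have [A [u [GA Az [du _] FE nE]]] := transport Oz.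
case Fz : (F (P1_inj (Some z))) => [c|]; last by rewrite le_max lexx.
rewrite le_max (PM u c) ?orbT//; first exact: dM0.
- by move=> /nE.
- by rewrite FE.
Qed.

Let Omega_superlevel_open (a : R) : open ([set z | Omega (Some (iota z)) /\
  exists2 c, F (Some (iota z)) = Some c & a < absv c] : set (line K)).
Proof.
move=> z [Oz [c Fz ac]]; have [A [u [GA Az [du su] FE nE]]] := transport Oz.
(* A perturbation smaller than [|c|] leaves [|c|] unchanged; for [a < 0] every value qualifies. *)
have [e e0 ce] : exists2 e : R, 0 < e & forall c', absv (c' - c) < e -> a < absv c'.
  have [a0|a0] := ltP a 0.
    by exists 1 => // c' _; rewrite (lt_le_trans a0)// absv_ge0.
  exists (absv c); first exact: le_lt_trans a0 ac.
  by move=> c' cc; rewrite -(subrK c c') absvD_eqr.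
have [|d d0 dF] := @function_near u c e du _ e0; first by rewrite FE.
have [r r0 rd] := domain_locally_constant.
have dr0 : 0 < Num.min d r by rewrite lt_min d0.
have [d' d'0 dz] := mobius_near_line (GU GA) Az dr0.
exists d' => // z' /dz[u' Az']; rewrite lt_min => /andP[/dF[c' Fu' /ce ac'] ur].
have du' : domainK u' by exact/(rd _ _ ur).1.
have Oz' : Omega (Some (iota z')).
  have -> : Some (iota z') = mobiusC (invmx A) (Some (iota u')).
    rewrite -[Some (iota u')]/(P1_inj (Some u')) -P1_inj_mobius -Az' mobiusK ?GU//.
  by apply: Omega_translate => //; exact: groupV.
split => //; exists c' => //; rewrite -Fu'.
have [_ /(_ A _ GA Oz')] := hF; rewrite -[Some (iota z')]/(P1_inj (Some z')).
by rewrite -P1_inj_mobius Az'.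
Qed.

Lemma measurable_kernel_of_difference :
  measurable_fun setT (kernel : borel (line K) -> R).
Proof.
have omeas (U : set (line K)) : open U -> measurable (U : set (borel (line K))).
  exact: sub_sigma_algebra.
have mnear : measurable (near : set (borel (line K))).
  by apply: omeas; move=> z; exact: near_poles_open.
have mlevel (a : R) : measurable ([set z | Omega (Some (iota z)) /\
    exists2 c, F (Some (iota z)) = Some c & a < absv c] : set (borel (line K))).
  by apply: omeas; exact: Omega_superlevel_open.
apply: measurable_superlevel => a.
(* The bound [-1] always holds: [V] is the open set where [F] is defined and finite. Outside both
   [V] and the cut-off region only limit points remain, where the kernel is 1. *)
pose V : set (borel (line K)) := [set z | Omega (Some (iota z)) /\
  exists2 c, F (Some (iota z)) = Some c & -1 < absv c].
have VE z : ~ near z -> Omega (Some (iota z)) -> V z.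
  move=> nz Oz; split => //; have [A [u [GA Az [du _] FE nE]]] := transport Oz.
  case Fz : (F (Some (iota z))) => [c|].
    by exists c => //; rewrite (lt_le_trans _ (absv_ge0 _))// ltrN10.
  by case: nz; apply/nE/pole_near => //; rewrite FE.
rewrite (_ : [set z | _] = ([set z | Omega (Some (iota z)) /\
    exists2 c, F (Some (iota z)) = Some c & a < absv c] `&` ~` near) `|`
    ([set z : borel (line K) | a < 1] `&` (near `|` ~` V))).
  apply: measurableU; apply: measurableI => //.
  - exact: measurableC.
  - have [a1|a1] := boolP (a < 1).
      by rewrite (_ : [set z | _] = setT)//; apply/seteqP; split.
    by rewrite (_ : [set z | _] = set0)//; apply/seteqP; split.
  - by apply: measurableU => //; apply: measurableC; exact: mlevel.
apply/seteqP; split => z; rewrite /kernel_of_difference /=.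
  case: asboolP => [[Oz nz]|H] az.
    left; split => //; split => //; have [_ [c Fz _]] := VE z nz Oz.
    by exists c => //; move: az; rewrite Fz.
  right; split => //; have [nz|nz] := pselect (near z); [by left|right].
  by move=> [Oz _]; apply: H.
move=> [[[Oz [c Fz ac]] nz]|[a1 [nz|Vz]]]; case: asboolP => //.
- by rewrite Fz.
- by case.
- by case.
- by move=> [Oz nz]; case: Vz; exact: VE.
Qed.

(** * Haar measure on a ball containing the domain *)

Context (dx : {measure set (borel (line K)) -> \bar R}) (hdx : haar_measure dx).

Let open_measurable (T : ptopologicalType) (U : set T) :
  open U -> measurable (U : set (borel T)).
Proof. exact: sub_sigma_algebra. Qed.

Let real_continuousP (T : ptopologicalType) (h : T -> R) :
  (forall x e, 0 < e -> exists U V : set T, [/\ nbhs x U, nbhs x V &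
     forall y, U y -> V y -> `|h x - h y| < e]) -> continuous h.
Proof.
move=> hh x; apply/cvgrPdist_lt => e /(hh x)[U [V [nU nV UV]]].
by apply: filterS (filterI nU nV) => y [Uy Vy]; exact: UV.
Qed.

Let real_continuous_nbhs (T : ptopologicalType) (h : T -> R) x e :
  continuous h -> 0 < e -> nbhs x [set y | `|h x - h y| < e].
Proof. by move=> ch e0; have /cvgrPdist_lt := ch x; apply. Qed.

Let open_line (U : set (line K)) : line_open U -> open U. Proof. by []. Qed.

Let borel_measurable d (T : measurableType d) (Y : ptopologicalType) (h : T -> Y) :
  (forall U : set Y, open U -> measurable (h @^-1` U)) ->
  measurable_fun setT (h : T -> borel Y).
Proof.
move=> hU; apply: (@measurability _ _ T (borel Y) setT (h : T -> borel Y)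
  (@open Y : set (set (borel Y)))) => // _ [U oU <-].
by rewrite setTI; exact: hU.
Qed.

Let rad : R := `|projT1 (cid domain_bounded)| + 1.

Let rad0 : 0 < rad. Proof. by rewrite ltr_wpDl. Qed.

Let domain_rad z : domainK z -> absv z <= rad.
Proof.
move=> dz; rewrite /rad; case: cid => M /= /(_ _ dz) zM.
by rewrite (le_trans zM)// (le_trans (ler_norm M))// lerDl.
Qed.

(* A ball containing the domain; in the ultrametric setting it is a group. *)
Let Ball : set (borel (line K)) := [set z : line K | absv z <= rad].

Let cball_open (a : line K) (r : R) : 0 < r -> open [set z : line K | absv (z - a) <= r].
Proof.
move=> r0; apply: open_line => z za; exists r => // z' zz.
by rewrite /= -(subrKA z) absvD_le// ltW.
Qed.

Let oball_open (a : line K) (r : R) : 0 < r -> open [set z : line K | absv (z - a) < r].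
Proof. by move=> r0; apply: open_line => z za; exists r => // z' zz; exact: (absv_dist zz za). Qed.

Let mBall : measurable Ball.
Proof.
apply: open_measurable; have := @cball_open 0 _ rad0.
by rewrite (_ : [set z | _] = Ball)//; apply/seteqP; split => z; rewrite /Ball /= subr0.
Qed.

Let dxBall : (dx Ball < +oo)%E.
Proof.
case: hdx => dx1 dxT.
(* Asking for a measurable superset makes the property pass to arbitrary subsets, as
   [ball_induction] demands. *)
pose P (A : set (line K)) := exists B : set (borel (line K)),
  [/\ measurable B, A `<=` B & (dx B < +oo)%E].
have [|||a|B [mB AB fB]] := @ball_induction _ _ _ _ _ hK P _ _ _ _ rad.
- by move=> A B AB [B' [? BB' ?]]; exists B'; split => //; exact: subset_trans BB'.
- by exists set0; split; [exact: measurable0|exact: sub0set|rewrite measure0].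
- move=> A B [A' [mA' AA' fA']] [B' [mB' BB' fB']]; exists (A' `|` B'); split.
  + exact: measurableU.
  + exact: setUSS.
  + by apply: le_lt_trans (measureU2 _ mA' mB') _; rewrite lte_add_pinfty.
- have m1 : measurable ([set x : line K | absv x <= 1] : set (borel (line K))).
    apply: open_measurable; have := @cball_open 0 _ ltr01.
    by rewrite (_ : [set z | _] = [set x : line K | absv x <= 1])//; apply/seteqP; split => z; rewrite /= subr0.
  exists 1 => //; exists [set a + x | x in [set x : line K | absv x <= 1]]; split.
  + apply: open_measurable; rewrite (_ : [set _ | _ in _] = [set z : line K | absv (z - a) <= 1]).
      exact: cball_open.
    apply/seteqP; split => [_ [x x1 <-]|z za]; first by rewrite /= addrAC subrr add0r.
    by exists (z - a); rewrite ?subrKC// addrC subrK.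
  + by move=> z za; exists (z - a); [exact: ltW|rewrite addrC subrK].
  + by rewrite [X in (X < _)%E](dxT a _ m1) dx1 ltry.
- by apply: le_lt_trans fB; apply: le_measure; rewrite ?inE.
Qed.

(** The restriction is finite and stays invariant under translation by elements of [Ball]. *)
Let mu : {measure set (borel (line K)) -> \bar R} := mrestr dx mBall.

Let mu_fin : (mu setT < +oo)%E. Proof. by rewrite /mu/= /mrestr setTI. Qed.

Let translate (a : line K) : borel (line K) -> borel (line K) := fun z : line K => z + a.

Let measurable_translate a : measurable_fun setT (translate a).
Proof.
apply: borel_measurable => U oU; apply: open_measurable.
apply: open_line => z /oU[r r0 rU]; exists r => // z' zz; apply: rU.
by rewrite /translate opprD addrACA subrr addr0.
Qed.

Let mu_translate a (B : set (borel (line K))) : Ball a -> measurable B ->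
  mu (translate a @^-1` B) = mu B.
Proof.
case: hdx => _ dxT aB mB; rewrite /mu/= /mrestr.
rewrite -[RHS](dxT (- a) _ (measurableI _ _ mB mBall)); congr (dx _).
apply/seteqP; split => [z [Bz za]|_ [x [Bx xB] <-]].
  exists (z + a : line K); last by rewrite addrC addrK.
  by split => //; exact: absvD_le za aB.
split; first by rewrite /translate /= addrAC addNr add0r.
by apply: absvD_le => //; rewrite absvN.
Qed.

Let mu_integrable (h : line K -> R) (N : R) :
  measurable_fun setT (h : borel (line K) -> R) -> (forall z, `|h z| <= N) ->
  mu.-integrable setT (EFin \o (h : borel (line K) -> R)).
Proof.
move=> mh hN; apply: (@bounded_integrable _ _ _ _ _ N mu_fin).
  exact/measurable_EFinP.
by move=> z; rewrite lee_fin.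
Qed.

Let Rintegral_translate a (h : line K -> R) (N : R) : Ball a ->
  measurable_fun setT (h : borel (line K) -> R) -> (forall z, `|h z| <= N) ->
  \int[mu]_z h z = \int[mu]_z h (translate a z).
Proof.
move=> aB mh hN; rewrite /Rintegral; congr fine.
transitivity (\int[image_measure mu (measurable_translate a)]_z (h z)%:E)%E.
  by apply: eq_measure_integral => B mB _; apply/esym; exact: mu_translate.
rewrite [LHS](integral_pushforward (measurable_translate a)) ?preimage_setT//.
  exact/measurable_EFinP.
apply: (mu_integrable (N := N)) => //.
exact: (measurableT_comp mh (measurable_translate a)).
Qed.

Let normr_Rintegral_mu (h : line K -> R) (N : R) :
  measurable_fun setT (h : borel (line K) -> R) -> (forall z, `|h z| <= N) ->
  `|\int[mu]_z h z| <= N * fine (mu setT).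
Proof.
move=> mh hN; have hi := mu_integrable mh hN.
apply: le_trans (le_normr_Rintegral measurableT hi) _.
have N0 : 0 <= N := le_trans (normr_ge0 _) (hN 0).
rewrite -Rintegral_cst//; apply: le_Rintegral => //.
  apply: (mu_integrable (N := N)); first exact: measurableT_comp.
  by move=> z; rewrite normr_id.
apply: (@mu_integrable (cst N) N) => // z.
by rewrite ger0_norm.
Qed.

Definition real_continuous_at (h : line K -> R) (a : line K) :=
  forall e : R, 0 < e -> exists2 d : R, 0 < d &
    forall z, absv (z - a) < d -> `|h z - h a| < e.

Let real_uniform (h : line K -> R) :
  (forall a, real_continuous_at h a) -> (forall z, ~ Ball z -> h z = 0) ->
  forall e, 0 < e -> exists2 d : R, 0 < d &
    forall z z', absv (z' - z) < d -> `|h z' - h z| < e.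
Proof.
move=> ch h0 e e0; pose P (A : set (line K)) := exists2 d : R, 0 < d &
  forall z z', A z -> absv (z' - z) < d -> `|h z' - h z| < e.
have [|||a|d d0 hd] := @ball_induction _ _ _ _ _ hK P _ _ _ _ rad.
- by move=> A B AB [d d0 hd]; exists d => // z z' /AB; exact: hd.
- by exists 1.
- move=> A B [d d0 hd] [d' d'0 hd']; exists (Num.min d d'); first by rewrite lt_min d0.
  by move=> z z' [zA|zB]; rewrite lt_min => /andP[? ?]; [exact: hd|exact: hd'].
- have [|d d0 hd] := ch a (e / 2); first by rewrite divr_gt0.
  exists d => //; exists d => // z z' za zz.
  rewrite -(subrKA (h a)) (le_lt_trans (ler_normD _ _))// [e]splitr ltrD//.
    exact/hd/(absv_dist zz za).
  by rewrite distrC hd.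
(* A move shorter than [rad] does not leave or enter [Ball], so outside it both values are zero. *)
exists (Num.min d rad); first by rewrite lt_min d0.
move=> z z'; rewrite lt_min => /andP[zd zr].
have [Bz|nBz] := pselect (Ball z); first exact: hd.
rewrite !h0 ?subrr ?normr0// => Bz'; apply: nBz.
by rewrite /Ball /= -(subKr z' z) absvB_le// ltW.
Qed.

Let real_bounded (h : line K -> R) :
  (forall a, real_continuous_at h a) -> (forall z, ~ Ball z -> h z = 0) ->
  exists M : R, forall z, `|h z| <= M.
Proof.
move=> ch h0; pose P (A : set (line K)) := exists M : R, forall z, A z -> `|h z| <= M.
have [|||a|M hM] := @ball_induction _ _ _ _ _ hK P _ _ _ _ rad.
- by move=> A B AB [M hM]; exists M => z /AB; exact: hM.
- by exists 0.
- move=> A B [M hM] [N hN]; exists (Num.max M N) => z [/hM|/hN] h1.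
    by rewrite le_max h1.
  by rewrite le_max h1 orbT.
- have [d d0 hd] := ch a 1 ltr01; exists d => //; exists (`|h a| + 1) => z /hd hz.
  rewrite -(subrK (h a) (h z)) addrC (le_trans (ler_normD _ _))//.
  by rewrite lerD2l ltW.
exists (Num.max M 0) => z; have [Bz|nBz] := pselect (Ball z).
  by rewrite le_max hM.
by rewrite h0// normr0 le_max lexx orbT.
Qed.

Let real_measurable (h : line K -> R) : (forall a, real_continuous_at h a) ->
  measurable_fun setT (h : borel (line K) -> R).
Proof.
move=> ch; apply: measurable_superlevel => a; apply: open_measurable; apply: open_line => z az.
have [|d d0 hd] := ch z (h z - a); first by rewrite subr_gt0.
exists d => // z' /hd; rewrite ltr_distl => /andP[+ _].
by rewrite opprB addrC subrK.
Qed.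

(** * The curve as a subset of the line, and its measure as a density *)

Context (z0 : OmegaK_minus iota G S).
Local Notation X := (orbit_space G z0).
Let class := @orbit_class _ _ G _ z0.
Let repr (x : X) : line K := strict_repr D x.

Let class_surj (x : X) : exists v, x = class v.
Proof.
have := set_mem (valP x) => /= -[z Vz E].
by exists (exist _ z (mem_set Vz)); apply: val_inj.
Qed.

Let class_eq (v v' : OmegaK_minus iota G S) A :
  G A -> mobius A (val v) = val v' -> class v = class v'.
Proof.
move=> GA Av; apply: val_inj; apply/seteqP; split => _ [B GB <-] /=.
  exists (B *m invmx A); first by apply: groupM => //; exact: groupV.
  by rewrite -Av mobiusM ?unitmx_inv ?GU// mobiusK ?GU.
by exists (B *m A); [exact: groupM|rewrite mobiusM ?GU// Av].
Qed.

Let repr_class (v : OmegaK_minus iota G S) A u : G A -> mobius A (val v) = Some u -> strict u ->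
  repr (class v) = u.
Proof.
move=> GA Av su; rewrite /repr /strict_repr.
have [] := @xgetPex _ 0 [set z | strict z /\ val (class v) (Some z)].
  by exists u; split => //; exists A.
set z := xget _ _ => sz [B GB Bv]; apply: (@strict_inequivalent (A *m invmx B)) => //.
  by apply: groupM => //; exact: groupV.
by rewrite -Bv mobiusM ?unitmx_inv ?GU// mobiusK ?GU.
Qed.

Let class_strict (v : OmegaK_minus iota G S) :
  exists A u, [/\ G A, mobius A (val v) = Some u & strict u].
Proof. by apply: Omega_strict; have := set_mem (valP v) => -[]. Qed.

Let repr_spec x : [/\ strict (repr x), w (iota (repr x)) != 0 &
  exists2 v, val v = Some (repr x) & class v = x].
Proof.
have [v ->] := class_surj x; have [A [u [GA Av su]]] := class_strict v.
rewrite (repr_class GA Av su); have [du _] := su.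
have Su : ~ S (P1_inj (Some u)).
  move=> Su; have [_] := set_mem (valP v); apply.
  rewrite -(mobiusK (val v) (GU GA)) P1_inj_mobius Av.
  by apply: zeros_form_invariant => //; exact: groupV.
have Vu : OmegaK_minus iota G S (Some u) by split => //; exact: domain_Omega.
split => //; first by apply/eqP => w0; apply: Su; exact/zeros_formE.
exists (exist _ (Some u) (mem_set Vu)) => //.
apply/esym/class_eq; first exact: GA.
exact: Av.
Qed.

Let repr_inj x y : repr x = repr y -> x = y.
Proof.
have [_ _ [v vx cx]] := repr_spec x; have [_ _ [v' vy cy]] := repr_spec y => E.
by rewrite -cx -cy; congr (class _); apply: val_inj; rewrite vx vy E.
Qed.

Let repr_point z : strict z -> w (iota z) != 0 ->
  exists2 v, val v = Some z & repr (class v) = z.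
Proof.
move=> sz wz; have [dz _] := sz.
have Vz : OmegaK_minus iota G S (Some z).
  split; first exact: domain_Omega.
  by move=> /zeros_formE-/(_ dz); apply/eqP.
exists (exist _ (Some z) (mem_set Vz)) => //.
apply: (repr_class (group1 subG)) => //.
exact: mobius1.
Qed.

(** The element [A] bringing [v] into the strict domain does the same for nearby points, since [A]
    is continuous and the strict domain is a union of balls of fixed radius; locally [repr] is the
    action of [A]. *)
Let repr_open (U : set (line K)) : open U -> open (repr @^-1` U : set X).
Proof.
move=> oU; rewrite /open /= /orbit_space_open openE => v /= Uv.
have [A [u [GA Av su]]] := class_strict v.
move: Uv; rewrite (repr_class GA Av su) => /oU[e e0 eU].
have [r r0 rd] := domain_locally_constant.
have er0 : 0 < Num.min e r by rewrite lt_min e0.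
have nv : nbhs v (set_val @^-1` [set z' | exists2 u', mobius A z' = Some u' &
    absv (u' - u) < Num.min e r]).
  have nz := mobius_near (GU GA) Av er0.
  exact: (@initial_continuous _ _ (@set_val _ (OmegaK_minus iota G S)) v _ nz).
rewrite /interior; apply: (filterS _ nv) => v' [u' Av']; rewrite lt_min => /andP[ue ur].
have su' : strict u' by exact/(rd _ _ ur).2.
by rewrite /= (repr_class GA Av' su'); exact: eU.
Qed.

Let measurable_repr : measurable_fun setT (repr : borel X -> borel (line K)).
Proof.
apply: borel_measurable => U oU; apply: open_measurable; exact: repr_open.
Qed.

Let measurable_singleton (x : X) : measurable ([set x] : set (borel X)).
Proof.
rewrite (_ : [set x] = ~` (repr @^-1` [set z | z <> repr x])).
  apply: measurableC; apply: open_measurable; apply: repr_open.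
  apply: open_line => z zx; exists (absv (z - repr x)).
    by rewrite absv_gt0 subr_eq0; apply/eqP.
  by move=> z' zz E; move: zz; rewrite E absvBC ltxx.
apply/seteqP; split => [_ -> /=|y /= /contrapT /repr_inj//]; exact.
Qed.

Let class_near (v : OmegaK_minus iota G S) (z : line K) (U : set X) :
  val v = Some z -> open U -> U (class v) ->
  exists2 d : R, 0 < d & forall z' v', absv (z' - z) < d -> val v' = Some z' -> U (class v').
Proof.
move=> vz oU Uv.
have [P' [oP iP] E] : exists2 P' : set (P1 K), open P' & set_val @^-1` P' = class @^-1` U.
  exact: oU.
have Pz : P' (Some z) by rewrite -vz; have : (class @^-1` U) v by []; rewrite -E.
have [d d0 dP] := oP _ Pz; exists d => // z' v' /dP zP vz'.
have : (set_val @^-1` P') v' by rewrite /= [set_val v']vz'.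
by rewrite E.
Qed.

(** Extension by zero costs no continuity, as the strict domain is open and closed in [K]. *)
Let form (z : line K) : line C := if `[< strict z >] then w (iota z) else 0.

Let form_notin z : ~ Ball z -> form z = 0.
Proof.
move=> nB; rewrite /form; case: asboolP => // -[dz _].
by case: nB; exact: domain_rad.
Qed.

Let form_neq0 z : form z != 0 -> strict z /\ w (iota z) != 0.
Proof. by rewrite /form; case: asboolP => //; rewrite eqxx. Qed.

Let form_cont a : absv_continuous_at form a.
Proof.
have [r r0 rd] := domain_locally_constant.
have [sa|nsa] := pselect (strict a).
  apply: (absv_continuous_near r0) (form_continuous sa.1) => z za.
  by rewrite /form; case: asboolP => // -[]; exact/(rd _ _ za).2.
apply: (absv_continuous_near r0) (absv_continuous_cst 0 a) => z za.
by rewrite /form; case: asboolP => // /((rd _ _ za).2).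
Qed.

Let dens (z : line K) : R := absv (form z).

Let dens_ge0 z : 0 <= dens z. Proof. exact: absv_ge0. Qed.

Let dens_notin z : ~ Ball z -> dens z = 0.
Proof. by move=> /form_notin E; rewrite /dens E absv0. Qed.

Let dens_cont a : real_continuous_at dens a.
Proof.
move=> e /(form_cont a)[d d0 hd]; exists d => // z /hd h.
have ub (x y : line C) : absv (x - y) < e -> absv x < absv y + e.
  move=> xy; rewrite -(subrK y x) (le_lt_trans (absvD _ _))// gt_max.
  by rewrite ltr_wpDl ?absv_ge0//= ltrDl (le_lt_trans (absv_ge0 _) h).
rewrite ltr_distl ltrBlDr; apply/andP; split; last exact: ub.
by apply: ub; rewrite absvBC.
Qed.

Let mdens : measurable_fun setT (dens : borel (line K) -> R).
Proof. by apply: real_measurable; exact: dens_cont. Qed.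

Context (nu : {measure set (borel X) -> \bar R}) (hnu : abs_form_measure w dx nu).

Let support : set (borel (line K)) := [set z | form z != 0].

Let msupport : measurable support.
Proof.
apply: open_measurable; apply: open_line => z fz.
by have [r r0 rz] := absv_continuous_neq0 (form_cont z) fz; exists r.
Qed.

Let pullback_class (B : set (line K)) : B `<=` support ->
  repr @^-1` B = class @` [set v | exists2 z, B z & val v = Some z].
Proof.
move=> BE; apply/seteqP; split => [x Bx|_ [v [z Bz vz] <-]].
  have [_ _ [v vx <-]] := repr_spec x.
  by exists v => //; exists (repr x).
have [sz wz] := form_neq0 (BE _ Bz).
have E : repr (class v) = z.
  by apply: (repr_class (group1 subG) _ sz); rewrite vz mobius1.
by rewrite /= E.
Qed.

(** Points where [form] is nonzero are pairwise inequivalent and avoid [S], so [hnu] applies to that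
    part of [B]. All representatives lie in it, and off it the density is zero. *)
Let nu_repr (B : set (borel (line K))) : measurable B ->
  image_measure nu measurable_repr B = (\int[mu]_(z in B) (dens z)%:E)%E.
Proof.
move=> mB; have mBE : measurable (B `&` support) by exact: measurableI.
transitivity (nu (repr @^-1` (B `&` support))).
  rewrite [LHS]/(nu _); congr (nu _); apply/seteqP; split => x; last by case.
  move=> Bx; split => //; have [sx wx _] := repr_spec x.
  by rewrite /support /= /form; case: asboolP.
rewrite pullback_class; last exact: subIsetr.
have := hnu mBE; move=> H; rewrite [LHS]H; last 2 first.
- move=> _ [z [_ /form_neq0[sz wz]] <-].
  by have [v vz _] := repr_point sz wz; rewrite -vz; exact: set_mem (valP v).
- move=> v v' /set_mem[z [_ /form_neq0[sz wz]] vz] /set_mem[z' [_ /form_neq0[sz' wz']] vz'] E.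
  apply: val_inj; rewrite vz vz'; congr Some.
  rewrite -(@repr_class v 1%:M z (group1 subG) _ sz); last by rewrite vz mobius1.
  have E' : class v = class v' := E.
  by rewrite E' (@repr_class v' 1%:M z' (group1 subG) _ sz')// vz' mobius1.
rewrite [RHS]integral_mkcond.
rewrite (@ge0_integral_density _ _ _ dx mu (\1_Ball)); first last.
- by move=> z; apply: erestrict_ge0 => y _; rewrite lee_fin.
- apply/(measurable_restrictT _ mB); apply: measurable_funTS.
  by apply/measurable_EFinP.
- move=> A mA; rewrite integral_indic// setIC.
  by rewrite /mu/= /mrestr.
- by move=> z; rewrite indicE.
- exact: measurable_indic.
rewrite [LHS]integral_mkcond; apply: eq_integral => z _.
rewrite !patchE indicE /dens.
have [zB|zB] := boolP (z \in B); last first.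
  rewrite mul0e (_ : (z \in B `&` support) = false)//.
  by apply/negbTE; apply: contra zB => /set_mem[+ _]; rewrite inE.
have [zE|zE] := boolP (z \in B `&` support); last first.
  have -> : form z = 0.
    by apply/eqP; apply: contraNT zE => fz; rewrite inE; split => //; exact: set_mem.
  by rewrite absv0 mul0e.
have [_ fz] := set_mem zE; have [sz wz] := form_neq0 fz.
rewrite (_ : z \in Ball) ?mule1; last by rewrite inE; exact/domain_rad/sz.1.
by rewrite /form; case: asboolP.
Qed.

Let dens_bounded : exists M : R, forall z, dens z <= M.
Proof.
have [M hM] := real_bounded dens_cont dens_notin; exists M => z.
exact: le_trans (ler_norm _) (hM z).
Qed.

Let nu_fin : (nu setT < +oo)%E.
Proof.
have -> : nu setT = (\int[mu]_z (dens z)%:E)%E.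
  by transitivity (image_measure nu measurable_repr setT); [|exact: nu_repr].
have [M hM] := real_bounded dens_cont dens_notin.
have /integrableP[_] := mu_integrable mdens hM.
by under eq_integral do rewrite /= ger0_norm//.
Qed.

Let Rintegral_repr (h : line K -> R) (N : R) :
  measurable_fun setT (h : borel (line K) -> R) -> (forall z, `|h z| <= N) ->
  \int[nu]_y h (repr y) = \int[mu]_z (h z * dens z).
Proof.
move=> mh hN.
rewrite -(@Rintegral_density _ _ _ mu (image_measure nu measurable_repr) dens
  mdens dens_ge0 nu_repr mu_fin dens_bounded h N mh hN).
rewrite /Rintegral; congr fine.
rewrite [RHS](integral_pushforward measurable_repr) ?preimage_setT//.
  exact/measurable_EFinP.
apply: (@bounded_integrable _ _ _ _ _ N nu_fin).
  by apply/measurable_EFinP; exact: (measurableT_comp mh measurable_repr).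
by move=> z; rewrite lee_fin.
Qed.

Let Bsub (x : X) : Ball (repr x).
Proof. by apply: domain_rad; have [[]] := repr_spec x. Qed.

(** * The Laplacian preserves continuity *)

Section Observable.
Variables (psi : X -> R) (N : R).
Hypotheses (cpsi : continuous psi) (psiN : forall x, `|psi x| <= N).

Let sec (z : line K) : X := xget (class z0) [set x | repr x = z].

Let secK x : sec (repr x) = x.
Proof.
apply: repr_inj; exact: (@xgetPex _ (class z0) [set y | repr y = repr x] (ex_intro _ x erefl)).
Qed.

(** [psi] read on the line. Off the support no continuity is claimed; the value 0 keeps the bound
    [N]. *)
Let lift (z : line K) : R := if form z != 0 then psi (sec z) else 0.

Let lift_repr x : lift (repr x) = psi x.
Proof.
rewrite /lift secK; have [sx wx _] := repr_spec x.
by rewrite /form; case: asboolP => // _; rewrite wx.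
Qed.

Let lift_bound z : `|lift z| <= N.
Proof.
rewrite /lift; case: ifP => // _; rewrite normr0.
exact: le_trans (normr_ge0 _) (psiN point).
Qed.

Let lift_cont a : form a != 0 -> real_continuous_at lift a.
Proof.
move=> fa e e0; have [sa wa] := form_neq0 fa.
have [v va ra] := repr_point sa wa.
have oU : open [set x | `|psi x - psi (class v)| < e].
  rewrite (_ : [set x | _] = psi @^-1` [set y | `|y - psi (class v)| < e]).
    have /continuousP := cpsi; apply.
    rewrite (_ : [set y | _] = ball (psi (class v)) e); first exact: ball_open.
    by apply/seteqP; split => y; rewrite /ball /= distrC.
  by [].
have [|d d0 hd] := class_near va oU; first by rewrite /= subrr normr0.
have [r r0 rz] := absv_continuous_neq0 (form_cont a) fa.
exists (Num.min d r); first by rewrite lt_min d0.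
move=> z; rewrite lt_min => /andP[zd /rz fz]; have [sz wz] := form_neq0 fz.
have [v' vz rv] := repr_point sz wz.
rewrite -{1}rv -{1}ra !lift_repr; exact: hd zd vz.
Qed.

Let mlift : measurable_fun setT (lift : borel (line K) -> R).
Proof.
apply: measurable_superlevel => a.
rewrite (_ : [set z | _] = [set z | form z != 0 /\ a < lift z] `|`
    ([set z : borel (line K) | a < 0] `&` ~` support)).
  apply: measurableU.
    apply: open_measurable; apply: open_line => z [fz az].
    have [r r0 rz] := absv_continuous_neq0 (form_cont z) fz.
    have [|d d0 hd] := @lift_cont z fz (lift z - a); first by rewrite subr_gt0.
    exists (Num.min d r); first by rewrite lt_min d0.
    move=> z'; rewrite lt_min => /andP[/hd + /rz ?]; rewrite ltr_distl => /andP[+ _].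
    by rewrite opprB addrC subrK.
  apply: measurableI; last exact: measurableC.
  have [a1|a1] := boolP (a < 0).
    by rewrite (_ : [set z | _] = setT)//; apply/seteqP; split.
  by rewrite (_ : [set z | _] = set0)//; apply/seteqP; split.
apply/seteqP; split => z /=.
  have [f0|f0] := eqVneq (form z) 0; last by left.
  by rewrite /lift f0 eqxx => a0; right; split => //; rewrite /support /= f0 eqxx.
by case=> [[]//|[a0 /negP]]; rewrite /support /= negbK /lift => /eqP ->; rewrite eqxx.
Qed.

Let mass (z : line K) : R := lift z * dens z.

Let mass_notin z : ~ Ball z -> mass z = 0.
Proof. by move=> /dens_notin E; rewrite /mass E mulr0. Qed.

(** Where [form] vanishes [lift] may jump, but it is bounded and the density tends to 0; elsewhere
    both factors are continuous. *)
Let mass_cont a : real_continuous_at mass a.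
Proof.
move=> e e0; have N0 : 0 <= N := le_trans (normr_ge0 _) (psiN point).
have N1 : 0 < N + 1 by rewrite ltr_wpDl.
have [f0|fa] := eqVneq (form a) 0.
  have [|d d0 hd] := @dens_cont a (e / (N + 1)); first by rewrite divr_gt0.
  have da : dens a = 0 by rewrite /dens f0 absv0.
  exists d => // z /hd; rewrite /mass da mulr0 !subr0 => h.
  rewrite normrM; apply: le_lt_trans (_ : _ <= (N + 1) * `|dens z|) _.
    by rewrite ler_wpM2r// (le_trans (lift_bound z))// lerDl.
  by rewrite mulrC -ltr_pdivlMr.
have D1 : 0 < `|dens a| + 1 by rewrite ltr_wpDl.
have [|d d0 hd] := @lift_cont a fa (e / 2 / (`|dens a| + 1)).
  by rewrite !divr_gt0.
have [|d' d'0 hd'] := @dens_cont a (e / 2 / (N + 1)); first by rewrite !divr_gt0.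
exists (Num.min d d'); first by rewrite lt_min d0.
move=> z; rewrite lt_min => /andP[/hd h1 /hd' h2].
have -> : mass z - mass a = lift z * (dens z - dens a) + (lift z - lift a) * dens a.
  by rewrite /mass; ring.
rewrite (le_lt_trans (ler_normD _ _))// [e]splitr ltrD// normrM.
  apply: le_lt_trans (_ : _ <= (N + 1) * `|dens z - dens a|) _.
    by rewrite ler_wpM2r// (le_trans (lift_bound z))// lerDl.
  by rewrite mulrC -ltr_pdivlMr.
apply: le_lt_trans (_ : _ <= `|lift z - lift a| * (`|dens a| + 1)) _.
  by rewrite ler_wpM2l// lerDl.
by rewrite -ltr_pdivlMr.
Qed.

Let kap := kernel.

Let mkap : measurable_fun setT (kap : borel (line K) -> R).
Proof. exact: measurable_kernel_of_difference. Qed.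

Let msub (a : line K) : measurable_fun setT ((fun z => a - z) : borel (line K) -> borel (line K)).
Proof.
apply: borel_measurable => U oU; apply: open_measurable; apply: open_line => z /oU[r r0 rU].
exists r => // z' zz; apply: rU.
by rewrite opprD opprK addrACA subrr add0r addrC absvBC.
Qed.

Let lap (x : X) : R := laplacian D F nu psi x.

(** The integrand after replacing the integration variable by [z + repr x]: the argument
    [repr x - (z + repr x)] of the kernel becomes [- z]. *)
Let net (x : X) (z : line K) : R := kap (- z) *
  (mass (z + repr x : line K) - psi x * dens (z + repr x : line K)).

Let mnet_bounds x M : (forall z, kap z <= M) ->
  measurable_fun setT (net x : borel (line K) -> R).
Proof.
move=> kM; apply: measurable_funM.
  apply: (measurableT_comp mkap).
  by have := @msub 0; under eq_fun do rewrite sub0r.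
apply: measurable_funB.
  by apply: (measurableT_comp (real_measurable mass_cont)); exact: (measurable_translate (repr x)).
apply: measurable_funM => //.
by apply: (measurableT_comp mdens); exact: (measurable_translate (repr x)).
Qed.

(* Translating the variable moves the dependence on x from the merely
   measurable kernel to the continuous density. *)
Let laplacianE x : lap x = \int[mu]_z net x z.
Proof.
have [M kM] := kernel_bounded; have [Md dM] := dens_bounded.
have kb z : `|kap z| <= M by rewrite ger0_norm// kernel_ge0.
have [Nm hm] := real_bounded mass_cont mass_notin.
have mk : measurable_fun setT ((fun z => kap (repr x - z)) : borel (line K) -> R).
  by apply: (measurableT_comp mkap); exact: msub.
transitivity (\int[nu]_y (fun z => kap (repr x - z) * (lift z - psi x)) (repr y)).
  by apply: eq_Rintegral => y _; rewrite /kernelH lift_repr.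
rewrite (@Rintegral_repr (fun z => kap (repr x - z) * (lift z - psi x)) (M * (N + N))); first last.
- move=> z; rewrite normrM; apply: ler_pM => //.
  by apply: le_trans (ler_normB _ _) _; exact: lerD.
- by apply: measurable_funM => //; exact: measurable_funB.
rewrite (@Rintegral_translate (repr x)
  (fun z => kap (repr x - z) * (lift z - psi x) * dens z) (M * (N + N) * Md)); first last.
- move=> z; rewrite normrM; apply: ler_pM => //; last by rewrite ger0_norm.
  rewrite normrM; apply: ler_pM => //.
  by apply: le_trans (ler_normB _ _) _; exact: lerD.
- apply: measurable_funM => //; apply: measurable_funM => //; exact: measurable_funB.
- exact: Bsub.
apply: eq_Rintegral => z _; rewrite /net /translate opprD addrCA subrr addr0.
by rewrite /mass -mulrA; congr (_ * _); ring.
Qed.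

(** In [laplacianE] the point enters through [psi x] and through translates of [mass] and [dens],
    which are uniformly continuous; the kernel contributes only its bound. *)
Lemma laplacian_continuous : continuous (laplacian D F nu psi).
Proof.
have [M kM] := kernel_bounded; have [Md dM] := dens_bounded.
have kb z : `|kap z| <= M by rewrite ger0_norm// kernel_ge0.
have [Nm hm] := real_bounded mass_cont mass_notin.
have M0 : 0 <= M := le_trans (normr_ge0 _) (kb 0).
have N0 : 0 <= N := le_trans (normr_ge0 _) (psiN point).
have Md0 : 0 <= Md := le_trans (dens_ge0 0) (dM 0).
have netb x z : `|net x z| <= M * (Nm + N * Md).
  rewrite normrM; apply: ler_pM => //; apply: le_trans (ler_normB _ _) _.
  apply: lerD => //; rewrite normrM; apply: ler_pM => //; by rewrite ger0_norm.
apply: real_continuousP => x e e0.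
pose mm := fine (mu setT); have mm0 : 0 <= mm by rewrite fine_ge0.
(* [1], [Md] and [N] weigh the variations of [mass], [psi] and [dens] in the integrand, [mm] is the
   total mass, and the final 1 makes [c] positive. *)
pose c := M * (1 + Md + N) * mm + 1.
have c0 : 0 < c by rewrite ltr_wpDl// !mulr_ge0// !addr_ge0.
pose eta := e / c; have eta0 : 0 < eta by rewrite divr_gt0.
have [d d0 hd] := real_uniform mass_cont mass_notin eta0.
have [d' d'0 hd'] := real_uniform dens_cont dens_notin eta0.
have dd0 : 0 < Num.min d d' by rewrite lt_min d0.
have near_r : nbhs x [set y | absv (repr y - repr x) < Num.min d d'].
  apply: open_nbhs_nbhs; split; last by rewrite /= subrr absv0.
  by have := repr_open (@oball_open (repr x) _ dd0).
have near_psi : nbhs x [set y | `|psi x - psi y| < eta].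
  exact: real_continuous_nbhs.
exists [set y | absv (repr y - repr x) < Num.min d d'],
  [set y | `|psi x - psi y| < eta]; split => // y ry py.
rewrite -!/(lap _) !laplacianE -RintegralB//; last 2 first.
- by apply: (mu_integrable (N := M * (Nm + N * Md))) => //; exact: mnet_bounds kM.
- by apply: (mu_integrable (N := M * (Nm + N * Md))) => //; exact: mnet_bounds kM.
have bound z : `|net x z - net y z| <= M * (1 + Md + N) * eta.
  move: ry; rewrite /= lt_min => /andP[ry ry'].
  have tr : (z + repr x : line K) - (z + repr y : line K) = repr x - repr y.
    by rewrite opprD addrACA subrr add0r.
  have h1 : `|mass (z + repr x : line K) - mass (z + repr y : line K)| <= eta.
    by rewrite ltW// hd// tr absvBC.
  have h2 : `|dens (z + repr x : line K) - dens (z + repr y : line K)| <= eta.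
    by rewrite ltW// hd'// tr absvBC.
  rewrite /net -mulrBr normrM -mulrA; apply: ler_pM => //.
  set m1 := mass _ in h1 *; set m2 := mass _ in h1 *.
  set r1 := dens _ in h2 *; set r2 := dens _ in h2 *.
  have -> : m1 - psi x * r1 - (m2 - psi y * r2) =
      (m1 - m2) - (psi x - psi y) * r2 - psi x * (r1 - r2) by ring.
  have -> : (1 + Md + N) * eta = eta + Md * eta + N * eta by ring.
  apply: le_trans (ler_normB _ _) _; apply: lerD.
    apply: le_trans (ler_normB _ _) _; apply: lerD => //.
    rewrite normrM mulrC; apply: ler_pM => //; last exact: ltW.
    by rewrite /r2 ger0_norm// dM.
  by rewrite normrM; apply: ler_pM.
apply: le_lt_trans (_ : M * (1 + Md + N) * eta * mm < _).
  apply: normr_Rintegral_mu bound.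
  by apply: measurable_funB; exact: mnet_bounds kM.
rewrite -[ltRHS](divfK (lt0r_neq0 c0)) -/eta mulrAC mulrC ltr_pM2l//.
by rewrite /c ltrDl.
Qed.

End Observable.

Let kernelH_net (e : R) : 0 < e ->
  exists s : seq (line K), forall z, Ball z -> exists2 c, c \in s & absv (z - c) < e.
Proof.
move=> e0; pose P (A : set (line K)) := exists s : seq (line K),
  forall z, A z -> exists2 c, c \in s & absv (z - c) < e.
have [|||a|s hs] := @ball_induction _ _ _ _ _ hK P _ _ _ _ rad.
- by move=> A B AB [s hs]; exists s => z /AB; exact: hs.
- by exists [::].
- move=> A B [s hs] [t ht]; exists (s ++ t) => z [/hs|/ht] [c cs zc]; exists c => //;
  by rewrite mem_cat cs ?orbT.
- by exists e => //; exists [:: a] => z za; exists a; rewrite ?mem_head.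
- by exists s.
Qed.

(* The topology of the ball has a countable basis, so that subtraction is
   measurable for the product sigma-algebra. *)
Let measurable_kernelH : measurable_fun setT
  (fun z : borel X * borel X => kernelH D F (z.1 : X) (z.2 : X)).
Proof.
apply: (measurableT_comp measurable_kernel_of_difference).
apply: borel_measurable => U oU.
have pe n : 0 < absv (pi ^+ n) by rewrite absv_gt0 expf_neq0// (uniformizer_neq0 hK).
have /choice[s hs] n := kernelH_net (pe n).
(* If the ball about [c - d] lies in [U], so do all differences of points of the balls about [c] and
   [d], by the ultrametric inequality. Finitely many centres at each level make the union
   countable. *)
pose good n (c d : line K) := forall t, absv (t - (c - d)) < absv (pi ^+ n) -> U t.
pose b n (c : line K) := repr @^-1` [set z : line K | absv (z - c) < absv (pi ^+ n)].
have mb n c : measurable (b n c : set (borel X)).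
  rewrite -[X in measurable X]setTI; apply: measurable_repr => //.
  by apply: open_measurable; apply: oball_open; exact: pe.
rewrite (_ : _ @^-1` U = \bigcup_n \bigcup_i \bigcup_(j in [set j |
    good n (nth 0 (s n) i) (nth 0 (s n) j)])
    (b n (nth 0 (s n) i) `*` b n (nth 0 (s n) j))).
  apply: bigcup_measurable => n _; apply: bigcup_measurable => i _.
  by apply: bigcup_measurable => j _; apply: measurableX.
apply/seteqP; split => [[x y] /= Uxy|[x y] [n _ [i _ [j gj [/= bx by_]]]]]; last first.
  have E : repr x - repr y - ((s n)`_i - (s n)`_j) =
      (repr x - (s n)`_i) - (repr y - (s n)`_j) by ring.
  by apply: gj; rewrite [X in absv X]E; exact: absvB_lt.
have [e e0 eU] := oU _ Uxy; have [n ne] := uniformizer_small hK e0.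
have [c cs xc] := hs n _ (Bsub x); have [d ds yd] := hs n _ (Bsub y).
exists n => //; exists (index c (s n)) => //; exists (index d (s n)); last first.
  by split; rewrite /b /= nth_index.
rewrite /= /good !nth_index// => t tcd; apply: eU; apply: lt_trans ne.
apply: absv_dist tcd _; rewrite absvBC.
have E : repr x - repr y - (c - d) = (repr x - c) - (repr y - d) by ring.
by rewrite [X in absv X]E; exact: absvB_lt.
Qed.

Lemma laplacian_process : exists P : R -> X -> probability (borel X) R,
  (forall h0 : X -> R, bounded_continuous h0 ->
     let h := fun (t : R) (x : X) => \int[P t x]_y h0 y in
     cauchy_solution (laplacian D F nu) h0 h /\
     forall h' : R -> X -> R,
       cauchy_solution (laplacian D F nu) h0 h' ->
       forall t x, 0 <= t -> h' t x = h t x) /\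
  transition_function P /\
  exists (d : measure_display) (W : measurableType d)
      (Px : X -> probability W R) (Y : R -> W -> X),
    markov_process P Px Y /\ right_continuous_with_jumps Y.
Proof.
have [M kM] := kernel_bounded.
have [Q [lam [lam0 LE]]] := @jump_kernel_exists R X nu
  (fun x y => kernelH D F x y) M nu_fin measurable_kernelH
  (fun x y => kernel_ge0 _) (fun x y => kM _).
apply: (@jump_process_exists R X Q lam) => //.
- move=> psi bpsi; rewrite -(LE _ bpsi); case: bpsi => cpsi [N psiN].
  exact: (laplacian_continuous cpsi psiN).
Qed.

End MumfordCurve.

Theorem theorem2
  (R : realType)
  (K : nafield R) (p f : nat) (pi : line K) (hK : local_field p f pi)
  (C : nafield R) (iota : {rmorphism line K -> line C})
  (hC : completed_closure iota)
  (dx : {measure set (borel (line K)) -> \bar R}) (hdx : haar_measure dx)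
  (G : set 'M[line K]_2) (hG : schottky iota G)
  (g : nat) (hg : (2 <= g)%N) (gam : 'I_g -> 'M[line K]_2)
  (D : bool -> 'I_g -> disc K) (hD : good_domain iota G gam D)
  (hDK : ~ domain iota D None)
  (w : line C -> line C) (hw : regular_differential iota G w)
  (F : P1 C -> P1 C) (hF : function_field iota G F)
  (S := zeros_form iota G w)
  (hSF : S `<=` zero_set iota G F)
  (hSK : K_rational iota S)
  (hVK : K_rational iota (zero_set iota G F))
  (hPK : K_rational iota (pole_set iota G F))
  (z0 : OmegaK_minus iota G S)
  (X := orbit_space G z0)
  (nu : {measure set (borel X) -> \bar R}) (hnu : abs_form_measure w dx nu) :
  exists P : R -> X -> probability (borel X) R,
    (forall h0 : X -> R, bounded_continuous h0 ->
       let h := fun (t : R) (x : X) => \int[P t x]_y h0 y in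
       cauchy_solution (laplacian D F nu) h0 h /\
       forall h' : R -> X -> R,
         cauchy_solution (laplacian D F nu) h0 h' ->
         forall t x, 0 <= t -> h' t x = h t x) /\
    transition_function P /\
    exists (d : measure_display) (W : measurableType d)
        (Px : X -> probability W R) (Y : R -> W -> X),
      markov_process P Px Y /\ right_continuous_with_jumps Y.
Proof.
case: hC => isoI _ _ _; case: hG => subG _ _ _.
exact: (laplacian_process hK isoI subG (ltnW hg) hD hDK hw hSK hF hSF hdx hnu).
Qed.
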